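(* Let $\hbar>0$, $m>0$, and let $\omega,\theta\in\mathbb{R}$ with $\omega>|\theta|$. Let $u$, with $u(\cdot,t)\in\mathcal{S}(\mathbb{R}^2)$, be the solution of the Schrödinger equation $$i\hbar\frac{\partial u}{\partial t}(x,t)=\left(-\frac{\hbar^2}{2m}\Delta-i\hbar\,\theta x_2\frac{\partial}{\partial x_1}+\frac{m\omega^2}{2}\left(x_1^2+x_2^2\right)\right)u(x,t),\qquad x=(x_1,x_2)\in\mathbb{R}^2.$$ Suppose that at time $t=0$ and at time $t=T$ the solution satisfies, for all $x\in\mathbb{R}^2$, $$|u(x,0)|\le Ke^{-\alpha|x|^2}\quad\text{and}\quad|u(x,T)|\le Ke^{-\beta|x|^2}$$ for some constants $\alpha,\beta,K>0$. Let $\lambda_1=\sqrt{\omega(\omega+\theta)}$, $\lambda_2=\sqrt{\omega(\omega-\theta)}$, and define $\Gamma_+(T)$ and $\Gamma_-(T)$ by $$\begin{aligned} 2(2m\omega)^2\,\Gamma_{\pm}(T):={}&\frac{\omega^4+\lambda_1^4}{\omega^2\lambda_1^2}\sin^2(\lambda_1T)+\frac{\omega^4+\lambda_2^4}{\omega^2\lambda_2^2}\sin^2(\lambda_2T)\\ &+2\,\frac{\omega^4+(\lambda_1\lambda_2)^2}{\omega^2\lambda_1\lambda_2}\sin(\lambda_1T)\sin(\lambda_2T)+2\big(\cos(\lambda_1T)-\cos(\lambda_2T)\big)^2\\ &\pm\left|\frac{\omega^2-\lambda_1^2}{\omega\lambda_1}\sin(\lambda_1T)+\frac{\omega^2-\lambda_2^2}{\omega\lambda_2}\sin(\lambda_2T)\right|\\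 &\quad\cdot\left(\left(\frac{\omega^2+\lambda_1^2}{\omega\lambda_1}\sin(\lambda_1T)+\frac{\omega^2+\lambda_2^2}{\omega\lambda_2}\sin(\lambda_2T)\right)^2+4\big(\cos(\lambda_1T)-\cos(\lambda_2T)\big)^2\right)^{\frac12}. \end{aligned}$$ If $\Gamma_+(T)\neq0$, $\Gamma_-(T)\ne0$, and $\alpha\beta(2\hbar)^2\,\Gamma_+(T)>1$, then $u\equiv0$.
   Context: $\mathcal{S}(\mathbb{R}^2)$ is the Schwartz space and $\Delta$ is the Laplacian in $x\in\mathbb{R}^2$. *)

(* Defs.v *)
From mathcomp Require Import all_boot all_order all_algebra.
From mathcomp Require Import all_classical all_reals all_analysis.
From mathcomp Require Import complex.

Set Implicit Arguments.
Unset Strict Implicit.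
Unset Printing Implicit Defensive.

Import Order.TTheory GRing.Theory Num.Theory.
Import numFieldNormedType.Exports.

Local Open Scope classical_set_scope.
Local Open Scope complex_scope.
Local Open Scope ring_scope.

(* [R[i]] carries no normed-module structure over [R] in the library, so
   real derivatives of complex-valued functions are taken componentwise. *)
Section ComplexValuedDerivatives.
Context {R : realType} {V : normedModType R}.
Implicit Types (f : V -> R[i]) (x v : V).

Definition cderivable f x v : Prop :=
  derivable (fun y => complex.Re (f y)) x v /\
  derivable (fun y => complex.Im (f y)) x v.

Definition cdifferentiable f x : Prop :=
  differentiable (fun y => complex.Re (f y)) x /\
  differentiable (fun y => complex.Im (f y)) x.

Definition cderive v f x : R[i] :=
  'D_v (fun y => complex.Re (f y)) x +i* 'D_v (fun y => complex.Im (f y)) x.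

End ComplexValuedDerivatives.

Section EuclideanSpace.
Context {R : realType} {n : nat}.
Implicit Types (f : 'rV[R]_n.+1 -> R[i]) (x : 'rV[R]_n.+1).

(* The library norm of a row vector is the sup norm, hence this definition. *)
Definition sqnorm2 x : R := \sum_(j < n.+1) x 0 j ^+ 2.

Definition partial (j : 'I_n.+1) f : 'rV[R]_n.+1 -> R[i] :=
  cderive (delta_mx 0 j) f.

Definition partials (s : seq 'I_n.+1) f : 'rV[R]_n.+1 -> R[i] :=
  foldr partial f s.

Definition laplacian f x : R[i] := \sum_(j < n.+1) partial j (partial j f) x.

(* [f] is C^oo iff all its iterated partial derivatives, in any order of
   differentiation, are differentiable everywhere. *)
Definition smooth f : Prop := forall s x, cdifferentiable (partials s f) x.

Definition schwartz f : Prop :=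
  smooth f /\
  forall (a : 'I_n.+1 -> nat) (s : seq 'I_n.+1),
    exists M : R, forall x,
      `|(\prod_(j < n.+1) x 0 j ^+ a j)%:C * partials s f x| <= M%:C.

End EuclideanSpace.

Section Schroedinger.
Context {R : realType}.

(* The coordinates (x_1, x_2) of the plane are [x 0 0] and [x 0 1]. *)
Definition hamiltonian (hbar m omega theta : R) (f : 'rV[R]_2 -> R[i])
    (x : 'rV[R]_2) : R[i] :=
  - (hbar ^+ 2 / (2 * m))%:C * laplacian f x
  - 'i * (hbar * theta * x 0 1)%:C * partial 0 f x
  + (m * omega ^+ 2 / 2 * (x 0 0 ^+ 2 + x 0 1 ^+ 2))%:C * f x.

Definition schroedinger_solution (hbar m omega theta : R)
    (u : 'rV[R]_2 -> R -> R[i]) : Prop :=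
  forall x t,
    cderivable (V := R^o) (u x) t 1 /\
    'i * hbar%:C * cderive (V := R^o) 1 (u x) t =
      hamiltonian hbar m omega theta (fun y => u y t) x.

Definition lambda1 (omega theta : R) : R := Num.sqrt (omega * (omega + theta)).
Definition lambda2 (omega theta : R) : R := Num.sqrt (omega * (omega - theta)).

(* [Gamma 1] and [Gamma (-1)] are Gamma_+ and Gamma_-. *)
Definition Gamma (sgn m omega theta T : R) : R :=
  let l1 := lambda1 omega theta in
  let l2 := lambda2 omega theta in
  ((omega ^+ 4 + l1 ^+ 4) / (omega ^+ 2 * l1 ^+ 2) * sin (l1 * T) ^+ 2
   + (omega ^+ 4 + l2 ^+ 4) / (omega ^+ 2 * l2 ^+ 2) * sin (l2 * T) ^+ 2
   + 2 * ((omega ^+ 4 + (l1 * l2) ^+ 2) / (omega ^+ 2 * l1 * l2))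
       * sin (l1 * T) * sin (l2 * T)
   + 2 * (cos (l1 * T) - cos (l2 * T)) ^+ 2
   + sgn
     * `| (omega ^+ 2 - l1 ^+ 2) / (omega * l1) * sin (l1 * T)
          + (omega ^+ 2 - l2 ^+ 2) / (omega * l2) * sin (l2 * T) |
     * Num.sqrt
         (((omega ^+ 2 + l1 ^+ 2) / (omega * l1) * sin (l1 * T)
           + (omega ^+ 2 + l2 ^+ 2) / (omega * l2) * sin (l2 * T)) ^+ 2
          + 4 * (cos (l1 * T) - cos (l2 * T)) ^+ 2))
  / (2 * (2 * m * omega) ^+ 2).

Definition Gamma_plus (m omega theta T : R) : R := Gamma 1 m omega theta T.
Definition Gamma_minus (m omega theta T : R) : R := Gamma (-1) m omega theta T.

End Schroedinger.

(* Main.v *)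
Require Import Defs.
From HB Require Import structures.
From mathcomp Require Import all_boot all_order all_algebra.
From mathcomp Require Import all_classical all_reals all_analysis.
From mathcomp Require Import measurable_realfun complex ring lra.

(* After rescaling, the classical Hamiltonian is quadratic and its flow consists
   of two oscillators of frequencies [l1], [l2]; a Gaussian wave packet of a
   suitable fixed width is carried along this flow without changing shape.
   Pairing the solution [u] with the packet centred at a phase space point gives
   a function on phase space from which [u] is recovered by Fourier inversion
   ([pairing_inversion]), and this function is transported by the flow
   ([pairing_conserved]).  As [u] is only assumed to be Schwartz at each time, with
   no uniformity in time, differentiation under the integral sign is first
   justified on an interval meeting the set of bad times, by a Baire category
   argument, and bounds are propagated across the gaps of that set.

   Solving the flow backwards from time [T] expresses [u (B xi) T], up to
   unimodular factors, as the Fourier transform at [xi] of a function with the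
   decay of [u x 0]; here [Gamma_plus] and [Gamma_minus] are, up to scaling, the
   squared singular values of [B].  In the direction of the larger one, Hardy's
   uniqueness principle applies to the odd part of this transform about every
   point, hence the transform is constant along that direction, hence zero.

   Hardy's principle is proved without complex analysis: if
   [f z = \int v sin (z l)] then the Laplace transform
   [s |-> \int f `|z| exp (- s z^2) dz] has an expansion in powers of [1/s] for
   large [s], from the decay of [v], and in powers of [s] for small [s], from the
   decay of [f]; the hypothesis makes the two domains overlap, and then all
   coefficients vanish. *)

Set Implicit Arguments.
Unset Strict Implicit.
Unset Printing Implicit Defensive.

Import Order.TTheory GRing.Theory Num.Theory.
Import numFieldNormedType.Exports.

Local Open Scope classical_set_scope.
Local Open Scope ring_scope.

(** * Differentiation and integration *)

(** The packet is a displaced ground state of the Hamiltonian: its complex quadratic form, with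
    diagonal [a], [b] and off-diagonal entry i [gam], solves the stationary Riccati equation. Hence
    the flow moves its centre and only adds the phase - (a + b) t / 2, where (a + b) / 2 is the
    ground state energy. Decay of the pairings is measured by the classical energy because this
    weight is constant along the flow: a bound at one time holds, with the same constant, at every
    time joined to it by conserved pairings. This substitutes for uniformity in time. The second
    power of the energy is what makes Fourier inversion in the two momenta converge. The product of
    the two squared singular values is (det B)^2, so the nonvanishing of [Gamma_plus] and
    [Gamma_minus] makes [B] invertible: the kernel formula becomes available and every point is of
    the form [B xi]. Wave functions are carried as pairs of real functions; a free phase ([d] or
    [pdl]) recovers the imaginary part of an identity from its real part. *)

Section DerivativeRules.
Context {R : realType}.
Implicit Types (f g : R -> R) (x : R).

(** The derivative is an argument rather than a computed value: [der_auto] builds one from the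
    syntax of [f] and leaves its identification with the wanted [l] to [ring] or [field]. *)
Definition der f x (l : R) : Prop := is_derive (x : R^o) 1 f l.

Lemma der_eq f x l l' : der f x l -> l = l' -> der f x l'.
Proof. by move=> ? <-. Qed.

Lemma der_id x : der (fun t => t) x 1.
Proof. exact: is_derive_id. Qed.

Lemma der_cst (c x : R) : der (fun=> c) x 0.
Proof. exact: is_derive_cst. Qed.

Lemma derD f g x l m : der f x l -> der g x m -> der (fun t => f t + g t) x (l + m).
Proof. by move=> hf hg; exact: is_deriveD. Qed.

Lemma derN f x l : der f x l -> der (fun t => - f t) x (- l).
Proof. by move=> hf; exact: is_deriveN. Qed.

Lemma derM f g x l m : der f x l -> der g x m ->
  der (fun t => f t * g t) x (l * g x + f x * m).
Proof.
move=> hf hg.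
apply: (@der_eq _ _ _ _ (@is_deriveM _ _ f g (x : R^o) 1 l m hf hg)).
by rewrite addrC; congr (_ + _); exact: mulrC.
Qed.

Lemma derX f n x l : der f x l -> der (fun t => f t ^+ n) x (n%:R * f x ^+ n.-1 * l).
Proof.
move=> hf; have := @is_deriveX _ _ f n (x : R^o) 1 l hf.
by rewrite /der exprfctE.
Qed.

Lemma der_comp f g x l m : der f x l -> der g (f x) m -> der (fun t => g (f t)) x (m * l).
Proof. by move=> hf hg; exact: is_derive1_comp. Qed.

Lemma der_expR f x l : der f x l -> der (fun t => expR (f t)) x (expR (f x) * l).
Proof. by move=> hf; apply: der_comp hf _; exact: is_derive_expR. Qed.

Lemma der_cos f x l : der f x l -> der (fun t => cos (f t)) x (- sin (f x) * l).
Proof. by move=> hf; apply: der_comp hf _; exact: is_derive_cos. Qed.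

Lemma der_sin f x l : der f x l -> der (fun t => sin (f t)) x (cos (f x) * l).
Proof. by move=> hf; apply: der_comp hf _; exact: is_derive_sin. Qed.

Lemma der_unique f x l m : der f x l -> der f x m -> l = m.
Proof. by move=> [_ <-] [_ <-]. Qed.

Lemma der_continuous f x l : der f x l -> {for x, continuous f}.
Proof. by move=> [h _]; apply/differentiable_continuous/derivable1_diffP. Qed.

Lemma der_near f g x l e : 0 < e ->
  (forall t, `|t - x| < e -> f t = g t) -> der f x l -> der g x l.
Proof.
move=> e0 fg; apply: near_eq_is_derive.
by near=> t; apply: fg; near: t; exact: cvgr_distC_lt.
Unshelve. all: by end_near. Qed.

End DerivativeRules.

Ltac der_tac :=
  first [ exact (der_cst _ _) | exact (der_id _) |
  lazymatch goal with
  | |- der (fun t => @?f t + @?g t) _ _ => refine (@derD _ f g _ _ _ _ _); der_tac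
  | |- der (fun t => - @?f t) _ _ => refine (@derN _ f _ _ _); der_tac
  | |- der (fun t => @?f t * @?g t) _ _ => refine (@derM _ f g _ _ _ _ _); der_tac
  | |- der (fun t => @?f t ^+ ?n) _ _ => refine (@derX _ f n _ _ _); der_tac
  | |- der (fun t => expR (@?f t)) _ _ => refine (@der_expR _ f _ _ _); der_tac
  | |- der (fun t => cos (@?f t)) _ _ => refine (@der_cos _ f _ _ _); der_tac
  | |- der (fun t => sin (@?f t)) _ _ => refine (@der_sin _ f _ _ _); der_tac
  end | eassumption | idtac ].
Ltac der_auto := eapply der_eq; [der_tac|].

(** * Real integrals: domination, limits, dependence on a parameter *)

Section RealIntegrals.
Context d (T : measurableType d) (R : realType).
Variable mu : {measure set T -> \bar R}.
Implicit Types f g : T -> R.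

Definition Rintegrable f : Prop := mu.-integrable setT (EFin \o f).

Lemma Rintegrable_measurable f : Rintegrable f -> measurable_fun setT f.
Proof. by move=> /integrableP[/measurable_EFinP]. Qed.

Lemma Rintegrable_le f g : measurable_fun setT f ->
  (forall x, `|f x| <= g x) -> Rintegrable g -> Rintegrable f.
Proof.
move=> mf fg ig; apply: (le_integrable _ _ _ ig) => //.
  exact/measurable_EFinP.
by move=> x _ /=; rewrite lee_fin (le_trans (fg x))// ler_norm.
Qed.

Lemma RintegrableZ c f : Rintegrable f -> Rintegrable (fun x => c * f x).
Proof.
by move=> h; rewrite /Rintegrable /comp; under eq_fun do rewrite EFinM; exact: integrableZl.
Qed.

Lemma RintegrableD f g :
  Rintegrable f -> Rintegrable g -> Rintegrable (fun x => f x + g x).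
Proof.
by move=> hf hg; rewrite /Rintegrable /comp; under eq_fun do rewrite EFinD; exact: integrableD.
Qed.

Lemma normr_Rintegral_le f g : Rintegrable f -> Rintegrable g ->
  (forall x, `|f x| <= g x) -> `|\int[mu]_x f x| <= \int[mu]_x g x.
Proof.
move=> hf hg fg; apply: (le_trans (le_normr_Rintegral _ hf)) => //.
apply: le_Rintegral => //.
by have := integrable_norm hf; apply: eq_integrable.
Qed.

Lemma Rintegral_dominated (f_ : nat -> T -> R) f g :
  (forall n, measurable_fun setT (f_ n)) ->
  (forall x, f_ n x @[n --> \oo] --> f x) ->
  (forall n x, `|f_ n x| <= g x) -> Rintegrable g ->
  \int[mu]_x f_ n x @[n --> \oo] --> \int[mu]_x f x.
Proof.
move=> mf_ ff fg ig.
have mf : measurable_fun setT f.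
  by apply: (measurable_fun_cvg mf_) => x _; exact: ff.
have ffE x : (f_ n x)%:E @[n --> \oo] --> (f x)%:E.
  by apply/fine_cvgP; split; [exact: nearW|exact: ff].
have [i1 _ i2] := @dominated_convergence _ _ _ mu setT measurableT
  (fun n x => (f_ n x)%:E) (EFin \o f) (EFin \o g)
  (fun n => (measurable_EFinP setT (f_ n)).2 (mf_ n)) ((measurable_EFinP setT f).2 mf)
  (aeW mu (fun x _ => ffE x)) ig
  (aeW mu (fun x n _ => fg n x)).
apply: fine_cvg => /=.
rewrite fineK//.
exact: integrable_fin_num.
Qed.

(** Domination is asked only on a ball around [a]; this lets bounds valid near a single time be used
    in [der_pairing]. *)
Lemma der_Rintegral (f df : R -> T -> R) (g : T -> R) (a e : R) :
  0 < e ->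
  (forall x, `|x - a| < e -> Rintegrable (f x)) ->
  (forall x y, `|x - a| < e -> der (f ^~ y) x (df x y)) ->
  (forall x y, `|x - a| < e -> `|df x y| <= g y) ->
  Rintegrable g ->
  der (fun x => \int[mu]_y f x y) a (\int[mu]_y df a y).
Proof.
move=> e0 intf hder ub ig.
have H x : (x \in `](a - e), (a + e)[) = (`|x - a| < e).
  by rewrite in_itv/= ltr_distl.
have Ia : [set` `](a - e), (a + e)[] a by rewrite /= H subrr normr0.
have intf' x : [set` `](a - e), (a + e)[] x -> mu.-integrable setT (EFin \o f x).
  by rewrite /= H; exact: intf.
have der' x y : [set` `](a - e), (a + e)[] x -> setT y -> derivable (f ^~ y) x 1.
  by rewrite /= H => xa _; case: (hder x y xa).
have g0 y : 0 <= g y.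
  by apply: le_trans (ub a y _); rewrite ?subrr ?normr0.
have dE x y : `|x - a| < e -> partial1of2 f x y = df x y.
  by rewrite partial1of2E => xa; case: (hder x y xa).
have ub' x y : [set` `](a - e), (a + e)[] x -> setT y -> `|partial1of2 f x y| <= g y.
  by rewrite /= H => xa _; rewrite dE//; exact: ub.
apply: DeriveDef.
  exact: (@derivable_under_integral _ _ _ mu f setT measurableT a _ _ Ia intf' der' g g0 ig ub').
rewrite -derive1E.
rewrite (@differentiation_under_integral _ _ _ mu f setT measurableT a _ _ Ia intf' der' g g0 ig ub').
apply: eq_Rintegral => y _; rewrite dE//.
by rewrite subrr normr0.
Qed.

End RealIntegrals.

Section ImageMeasure.
Context d d' (X : measurableType d) (Y : measurableType d') (R : realType).
Variable mu : {measure set X -> \bar R}.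
Variables (phi : X -> Y) (mphi : measurable_fun [set: X] phi).

Definition image_measure : {measure set Y -> \bar R} :=
  measure_function_pushforward__canonical__measure_function_Measure mu mphi.

Lemma Rintegral_image_measure (f : Y -> R) : measurable_fun [set: Y] f ->
  Rintegrable mu (f \o phi) ->
  \int[image_measure]_y f y = \int[mu]_x f (phi x).
Proof.
move=> mf intf; congr fine.
rewrite (@integral_pushforward _ _ _ _ _ _ mphi mu setT (EFin \o f))//.
exact/measurable_EFinP.
Qed.

End ImageMeasure.

Lemma integral_mscale d (X : measurableType d) (R : realType)
    (mu : {measure set X -> \bar R}) (k : {nonneg R}) (f : X -> \bar R) :
  mu.-integrable setT f ->
  (\int[mscale k mu]_x f x = k%:num%:E * \int[mu]_x f x)%E.
Proof.
move=> intf; have mf := measurable_int _ intf.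
have mp := measurable_funepos mf; have mn := measurable_funeneg mf.
have fin : (\int[mu]_x f^\+ x +? - \int[mu]_x f^\- x)%E.
  by rewrite fin_num_adde_defl// fin_numN integrable_neg_fin_num.
rewrite [LHS]integralE [in RHS]integralE muleBr//.
by rewrite !ge0_integral_mscale.
Qed.

(** * Lebesgue measure on the line and a polynomial weight *)

Section Lebesgue.
Context {R : realType}.
Notation leb := (@lebesgue_measure R).
Implicit Types f g : R -> R.

(** The standard integrable majorant: most dominations are by a multiple of [k1] on the line and of
    its tensor square [k2] on the plane. *)
Definition k1 (x : R) : R := (1 + x ^+ 2)^-1.

Lemma one_add_sqr_gt0 (x : R) : 0 < 1 + x ^+ 2.
Proof. by rewrite ltr_pwDl// sqr_ge0. Qed.

Lemma k1_gt0 x : 0 < k1 x.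
Proof. by rewrite invr_gt0 one_add_sqr_gt0. Qed.

Lemma k1_le1 x : k1 x <= 1.
Proof. by rewrite invf_le1 ?one_add_sqr_gt0// lerDl sqr_ge0. Qed.

Lemma continuous_k1 : continuous k1.
Proof. exact: continuous_oneDsqrV. Qed.

Lemma Rintegrable_k1 : Rintegrable leb k1.
Proof.
apply/integrableP; split.
  by apply/measurable_EFinP; exact: continuous_measurable_fun continuous_k1.
under eq_integral => x _ do rewrite /= ger0_norm ?ltW ?k1_gt0//.
rewrite ge0_symfun_integralT.
- have -> : [set x : R | 0 <= x] = `[0, +oo[%classic by rewrite -set_itvcy.
  by rewrite integral0y_oneDsqr -EFinM ltry.
- by move=> x; exact/ltW/k1_gt0.
- exact: continuous_k1.
- by move=> x /=; rewrite /k1 sqrrN.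
Qed.

(* Peetre's inequality, which lets shifts be absorbed by [k1]. *)
Lemma k1_shift x c : k1 (x + c) <= 2 * (1 + c ^+ 2) * k1 x.
Proof.
rewrite /k1 ler_pdivlMr ?one_add_sqr_gt0// ler_pdivrMl ?one_add_sqr_gt0//.
rewrite -subr_ge0 (_ : _ - _ =
  1 + (x + 2 * c) ^+ 2 + 2 * (c * (x + c)) ^+ 2); last by ring.
apply: addr_ge0; first by apply: addr_ge0 => //; exact: sqr_ge0.
by apply: mulr_ge0 => //; exact: sqr_ge0.
Qed.

Definition affine1 (s c x : R) : measurableTypeR R := s * x + c.

Lemma measurable_affine1 s c : measurable_fun [set: measurableTypeR R] (affine1 s c).
Proof. by apply: measurable_funD => //; exact: measurable_funM. Qed.

(** Both sides are measures in [A] that agree on half-open intervals, and these determine Lebesgue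
    measure. *)
Lemma lebesgue_affine1 s c (s0 : 0 < s) (A : set R) : measurable A ->
  leb A = (s%:E * leb (affine1 s c @^-1` A))%E.
Proof.
move=> mA.
pose s' : {nonneg R} := NngNum (ltW s0).
rewrite -[RHS]/(mscale s' (image_measure leb (measurable_affine1 s c)) A).
apply: lebesgue_measure_unique => //= _ [[a b]] _ <-.
rewrite /mscale /= /pushforward.
have -> : affine1 s c @^-1` `]a, b] = `]((a - c) / s), ((b - c) / s)]%classic.
  apply/seteqP; split => x /=; rewrite !in_itv/= /affine1.
    by rewrite ltr_pdivrMr// ler_pdivlMr// ltrBlDr lerBrDr mulrC.
  by rewrite ltr_pdivrMr// ler_pdivlMr// ltrBlDr lerBrDr mulrC.
rewrite /= !lebesgue_measure_itv/= !lte_fin ltr_pM2r ?invr_gt0// ltrD2r.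
case: ifPn => // _; last by rewrite mule0.
rewrite -!EFinD -EFinM; congr EFin.
by field; rewrite gt_eqF.
Qed.

End Lebesgue.

(** * Integration on the plane *)

Section Plane.
Context {R : realType}.
Notation leb := (@lebesgue_measure R).
Implicit Types f g : R * R -> R.

Definition leb1 : {sigma_finite_measure set (measurableTypeR R) -> \bar R} :=
  @lebesgue_measure R.

(** Named so that the product measure carries its own sigma-finite structure, as Fubini's theorem
    for pairs of points of the plane demands. *)
Definition leb2 : set (measurableTypeR R * measurableTypeR R)%type -> \bar R :=
  (leb1 \x leb1)%E.

HB.instance Definition _ := Measure.on leb2.

Lemma sigma_finite_leb2 : sigma_finite setT leb2.
Proof.
have /sigma_finiteP[F [TF ndF Foo]] := sigma_finiteT leb1.
exists (fun n => F n `*` F n).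
  rewrite -setXTT TF predeqE => -[x y]; split.
    move=> [/= [n _ Fnx] [k _ Fky]]; exists (maxn n k) => //; split.
    - by move: x Fnx; exact/subsetPset/ndF/leq_maxl.
    - by move: y Fky; exact/subsetPset/ndF/leq_maxr.
  by move=> [n _ []/= ? ?]; split; exists n.
move=> k; have [? ?] := Foo k.
split; first exact: measurableX.
by rewrite /leb2 product_measure1E// lte_mul_pinfty// ge0_fin_numE.
Qed.

HB.instance Definition _ := Measure_isSigmaFinite.Build _ _ _ leb2 sigma_finite_leb2.

Lemma leb2X A B : measurable A -> measurable B ->
  leb2 (A `*` B) = (leb1 A * leb1 B)%E.
Proof. by move=> mA mB; rewrite /leb2 product_measure1E. Qed.

(** Measurability refers to the product sigma-algebra; an open set belongs to it as the countable
    union of the rational boxes that it contains. *)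
Lemma continuous_measurable_plane f : continuous f -> measurable_fun setT f.
Proof.
move=> cf; apply: (measurability _ (RGenOpens.measurableE R)) => //.
move=> _ [_ [a [b ->] <-]]; rewrite setTI.
set O := f @^-1` _.
have oO : open O by move/continuousP : cf; apply; exact: interval_open.
pose box (q : rat * rat * rat) : set (R * R) :=
  ball (ratr q.1.1 : R) (ratr q.2 : R) `*` ball (ratr q.1.2 : R) (ratr q.2 : R).
have -> : O = \bigcup_(q in [set: (rat * rat * rat)%type]) (if `[< box q `<=` O >] then box q else set0).
  apply/seteqP; split => [[x y] Oxy|[x y] [q _]]; last first.
    by case: ifPn => // /asboolP; exact.
  have /nbhs_ballP[e /= e0 eO] : nbhs (x, y) O.
    exact: (open_nbhs_nbhs (conj oO Oxy)).
  (* A centre within e/4 of the point in each coordinate and a radius between e/4 and e/2: the box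
     contains the point and stays within distance 3e/4 of it. *)
  have e4 : 0 < e / 4 by rewrite divr_gt0.
  have [p] : exists q : rat, ratr q \in `]x, (x + e / 4)[.
    by apply: rat_in_itvoo; rewrite ltrDl.
  rewrite in_itv/= => /andP[p1 p2].
  have [q] : exists q : rat, ratr q \in `]y, (y + e / 4)[.
    by apply: rat_in_itvoo; rewrite ltrDl.
  rewrite in_itv/= => /andP[q1 q2].
  have [r] : exists r : rat, ratr r \in `](e / 4), (e / 2)[.
    by apply: rat_in_itvoo; rewrite ltr_pM2l// ltf_pV2 ?posrE//; lra.
  rewrite in_itv/= => /andP[r1 r2].
  exists ((p, q), r) => //; case: ifPn.
    by move=> _; split; rewrite /= /ball/= ltr_norml; lra.
  move=> /asboolP; case => -[x' y'] [/=]; rewrite /ball/= !ltr_norml => h1 h2.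
  by apply: eO; split; rewrite /ball/= ltr_norml; lra.
apply: countable_bigcupT_measurable => [|q]; first exact: countableP.
case: ifPn => // _; apply: measurableX; exact: open_measurable (ball_open _ _).
Qed.

Definition k2 (x : R * R) : R := k1 x.1 * k1 x.2.

Lemma k2_gt0 x : 0 < k2 x. Proof. by rewrite mulr_gt0 ?k1_gt0. Qed.

Lemma measurable_k1 : measurable_fun [set: R] (@k1 R).
Proof. exact: continuous_measurable_fun (@continuous_k1 R). Qed.

Lemma measurable_k2 : measurable_fun [set: (R * R)%type] k2.
Proof.
apply: measurable_funM.
  exact: (measurableT_comp measurable_k1 measurable_fst).
exact: (measurableT_comp measurable_k1 measurable_snd).
Qed.

Lemma Rintegrable_prod d1 d2 (X : measurableType d1) (Y : measurableType d2)
    (m1 : {sigma_finite_measure set X -> \bar R})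
    (m2 : {sigma_finite_measure set Y -> \bar R}) (u : X -> R) (v : Y -> R) :
  Rintegrable m1 u -> Rintegrable m2 v ->
  Rintegrable (m1 \x m2)%E (fun z => u z.1 * v z.2).
Proof.
move=> iu iv.
have mu := Rintegrable_measurable iu; have mv := Rintegrable_measurable iv.
have m : measurable_fun [set: (X * Y)%type] (EFin \o (fun z => u z.1 * v z.2)).
  apply/measurable_EFinP; apply: measurable_funM.
    exact: (measurableT_comp mu measurable_fst).
  exact: (measurableT_comp mv measurable_snd).
apply/(integrable12ltyP m1 m2 m) => /=.
under eq_integral => x _.
  under eq_integral => y _ do rewrite normrM EFinM.
  rewrite ge0_integralZl//; last first.
    by apply/measurable_EFinP; exact: measurableT_comp mv.
  over.
have [_ fu] := integrableP _ _ _ iu; have [_ fv] := integrableP _ _ _ iv.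
rewrite ge0_integralZr//; last 2 first.
  by apply/measurable_EFinP; exact: measurableT_comp mu.
  exact: integral_ge0.
by apply: lte_mul_pinfty => //; [exact: integral_ge0|rewrite ge0_fin_numE//; exact: integral_ge0].
Qed.

Lemma Rintegrable_k2 : Rintegrable leb2 k2.
Proof. exact: Rintegrable_prod (@Rintegrable_k1 R) (@Rintegrable_k1 R). Qed.

Definition affine2 (s c1 c2 : R) (x : R * R) : (measurableTypeR R * measurableTypeR R)%type :=
  (affine1 s c1 x.1, affine1 s c2 x.2).

Lemma measurable_affine2 s c1 c2 : measurable_fun [set: (measurableTypeR R * measurableTypeR R)%type] (affine2 s c1 c2).
Proof.
apply: measurable_fun_pair.
  exact: (measurableT_comp (measurable_affine1 s c1) measurable_fst).
exact: (measurableT_comp (measurable_affine1 s c2) measurable_snd).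
Qed.

(** As on the line, a rescaled pushforward is identified with the measure, here through its values
    on rectangles. *)
Lemma Rintegral_affine2 s c1 c2 f : 0 < s -> measurable_fun setT f ->
  Rintegrable leb2 (fun x => f (s * x.1 + c1, s * x.2 + c2)) ->
  \int[leb2]_x f x = s ^+ 2 * \int[leb2]_x f (s * x.1 + c1, s * x.2 + c2).
Proof.
move=> s0 mf intf.
pose s' : {nonneg R} := NngNum (sqr_ge0 s).
pose im := image_measure leb2 (measurable_affine2 s c1 c2).
have -> : \int[leb2]_x f x = \int[mscale s' im]_x f x.
  congr fine; apply: eq_measure_integral => A mA _.
  apply: (@product_measure_unique _ _ _ _ _ leb1 leb1 (mscale s' im)); last exact: mA.
  move=> B C mB mC.
  rewrite -[LHS]/((s ^+ 2)%:E * leb2 (affine2 s c1 c2 @^-1` (B `*` C)))%E.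
  have -> : affine2 s c1 c2 @^-1` (B `*` C) = (affine1 s c1 @^-1` B) `*` (affine1 s c2 @^-1` C).
    by apply/seteqP; split => x.
  rewrite leb2X//; last 2 first.
    by rewrite -[X in measurable X]setTI; exact: measurable_affine1.
    by rewrite -[X in measurable X]setTI; exact: measurable_affine1.
  have EB : leb1 B = (s%:E * leb1 (affine1 s c1 @^-1` B))%E := lebesgue_affine1 c1 s0 mB.
  have EC : leb1 C = (s%:E * leb1 (affine1 s c2 @^-1` C))%E := lebesgue_affine1 c2 s0 mC.
  rewrite EB EC.
  by rewrite muleACA -EFinM.
have imf : im.-integrable setT (EFin \o f).
  have mf' : measurable_fun setT (EFin \o f) by exact/measurable_EFinP.
  exact: (@integrable_pushforward _ _ _ _ _ _ (measurable_affine2 s c1 c2) leb2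
    setT (EFin \o f) mf' intf measurableT).
have E : \int[im]_x f x = \int[leb2]_x f (s * x.1 + c1, s * x.2 + c2).
  exact: (Rintegral_image_measure (measurable_affine2 s c1 c2) mf intf).
rewrite -E.
have H : (\int[mscale s' im]_x (f x)%:E = (s ^+ 2)%:E * \int[im]_x (f x)%:E)%E.
  exact: (integral_mscale s' imf).
transitivity (fine ((s ^+ 2)%:E * \int[im]_x (f x)%:E)%E).
  exact: (congr1 fine H).
have fin := integrable_fin_num measurableT imf.
by rewrite fineM.
Qed.

Lemma Rintegral_shift2 c1 c2 f : measurable_fun setT f ->
  Rintegrable leb2 (fun x => f (x.1 + c1, x.2 + c2)) ->
  \int[leb2]_x f (x.1 + c1, x.2 + c2) = \int[leb2]_x f x.
Proof.
move=> mf intf.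
have E : (fun x : R * R => f (1 * x.1 + c1, 1 * x.2 + c2)) =
         (fun x => f (x.1 + c1, x.2 + c2)) by apply/funext => x; rewrite !mul1r.
have := @Rintegral_affine2 1 c1 c2 f ltr01 mf.
by rewrite E => /(_ intf) ->; rewrite expr1n mul1r.
Qed.

Lemma Rintegrable_section d1 d2 (X : measurableType d1) (Y : measurableType d2)
    (m2 : {measure set Y -> \bar R})
    (f : X * Y -> R) (u : X -> R) (v : Y -> R) (x : X) :
  measurable_fun setT f -> Rintegrable m2 v ->
  (forall x y, `|f (x, y)| <= u x * v y) -> Rintegrable m2 (fun y => f (x, y)).
Proof.
move=> mf iv fuv; apply: (@Rintegrable_le _ _ _ _ _ (fun y => u x * v y)) => //.
  exact: measurable_fun_pair2.
exact: RintegrableZ.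
Qed.

Section RealFubini.
Context d1 d2 (X : measurableType d1) (Y : measurableType d2).
Variables (m1 : {sigma_finite_measure set X -> \bar R})
  (m2 : {sigma_finite_measure set Y -> \bar R}).
Variables (f : X * Y -> R) (u : X -> R) (v : Y -> R).
Hypotheses (mf : measurable_fun setT f)
  (iu : Rintegrable m1 u) (iv : Rintegrable m2 v)
  (fuv : forall x y, `|f (x, y)| <= u x * v y).

Let intf : Rintegrable (m1 \x m2)%E f.
Proof.
apply: (Rintegrable_le mf) (Rintegrable_prod iu iv) => -[x y]; exact: fuv.
Qed.

Let inner x : (\int[m2]_y (f (x, y))%:E)%E = (\int[m2]_y f (x, y))%:E.
Proof.
rewrite fineK//; apply: integrable_fin_num => //.
exact: (Rintegrable_section x mf iv fuv).
Qed.

Lemma Rintegrable_Fubini : Rintegrable m1 (fun x => \int[m2]_y f (x, y)).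
Proof.
have := integrable_fubini_F intf.
by apply: eq_integrable => // x _; rewrite /fubini_F inner.
Qed.

(** The product majorant makes every section integrable, not merely almost every one, so the
    extended-real inner integrals are finite at each point and can be read as reals. *)
Lemma Rintegral_Fubini :
  \int[m1]_x (\int[m2]_y f (x, y)) = \int[m2]_y (\int[m1]_x f (x, y)).
Proof.
have E : (\int[m1]_x \int[m2]_y (f (x, y))%:E = \int[m2]_y \int[m1]_x (f (x, y))%:E)%E.
  exact: (Fubini intf).
have inner' y : (\int[m1]_x (f (x, y))%:E)%E = (\int[m1]_x f (x, y))%:E.
  rewrite fineK//; apply: integrable_fin_num => //.
  have mf' : measurable_fun setT (fun z : Y * X => f (z.2, z.1)).
    by apply: measurableT_comp mf _; apply: measurable_fun_pair.
  apply: (@Rintegrable_section _ _ _ _ m1 (fun z : Y * X => f (z.2, z.1)) v u y mf' iu).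
  by move=> y' x' /=; rewrite mulrC.
rewrite (eq_integral _ _ (fun x _ => inner x)) (eq_integral _ _ (fun y _ => inner' y)) in E.
exact: (congr1 fine E).
Qed.

End RealFubini.

(* A translation-invariant integral annihilates derivatives: differentiate
   [h |-> \int g (x + h e_1)], which is constant. *)
Lemma Rintegral_partial1_eq0 g (dg : R * R -> R) C :
  measurable_fun setT g -> (forall x, `|g x| <= C * k2 x) ->
  (forall x, `|dg x| <= C * k2 x) ->
  (forall a b, der (fun a => g (a, b)) a (dg (a, b))) ->
  \int[leb2]_x dg x = 0.
Proof.
move=> mg gC dgC hder.
have C0 : 0 <= C.
  have := le_trans (normr_ge0 _) (gC (0, 0)).
  by rewrite pmulr_lge0// k2_gt0.
(* For |h| < 1 the constant 2 (1 + h^2) of Peetre's inequality is below 4. *)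
have bd (h : R) x : `|h| < 1 -> k2 (x.1 + h, x.2) <= 4 * k2 x.
  move=> h1; rewrite /k2/= mulrA ler_pM2r ?k1_gt0//.
  apply: le_trans (k1_shift _ _) _; rewrite ler_pM2r ?k1_gt0//.
  by move: h1; rewrite ltr_norml => /andP[h1 h1']; nra.
have ig : Rintegrable leb2 (fun x => C * (4 * k2 x)).
  by apply: RintegrableZ; apply: RintegrableZ; exact: Rintegrable_k2.
have ish h : `|h| < 1 -> Rintegrable leb2 (fun x => g (x.1 + h, x.2)).
  move=> h1; apply: (Rintegrable_le _ _ ig).
    apply: (measurableT_comp mg); apply: measurable_fun_pair => //.
    exact: measurable_funD.
  move=> x; apply: le_trans (gC _) _.
  by rewrite ler_wpM2l// bd.
have D := @der_Rintegral _ _ R leb2 (fun h x => g (x.1 + h, x.2))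
  (fun h x => dg (x.1 + h, x.2)) (fun x => C * (4 * k2 x)) 0 1 ltr01.
have {}D : der (fun h => \int[leb2]_x g (x.1 + h, x.2)) 0
    (\int[leb2]_x dg (x.1 + 0, x.2)).
  apply: D => //.
  - by move=> h; rewrite subr0; exact: ish.
  - move=> h x _.
    have d2 : der (fun h => x.1 + h) h 1 by der_auto; rewrite add0r.
    have := der_comp d2 (hder (x.1 + h) x.2).
    by rewrite mulr1.
  - move=> h x; rewrite subr0 => h1; apply: le_trans (dgC _) _.
    by rewrite ler_wpM2l// bd.
have cst h : `|h| < 1 -> \int[leb2]_x g (x.1 + h, x.2) = \int[leb2]_x g x.
  move=> h1; rewrite -[RHS](@Rintegral_shift2 h 0 g)//.
    by apply: eq_Rintegral => x _; rewrite addr0.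
  by have := ish h h1; apply: eq_integrable => // x _ /=; rewrite addr0.
have D0 : der (fun h => \int[leb2]_x g (x.1 + h, x.2)) 0 0.
  apply: (@der_near _ (fun=> \int[leb2]_x g x) _ _ _ 1 ltr01 _ (der_cst _ _)).
  by move=> h; rewrite subr0 => h1; rewrite cst.
have := der_unique D D0; rewrite -[X in _ = X -> _]/(0 : R) => <-.
by apply: eq_Rintegral => -[a b] _ /=; rewrite addr0.
Qed.

Lemma Rintegral_partial2_eq0 g (dg : R * R -> R) C :
  measurable_fun setT g -> (forall x, `|g x| <= C * k2 x) ->
  measurable_fun setT dg -> (forall x, `|dg x| <= C * k2 x) ->
  (forall a b, der (fun b => g (a, b)) b (dg (a, b))) ->
  \int[leb2]_x dg x = 0.
Proof.
move=> mg gC mdg dgC hder.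
(* Exchanging the coordinates reduces the claim to the first partial derivative; the exchange
   preserves the measure because it does so on rectangles. *)
pose sw (x : R * R) : (measurableTypeR R * measurableTypeR R)%type := (x.2, x.1).
have msw : measurable_fun [set: (measurableTypeR R * measurableTypeR R)%type] sw.
  exact: measurable_fun_pair.
have k2sw x : k2 (sw x) = k2 x by rewrite /k2 mulrC.
have -> : \int[leb2]_x dg x = \int[leb2]_x dg (sw x).
  have isw : Rintegrable leb2 (dg \o sw).
    apply: (@Rintegrable_le _ _ R leb2 (dg \o sw) (fun x => C * k2 x)).
    - exact: measurableT_comp.
    - by move=> x /=; rewrite -(k2sw x).
    - by apply: RintegrableZ; exact: Rintegrable_k2.
  have E : \int[image_measure leb2 msw]_x dg x = \int[leb2]_x dg (sw x).
    exact: (Rintegral_image_measure msw mdg isw).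
  have H : (\int[leb2]_x (dg x)%:E = \int[image_measure leb2 msw]_x (dg x)%:E)%E; last first.
    by rewrite -E; exact: (congr1 fine H).
  apply: eq_measure_integral => A mA _.
  apply: (@product_measure_unique _ _ _ _ _ leb1 leb1 (image_measure leb2 msw)); last exact: mA.
  move=> B D mB mD.
  rewrite -[LHS]/(leb2 (sw @^-1` (B `*` D))).
  have swX : sw @^-1` (B `*` D) = D `*` B.
    by apply/seteqP; split => -[x y] [h1 h2]; exact: conj h2 h1.
  by rewrite swX (leb2X mD mB) muleC.
apply: (@Rintegral_partial1_eq0 (g \o sw) (dg \o sw) C).
- exact: measurableT_comp.
- by move=> x /=; rewrite -(k2sw x).
- by move=> x /=; rewrite -(k2sw x).
- by move=> a b; exact: hder.
Qed.

End Plane.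

Section LineIntegral.
Context {R : realType}.
Notation leb := (@lebesgue_measure R).

Lemma Rintegral_shift1 (f : R -> R) c : measurable_fun setT f ->
  Rintegrable leb (fun x => f (x + c)) ->
  \int[leb]_x f (x + c) = \int[leb]_x f x.
Proof.
move=> mf intf.
have E : f \o affine1 1 c = (fun x => f (x + c)).
  by apply/funext => x; rewrite /= /affine1 mul1r.
have ia : Rintegrable (@leb1 R) (f \o affine1 1 c) by rewrite E.
have H := Rintegral_image_measure (measurable_affine1 1 c) mf ia.
transitivity (\int[@leb1 R]_x f (affine1 1 c x)).
  by apply: eq_Rintegral => x _; rewrite /affine1 mul1r.
rewrite -H.
have -> : (\int[leb]_x f x) = \int[@leb1 R]_x f x by [].
apply: (congr1 fine); apply: eq_measure_integral => A mA _.
have H2 : (@leb1 R) A = (1 * (@leb1 R) (affine1 1 c @^-1` A))%E := lebesgue_affine1 c ltr01 mA.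
exact: (esym (etrans H2 (mul1e _))).
Qed.

Lemma Rintegral_der_eq0 (g dg : R -> R) (C : R) :
  (forall x, `|g x| <= C * k1 x) -> (forall x, `|dg x| <= C * k1 x) ->
  (forall x, der g x (dg x)) -> \int[leb]_x dg x = 0.
Proof.
move=> gC dgC hder.
have mg : measurable_fun setT g.
  by apply: continuous_measurable_fun => x; exact: der_continuous (hder x).
have C0 : 0 <= C.
  by have := le_trans (normr_ge0 _) (gC 0); rewrite pmulr_lge0// k1_gt0.
have bd (h : R) x : `|h| < 1 -> k1 (x + h) <= 4 * k1 x.
  move=> h1; apply: le_trans (k1_shift _ _) _; rewrite ler_pM2r ?k1_gt0//.
  by move: h1; rewrite ltr_norml => /andP[h1 h1']; nra.
have ig : Rintegrable leb (fun x => C * (4 * k1 x)).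
  by apply: RintegrableZ; apply: RintegrableZ; exact: Rintegrable_k1.
have ish h : `|h| < 1 -> Rintegrable leb (fun x => g (x + h)).
  move=> h1; apply: (Rintegrable_le _ _ ig).
    by apply: (measurableT_comp mg); exact: measurable_funD.
  by move=> x; apply: le_trans (gC _) _; rewrite ler_wpM2l// bd.
have D : der (fun h => \int[leb]_x g (x + h)) 0 (\int[leb]_x dg (x + 0)).
  apply: (@der_Rintegral _ _ R leb (fun h x => g (x + h))
    (fun h x => dg (x + h)) (fun x => C * (4 * k1 x)) 0 1 ltr01) => //.
  - by move=> h; rewrite subr0; exact: ish.
  - move=> h x _.
    have d2 : der (fun h => x + h) h 1 by der_auto; rewrite add0r.
    by have := der_comp d2 (hder (x + h)); rewrite mulr1.
  - move=> h x; rewrite subr0 => h1; apply: le_trans (dgC _) _.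
    by rewrite ler_wpM2l// bd.
have D0 : der (fun h => \int[leb]_x g (x + h)) 0 0.
  apply: (@der_near _ (fun=> \int[leb]_x g x) _ _ _ 1 ltr01 _ (der_cst _ _)).
  by move=> h; rewrite subr0 => h1; rewrite Rintegral_shift1//; exact: ish.
have := der_unique D D0; rewrite -[X in _ = X -> _]/(0 : R) => <-.
by apply: eq_Rintegral => x _; rewrite addr0.
Qed.

(** Serves at the origin for z |z|, where the formulas for the two half-lines meet. *)
Lemma der_quadratic0 (f : R -> R) (C : R) : (forall h, `|f h| <= C * h ^+ 2) -> der f 0 0.
Proof.
move=> fC.
have f0 : f 0 = 0.
  by apply/eqP; rewrite -normr_le0; have := fC 0; rewrite expr0n/= mulr0.
have C0 : 0 <= C by have := le_trans (normr_ge0 _) (fC 1); rewrite expr1n mulr1.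
have L : h^-1 *: (f (h *: 1 + 0) - f 0) @[h --> (0 : R)^'] --> (0 : R).
  apply/cvgrPdist_lt => e e0; near=> h.
  have hn0 : h != 0 by near: h; exact: nbhs_dnbhs_neq.
  have he : `|h| < e / (C + 1).
    by near: h; apply: dnbhs0_lt; rewrite divr_gt0// ltr_wpDl.
  rewrite sub0r normrN f0 subr0 addr0 /GRing.scale/= mulr1 normrM normfV.
  rewrite ltr_pdivrMl ?normr_gt0//; apply: (le_lt_trans (fC h)).
  rewrite -real_normK ?num_real// expr2 mulrCA ltr_pM2l ?normr_gt0//.
  move: he; rewrite ltr_pdivlMr ?ltr_wpDl// => he.
  by apply: le_lt_trans he; rewrite mulrC ler_wpM2l// lerDl.
apply: DeriveDef; last exact: cvg_lim L.
by apply/cvg_ex; exists 0.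
Unshelve. all: by end_near. Qed.

End LineIntegral.

(** * The Hardy uniqueness principle on the line *)

Section CountingIntegral.
Context {R : realType}.

(** With series written as integrals over [nat], exchanging a sum with an integral or
    differentiating a sum are instances of the lemmas on integrals. *)
Definition nat_counting : set nat -> \bar R := @counting nat R.
HB.instance Definition _ := Measure.on nat_counting.
HB.instance Definition _ :=
  Measure_isSigmaFinite.Build _ _ _ nat_counting (@sigma_finite_counting R).

Notation cnt := (@counting nat R).
Implicit Type f : nat -> R.

Lemma Rintegral_counting_single f m :
  \int[cnt]_n ((n == m)%:R * f n) = f m.
Proof.
have -> : (fun n => (n == m)%:R * f n) = (fun n => f m * \1_[set m] n).
  apply/funext => n; rewrite indicE; case: eqVneq => [->|nm].
    by rewrite mem_set// mulrC.
  by rewrite memNset/= ?mulr0 ?mul0r//; exact/eqP.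
have E : (\int[cnt]_n (\1_[set m] n)%:E = 1)%E.
  rewrite integral_indic// setIT -[LHS]/(counting [set m]) /counting asboolT; last exact: finite_set1.
  by rewrite fset_set1 finmap.cardfs1.
have i1 : Rintegrable cnt (\1_[set m] : nat -> R).
  apply/integrableP; split; first exact/measurable_EFinP.
  under eq_integral => n _ do rewrite /= ger0_norm//.
  by rewrite E ltry.
by rewrite RintegralZl// /Rintegral E mulr1.
Qed.

Lemma Rintegrable_counting f C :
  (forall N, \sum_(0 <= n < N) `|f n| <= C) -> Rintegrable cnt f.
Proof.
move=> h; apply/integrableP; split; first exact/measurable_EFinP.
rewrite ge0_integral_count//=.
apply: (@le_lt_trans _ _ C%:E); last exact: ltry.
apply: lime_le; first by apply: is_cvg_nneseries => n _.
by apply: nearW => N; rewrite sumEFin lee_fin.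
Qed.

Lemma geometric_sum_le (r : R) N : 0 <= r < 1 -> \sum_(0 <= n < N) r ^+ n <= (1 - r)^-1.
Proof.
move=> /andP[r0 r1]; have r1' : 0 < 1 - r by rewrite subr_gt0.
have -> : \sum_(0 <= n < N) r ^+ n = (1 - r)^-1 * (1 - r ^+ N).
  elim: N => [|N IH]; first by rewrite big_geq// expr0 subrr mulr0.
  rewrite big_nat_recr//= IH exprS; field.
  by rewrite lt0r_neq0.
by apply: ler_piMr; [rewrite invr_ge0 ltW|rewrite gerBl exprn_ge0].
Qed.

Lemma Rintegrable_geometric C r : 0 <= r < 1 -> Rintegrable cnt (fun n => C * r ^+ n).
Proof.
move=> r01; apply: RintegrableZ.
apply: (@Rintegrable_counting _ (1 - r)^-1) => N.
under eq_bigr do rewrite ger0_norm ?exprn_ge0 ?(andP r01).1//.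
exact: geometric_sum_le.
Qed.

(** Dominated convergence for the truncations of [f]. *)
Lemma cvg_series_Rintegral f : Rintegrable cnt f ->
  series f @ \oo --> \int[cnt]_n f n.
Proof.
move=> intf.
have -> : series f = (fun N => \int[cnt]_n ((n < N)%N%:R * f n)).
  apply/funext; elim => [|N IH].
    rewrite /series/= big_geq//.
    rewrite (_ : (fun n => _) = (fun=> 0)); first by rewrite /Rintegral integral0.
    by apply/funext => n; rewrite mul0r.
  rewrite /series/= big_nat_recr//= -[X in X + _]/(series f N) IH.
  rewrite -(Rintegral_counting_single f N) -RintegralD//.
  - apply: eq_Rintegral => n _; rewrite -mulrDl; congr (_ * _).
    have -> : (n < N.+1)%N = (n == N) || (n < N)%N by rewrite ltnS leq_eqVlt.
    by case: eqVneq => [->|_] /=; rewrite ?ltnn ?add0r ?addr0.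
  - apply: (Rintegrable_le _ _ (integrable_norm intf)) => // n /=.
    by case: (n < N)%N; rewrite ?mul1r// mul0r normr0.
  - apply: (Rintegrable_le _ _ (integrable_norm intf)) => // n /=.
    by case: (n == N); rewrite ?mul1r// mul0r normr0.
apply: (@Rintegral_dominated _ _ _ _ _ f (fun n => `|f n|)) => //.
- move=> n; apply/cvgrPdist_lt => eps eps0; exists n.+1 => // N /= nN.
  by rewrite nN mul1r subrr normr0.
- by move=> N n; case: (n < N)%N; rewrite ?mul1r// mul0r normr0.
- exact: integrable_norm intf.
Qed.

Lemma Rintegrable_exp_coeff (x : R) : Rintegrable cnt (fun n => x ^+ n / n`!%:R).
Proof.
apply: (@Rintegrable_counting _ (expR `|x|)) => N.
rewrite (_ : \sum_(0 <= n < N) _ = series (exp_coeff `|x|) N); last first.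
  rewrite /series/= ; apply: eq_bigr => n _.
  by rewrite /exp_coeff/= normrM normrX normfV [X in _ / X]ger0_norm.
have nd : nondecreasing_seq (series (exp_coeff `|x|)).
  by apply/nondecreasing_series => n _ _; exact: exp_coeff_ge0.
have := nondecreasing_cvgn_le nd (is_cvg_series_exp_coeff `|x|) N.
by [].
Qed.

Lemma Rintegral_exp_coeff (x : R) : \int[cnt]_n (x ^+ n / n`!%:R) = expR x.
Proof.
have h := cvg_series_Rintegral (Rintegrable_exp_coeff x).
exact/esym/cvg_lim.
Qed.

Lemma pow_fact_le_expR (x : R) n : 0 <= x -> x ^+ n / n`!%:R <= expR x.
Proof.
move=> x0; case: n => [|n].
  by rewrite expr0 fact0 divr1 -expR0 ler_expR.
by apply: le_trans (expR_ge1Dxn n x0); rewrite lerDr.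
Qed.

Lemma Rintegrable_sin_coeff (x : R) :
  Rintegrable cnt (fun n => (-1) ^+ n * x ^+ n.*2.+1 / n.*2.+1`!%:R).
Proof.
(* The majorant comes from (4|x|)^(2n+1) / (2n+1)! <= exp (4|x|) and 2^n <= 4^(2n+1). *)
apply: (Rintegrable_le _ (g := fun n => expR (4 * `|x|) * 2^-1 ^+ n)) => //; last first.
  by apply: Rintegrable_geometric; rewrite invr_ge0 invf_lt1 ?ltr1n// ler0n.
move=> n.
rewrite normrM normfV [X in _ / X]ger0_norm// normrM normrX normrN1 expr1n mul1r normrX.
have x0 : 0 <= 4 * `|x| by rewrite mulr_ge0.
have := pow_fact_le_expR n.*2.+1 x0.
rewrite exprMn -mulrA => h.
rewrite -ler_pdivrMr ?exprn_gt0 ?invr_gt0//; apply: le_trans h.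
rewrite mulrC ler_wpM2r ?divr_ge0 ?exprn_ge0//.
rewrite -exprVn invrK; apply: (@le_trans _ _ (4 ^+ n)).
  by apply: lerXn2r; rewrite ?nnegrE ?ler_nat.
apply: ler_weXn2l; first by rewrite ler1n.
by rewrite -addnn -addnS leq_addr.
Qed.

Lemma Rintegral_sin_coeff (x : R) :
  \int[cnt]_n ((-1) ^+ n * x ^+ n.*2.+1 / n.*2.+1`!%:R) = sin x.
Proof.
have h := cvg_series_Rintegral (Rintegrable_sin_coeff x).
have E : (fun n => (-1) ^+ n * x ^+ n.*2.+1 / n.*2.+1`!%:R) = sin_coeff' x.
  by apply/funext => n; rewrite /sin_coeff' exprnP.
have h' := @cvg_sin_coeff' R x; rewrite -E in h'.
exact: (cvg_unique _ h h').
Qed.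

End CountingIntegral.

(** * Analytic continuation from factorial bounds on derivatives *)

Section Ladder.
Context {R : realType}.

Lemma der_ndecr (f df : R -> R) (a b : R) : a <= b ->
  (forall t, der f t (df t)) -> (forall t, a < t < b -> 0 <= df t) -> f a <= f b.
Proof.
rewrite le_eqVlt => /predU1P[->//|ab] hf h0.
have cf : {within `[a, b], continuous f}.
  apply: continuous_subspaceT => t; exact: der_continuous (hf t).
have [c cab E] := MVT ab (fun t _ => hf t) cf.
rewrite -subr_ge0 E mulr_ge0 ?subr_ge0//; last exact: ltW.
by apply: h0; move: cab; rewrite in_itv.
Qed.

(** Integration of a derivative bound without integrals: the majorant plus or minus [g] is
    nondecreasing. *)
Lemma der_norm_le (g dg : R -> R) (K h : R) (m : nat) : 0 <= K ->
  (forall t, der g t (dg t)) -> g 0 = 0 ->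
  (forall t, 0 <= t <= h -> `|dg t| <= K * (t ^+ m / m`!%:R)) ->
  forall t, 0 <= t <= h -> `|g t| <= K * (t ^+ m.+1 / m.+1`!%:R).
Proof.
move=> K0 hg g0 hb t /andP[t0 th].
have dp s : der (fun s => K * (s ^+ m.+1 / m.+1`!%:R)) s (K * (s ^+ m / m`!%:R)).
  der_auto; rewrite /= factS natrM; field.
  by rewrite pnatr_eq0 -lt0n fact_gt0 /= nat1r pnatr_eq0.
have bd s : 0 < s < t -> `|dg s| <= K * (s ^+ m / m`!%:R).
  by move=> /andP[s0 st]; rewrite hb// ltW//= (le_trans (ltW st)).
rewrite ler_norml -subr_ge0 -[X in _ && X]subr_ge0 opprK; apply/andP; split.
  have := @der_ndecr (fun s => g s + K * (s ^+ m.+1 / m.+1`!%:R))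
    (fun s => dg s + K * (s ^+ m / m`!%:R)) 0 t t0.
  rewrite g0 expr0n/= mul0r mulr0 addr0; apply.
    by move=> s; exact: derD.
  by move=> s /bd; rewrite ler_norml => /andP[]; rewrite -subr_ge0 opprK.
have := @der_ndecr (fun s => K * (s ^+ m.+1 / m.+1`!%:R) - g s)
  (fun s => K * (s ^+ m / m`!%:R) - dg s) 0 t t0.
rewrite g0 expr0n/= mul0r mulr0 subr0; apply.
  by move=> s; apply: derD => //; exact: derN.
by move=> s /bd; rewrite ler_norml => /andP[_]; rewrite subr_ge0.
Qed.

Variables (q : nat -> R -> R) (A : R).
Hypotheses (A0 : 0 < A) (dq : forall j t, der (q j) t (q j.+1 t)).
Hypothesis (bq : forall j, exists C, forall i t, `|q (j + i) t| <= C * A ^+ i * i`!%:R).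

(** Taylor's formula at [t0] with all coefficients zero: the remainder of order [J] is at most C (A
    h)^J, hence at most C / 2^J. *)
Lemma ladder_local t0 : (forall j, q j t0 = 0) ->
  forall j h, 0 <= h <= (2 * A)^-1 -> q j (t0 + h) = 0.
Proof.
move=> q0 j h /andP[h0 hA]; have [C HC] := bq j.
have C0 : 0 <= C.
  by have := le_trans (normr_ge0 _) (HC 0 0); rewrite expr0 fact0 !mulr1.
have A2 : 0 < 2 * A by rewrite mulr_gt0.
have dq' i t : der (fun s => q i (t0 + s)) t (q i.+1 (t0 + t)).
  have d1 : der (fun s => t0 + s) t 1 by der_auto; rewrite add0r.
  by have := der_comp d1 (dq i (t0 + t)); rewrite mulr1.
(* Descent from the derivative of order j + J, which is bounded by C A^J J!; each integration raises
   the power in t^i / i! by one. *)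
have key J i : (i <= J)%N -> forall t, 0 <= t <= h ->
    `|q (j + (J - i)) (t0 + t)| <= (C * A ^+ J * J`!%:R) * (t ^+ i / i`!%:R).
  elim: i => [_|i IH iJ] t tI.
    by rewrite subn0 expr0 fact0 divr1 mulr1 HC.
  apply: (@der_norm_le (fun s => q (j + (J - i.+1)) (t0 + s))
    (fun s => q (j + (J - i)) (t0 + s)) _ h) => //.
  - by rewrite mulr_ge0 ?ler0n// mulr_ge0// exprn_ge0// ltW.
  - move=> s; have := dq' (j + (J - i.+1))%N s.
    by rewrite -addnS subnSK.
  - by rewrite addr0 q0.
  - by move=> s sI; apply: IH => //; exact: ltnW.
have bJ J : `|q j (t0 + h)| <= C * 2^-1 ^+ J.
  have := key J J (leqnn J) h; rewrite subnn addn0 h0 lexx => /(_ isT) H.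
  apply: le_trans H _.
  rewrite -!mulrA ler_wpM2l// [J`!%:R * _]mulrC divfK; last first.
    by rewrite pnatr_eq0 -lt0n fact_gt0.
  rewrite -exprMn; apply: lerXn2r; rewrite ?nnegrE ?invr_ge0// ?(mulr_ge0 (ltW A0))//.
  apply: le_trans (ler_wpM2l (ltW A0) hA) _.
  by rewrite invfM mulrCA divff ?mulr1// gt_eqF.
have lim0 : (fun J => C * 2^-1 ^+ J) @ \oo --> (0 : R).
  rewrite -[X in _ --> X](mulr0 C); apply: cvgM; first exact: cvg_cst.
  by apply: cvg_expr; rewrite ger0_norm ?invr_ge0// invf_lt1// ltr1n.
apply/eqP; rewrite -normr_le0.
apply: (ler_cvg_to (cvg_cst _) lim0).
by apply: nearW => J; exact: bJ.
Qed.

(** The admissible step 1 / (2A) is the same at every point, so finitely many local continuations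
    reach any [t]. *)
Lemma ladder : (forall j, q j 0 = 0) -> forall j t, 0 <= t -> q j t = 0.
Proof.
move=> q0 j t t0; pose h := (2 * A)^-1.
have h0 : 0 < h by rewrite invr_gt0 mulr_gt0.
have step n : forall j, q j (n%:R * h) = 0.
  elim: n => [|n IH] i; first by rewrite mul0r.
  rewrite -natr1 mulrDl mul1r; apply: ladder_local => //.
  by rewrite lexx ltW.
pose n := Num.truncn (t / h).
have /andP[n1 n2] := truncn_itv (divr_ge0 t0 (ltW h0)).
have -> : t = n%:R * h + (t - n%:R * h) by rewrite addrC subrK.
apply: ladder_local => //; rewrite subr_ge0 -ler_pdivlMr// n1/= lerBlDr.
by move: n2; rewrite ltr_pdivrMr// -natr1 mulrDl mul1r addrC => /ltW.
Qed.

End Ladder.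

(** * Exponential sums along the real and the imaginary direction *)

Section ExponentialSums.
Context d (Y : measurableType d) (R : realType).
Variable nu : {measure set Y -> \bar R}.
Variables (a w : Y -> R) (eta : R).
Hypotheses (ma : measurable_fun setT a) (mw : measurable_fun setT w) (eta0 : 0 < eta).
Hypothesis ia : Rintegrable nu (fun y => `|a y| * expR (eta * `|w y|)).

Let I0 := \int[nu]_y (`|a y| * expR (eta * `|w y|)).

Lemma pow_le_expR (x e : R) j : 0 < e -> 0 <= x ->
  x ^+ j <= j`!%:R * e^-1 ^+ j * expR (e * x).
Proof.
move=> e0 x0; have := pow_fact_le_expR j (mulr_ge0 (ltW e0) x0).
rewrite ler_pdivrMr ?ltr0n ?fact_gt0// exprMn => h.
rewrite exprVn -mulrA mulrCA ler_pdivlMl ?exprn_gt0//.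
by rewrite [j`!%:R * _]mulrC.
Qed.

(** A portion [e] of the exponential margin [eta] pays for the power of [w], at the price j! /
    e^j. *)
Lemma expsum_bound (h : Y -> R) j e : 0 < e ->
  (forall y, `|h y| <= expR ((eta - e) * `|w y|)) ->
  forall y, `|a y * w y ^+ j * h y| <=
    j`!%:R * e^-1 ^+ j * (`|a y| * expR (eta * `|w y|)).
Proof.
move=> e0 hh y; rewrite !normrM normrX -mulrA [leRHS]mulrCA.
rewrite ler_wpM2l//; apply: (le_trans (ler_wpM2l _ (hh y))).
  by rewrite exprn_ge0.
have -> : eta * `|w y| = e * `|w y| + (eta - e) * `|w y| by ring.
by rewrite expRD mulrA ler_wpM2r ?expR_ge0//; exact: pow_le_expR.
Qed.

Lemma expsum_integrable (h : Y -> R) j e : 0 < e -> measurable_fun setT h ->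
  (forall y, `|h y| <= expR ((eta - e) * `|w y|)) ->
  Rintegrable nu (fun y => a y * w y ^+ j * h y).
Proof.
move=> e0 mh hh; apply: (Rintegrable_le _ (expsum_bound j e0 hh) (RintegrableZ _ ia)).
apply: measurable_funM => //; apply: measurable_funM => //.
exact: measurable_funX.
Qed.

Definition expsum j t := \int[nu]_y (a y * w y ^+ j * expR (t * w y)).

Lemma der_expsum j t : `|t| < eta -> der (expsum j) t (expsum j.+1 t).
Proof.
move=> te; pose e := (eta - `|t|) / 2.
have e0 : 0 < e by rewrite divr_gt0// subr_gt0.
have bd x y : `|x - t| < e -> `|expR (x * w y)| <= expR ((eta - e) * `|w y|).
  move=> xt; rewrite ger0_norm ?expR_ge0// ler_expR.
  apply: le_trans (ler_norm _) _; rewrite normrM ler_wpM2r//.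
  have : `|x| <= `|x - t| + `|t| by rewrite -{1}(subrK t x) ler_normD.
  by rewrite /e in xt *; lra.
have mexp x : measurable_fun setT (fun y => expR (x * w y)).
  by apply: measurableT_comp => //; exact: measurable_funM.
apply: (@der_Rintegral _ _ _ nu (fun t y => a y * w y ^+ j * expR (t * w y))
  (fun t y => a y * w y ^+ j.+1 * expR (t * w y)) _ t e e0 _ _ _ (RintegrableZ (j.+1`!%:R * e^-1 ^+ j.+1) ia)).
- by move=> x xt; apply: (expsum_integrable _ e0) => // y; exact: bd.
- move=> x y _; der_auto; rewrite /= exprS; ring.
- by move=> x y xt; apply: (@expsum_bound (fun y => expR (x * w y)) j.+1 e e0) => y'; exact: bd.
Qed.

(** The j-th derivative in t of the real part of the integral of a exp (i (t w + delta)): each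
    differentiation advances the phase by a quarter turn. *)
Definition trigsum (delta : R) j t :=
  \int[nu]_y (a y * w y ^+ j * cos (t * w y + j%:R * (pi / 2) + delta)).

Let cos_bd (x : R) y : `|cos x| <= expR ((eta - eta) * `|w y|).
Proof. by rewrite subrr mul0r expR0 cos_max. Qed.

Let mcos t c : measurable_fun setT (fun y => cos (t * w y + c)).
Proof.
apply: (measurableT_comp (continuous_measurable_fun (@continuous_cos R))).
by apply: measurable_funD => //; exact: measurable_funM.
Qed.

Lemma der_trigsum delta j t : der (trigsum delta j) t (trigsum delta j.+1 t).
Proof.
apply: (@der_Rintegral _ _ _ nu
  (fun t y => a y * w y ^+ j * cos (t * w y + j%:R * (pi / 2) + delta))
  (fun t y => a y * w y ^+ j.+1 * cos (t * w y + j.+1%:R * (pi / 2) + delta))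
  _ t 1 ltr01 _ _ _ (RintegrableZ (j.+1`!%:R * eta^-1 ^+ j.+1) ia)).
- move=> x _; apply: (expsum_integrable _ eta0) => //.
  by under eq_fun do rewrite -addrA; exact: mcos.
- move=> x y _.
  have -> : x * w y + j.+1%:R * (pi / 2) + delta =
            (x * w y + j%:R * (pi / 2) + delta) + pi / 2.
    by rewrite -natr1; ring.
  rewrite cosD cos_pihalf sin_pihalf mulr0 mulr1 sub0r.
  der_auto; rewrite /= exprS; ring.
- by move=> x y _; apply: (@expsum_bound (fun y => cos (x * w y + j.+1%:R * (pi / 2) + delta)) j.+1 eta eta0).
Qed.

(** Half of [eta] absorbs w^j and the other half w^i, so the constant depends on [j] alone and the
    growth in [i] has the form required by [ladder]. *)
Lemma trigsum_bound delta j : exists C, forall i t,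
  `|trigsum delta (j + i) t| <= C * (2 / eta) ^+ i * i`!%:R.
Proof.
exists (j`!%:R * (2 / eta) ^+ j * I0) => i t.
have e2 : 0 < eta / 2 by rewrite divr_gt0.
have -> : j`!%:R * (2 / eta) ^+ j * I0 * (2 / eta) ^+ i * i`!%:R =
  \int[nu]_y ((j`!%:R * (2 / eta) ^+ j * ((2 / eta) ^+ i * i`!%:R)) *
     (`|a y| * expR (eta * `|w y|))).
  by rewrite RintegralZl// /I0; ring.
apply: normr_Rintegral_le.
- apply: (expsum_integrable _ eta0) => //.
  by under eq_fun do rewrite -addrA; exact: mcos.
- exact: RintegrableZ.
move=> y; rewrite !normrM normrX.
apply: (@le_trans _ _ (`|a y| * `|w y| ^+ (j + i))).
  by rewrite ler_piMr ?cos_max// mulr_ge0// exprn_ge0.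
rewrite mulrCA ler_wpM2l// exprD.
have -> : eta * `|w y| = eta / 2 * `|w y| + eta / 2 * `|w y| by field.
have h k := @pow_le_expR `|w y| (eta / 2) k e2 (normr_ge0 _).
rewrite invf_div in h.
rewrite expRD; apply: (le_trans (ler_pM _ _ (h j) (h i))); rewrite ?exprn_ge0//.
by rewrite le_eqVlt; apply/orP; left; apply/eqP; ring.
Qed.

(** At t = 0 the phase no longer depends on [y], so vanishing derivatives in the real direction pass
    to the imaginary direction. *)
Lemma trigsum0 delta j : trigsum delta j 0 = expsum j 0 * cos (j%:R * (pi / 2) + delta).
Proof.
rewrite /trigsum /expsum -RintegralZr//.
  by apply: eq_Rintegral => y _; rewrite !mul0r add0r expR0 mulr1.
apply: (expsum_integrable _ eta0) => //.
  by apply: measurableT_comp => //; exact: measurable_funM.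
by move=> y; rewrite mul0r expR0 subrr mul0r expR0 normr1.
Qed.

Lemma expsum_coeff_integrable : Rintegrable nu a.
Proof.
apply: (Rintegrable_le ma _ ia) => y.
by rewrite ler_peMr// -expR0 ler_expR mulr_ge0// ltW.
Qed.

End ExponentialSums.

Section TrigPrimitive.
Context d (Y : measurableType d) (R : realType).
Variable nu : {measure set Y -> \bar R}.
Variables (a w : Y -> R).
Hypotheses (mw : measurable_fun setT w) (mwV : measurable_fun setT (fun y => (w y)^-1)).
Hypothesis ia : Rintegrable nu a.
Hypothesis w1 : forall y, w y != 0 -> 1 <= `|w y|.

(** Since 0^-1 = 0, a zero frequency contributes nothing here, and [w y / w y] records this in the
    derivative: the result is a primitive of the cosine sum without its constant term, which is what
    stays bounded. *)
Definition trigprim t := \int[nu]_y (a y * (sin (t * w y) / w y)).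

Let bd t y : `|a y * (sin (t * w y) / w y)| <= `|a y|.
Proof.
rewrite normrM ler_piMr//; have [->|w0] := eqVneq (w y) 0.
  by rewrite invr0 mulr0 normr0.
rewrite normrM normfV ler_pdivrMr ?normr_gt0// mul1r.
exact: le_trans (sin_max _) (w1 w0).
Qed.

Let ma := Rintegrable_measurable ia.

Let mint t : measurable_fun setT (fun y => a y * (sin (t * w y) / w y)).
Proof.
apply: measurable_funM => //; apply: measurable_funM.
  apply: (measurableT_comp (continuous_measurable_fun (@continuous_sin R))).
  exact: measurable_funM.
exact: mwV.
Qed.

Lemma der_trigprim t : der trigprim t (\int[nu]_y (a y * (cos (t * w y) * (w y / w y)))).
Proof.
apply: (@der_Rintegral _ _ _ nu (fun t y => a y * (sin (t * w y) / w y))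
  (fun t y => a y * (cos (t * w y) * (w y / w y))) (fun y => `|a y|) t 1 ltr01).
- move=> x _; apply: (Rintegrable_le (mint x) (bd x)).
  exact: integrable_norm ia.
- by move=> x y _; der_auto; rewrite /=; ring.
- move=> x y _; rewrite normrM ler_piMr// normrM.
  apply: mulr_ile1 => //; first exact: cos_max.
  have [->|w0] := eqVneq (w y) 0; first by rewrite mul0r normr0.
  by rewrite divff// normr1.
- exact: integrable_norm ia.
Qed.

Lemma trigprim_bound t : `|trigprim t| <= \int[nu]_y `|a y|.
Proof.
apply: normr_Rintegral_le => //; last exact: integrable_norm ia.
by apply: (Rintegrable_le (mint t) (bd t)); exact: integrable_norm ia.
Qed.

End TrigPrimitive.

(** * Uniqueness for two expansions on a common interval *)

Section Laurent.
Context {R : realType}.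
Notation cnt := (@counting nat R).
Variables (c g : nat -> R) (C s b : R).
Hypotheses (s0 : 0 < s) (sb : s < b).
Hypotheses (cC : forall k, `|c k| <= C * b^-1 ^+ k) (gC : forall n, `|g n| <= C * s ^+ n).
Hypothesis cg : forall x, s < x < b ->
  \int[cnt]_k (c k * x ^+ k) = \int[cnt]_n (g n * x^-1 ^+ n.+1).

Lemma exists_expR_lt (r : R) : 1 < r -> exists2 e : R, 0 < e & expR e < r.
Proof.
move=> r1; have h : 0 < (1 + r) / 2 by lra.
exists (ln ((1 + r) / 2)); first by apply: ln_gt0; lra.
by rewrite lnK ?posrE//; lra.
Qed.

(* Both sides continue analytically to a whole annulus: along the circle through
   [x0] every derivative of the difference vanishes, so it vanishes identically;
   then [Q], a primitive of the constant [g m], stays bounded. *)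
Lemma laurent_eq0 m : g m = 0.
Proof.
have b0 : 0 < b := lt_trans s0 sb.
have [x0 sx0 x0b] : exists2 x0 : R, s < x0 & x0 < b.
  by exists ((s + b) / 2); [exact: (midf_lt sb).1|exact: (midf_lt sb).2].
have x00 : 0 < x0 := lt_trans s0 sx0.
have x0V : 0 <= x0^-1 by rewrite invr_ge0 ltW.
(* Margins for which x0 exp e < b and s < x0 exp (- e), so that both coefficient sequences keep a
   geometric majorant after multiplication by exp (e |w|). *)
have [e1 e10 e1b] : exists2 e : R, 0 < e & expR e < b / x0.
  by apply: exists_expR_lt; rewrite ltr_pdivlMr// mul1r.
have [e2 e20 e2b] : exists2 e : R, 0 < e & expR e < x0 / s.
  by apply: exists_expR_lt; rewrite ltr_pdivlMr// mul1r.
pose e := Num.min e1 e2.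
have e0 : 0 < e by rewrite lt_min e10.
have eb : expR e < b / x0.
  by apply: le_lt_trans e1b; rewrite ler_expR ge_min lexx.
have es : expR e < x0 / s.
  by apply: le_lt_trans e2b; rewrite ler_expR ge_min lexx orbT.
have C0 : 0 <= C by have := le_trans (normr_ge0 _) (cC 0); rewrite expr0 mulr1.
(* With x = x0 exp t, the two expansions become exponential sums in t with frequencies k and - (n +
   1). *)
pose aP k := c k * x0 ^+ k; pose wP (k : nat) : R := k%:R.
pose aN n := g n * x0^-1 ^+ n.+1; pose wN (n : nat) : R := - n.+1%:R.
have iP : Rintegrable cnt (fun y => `|aP y| * expR (e * `|wP y|)).
  apply: (Rintegrable_le _ (g := fun k => C * (x0 * expR e / b) ^+ k)) => //; last first.
    apply: Rintegrable_geometric; rewrite divr_ge0 ?mulr_ge0 ?expR_ge0 ?ltW//=.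
    by rewrite ltr_pdivrMr// mul1r mulrC -ltr_pdivlMr.
  move=> k; rewrite ger0_norm ?mulr_ge0 ?expR_ge0// /wP normr_nat mulrC expRM_natr.
  rewrite /aP normrM normrX (ger0_norm (ltW x00)) mulrC !exprMn.
  rewrite -mulrA [X in _ <= X](_ : _ = (C * b^-1 ^+ k) * (x0 ^+ k * expR e ^+ k)); last by ring.
  by rewrite -[X in X <= _]mulrA ler_wpM2r// mulr_ge0 ?exprn_ge0 ?expR_ge0 ?ltW.
have iN : Rintegrable cnt (fun y => `|aN y| * expR (e * `|wN y|)).
  apply: (Rintegrable_le _ (g := fun k => (C * (expR e / x0)) * (s * expR e / x0) ^+ k)) => //; last first.
    apply: Rintegrable_geometric; rewrite divr_ge0 ?mulr_ge0 ?expR_ge0 ?ltW//=.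
    by rewrite ltr_pdivrMr// mul1r mulrC -ltr_pdivlMr.
  move=> k; rewrite ger0_norm ?mulr_ge0 ?expR_ge0// /wN normrN normr_nat mulrC expRM_natr.
  rewrite /aN normrM normrX (ger0_norm x0V) mulrC !exprMn.
  rewrite -mulrA [X in _ <= X](_ : _ = (C * s ^+ k) * (x0^-1 ^+ k.+1 * expR e ^+ k.+1)); last first.
    by rewrite !exprS; ring.
  by rewrite -[X in X <= _]mulrA ler_wpM2r// mulr_ge0 ?exprn_ge0 ?expR_ge0 ?invr_ge0 ?ltW.
have mn (f : nat -> R) : measurable_fun setT f by [].
(* Equality in the real direction: for j = 0 this is [cg]; a higher order follows because the
   difference vanishes on a whole interval. *)
have D0 j t : `|t| < e -> expsum cnt aP wP j t - expsum cnt aN wN j t = 0.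
  elim: j t => [|j IH] t te.
    have [t1 t2] : - e < t /\ t < e by move: te; rewrite ltr_norml => /andP.
    have xe : s < x0 * expR t < b.
      apply/andP; split; last first.
        rewrite mulrC -ltr_pdivlMr//; apply: lt_trans eb; by rewrite ltr_expR.
      apply: (@lt_trans _ _ (x0 * expR (- e))); last by rewrite ltr_pM2l// ltr_expR.
      by rewrite expRN ltr_pdivlMr ?expR_gt0// mulrC -ltr_pdivlMr.
    have := cg xe; rewrite /expsum => cgE.
    apply/eqP; rewrite subr_eq0; apply/eqP; etransitivity; last (etransitivity; first exact: cgE).
      apply: eq_Rintegral => k _; rewrite expr0 mulr1 /aP /wP expRM_natr exprMn; ring.
    apply: eq_Rintegral => k _; rewrite expr0 mulr1 /aN /wN mulrN expRN expRM_natr.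
    by rewrite invfM exprMn !exprVn; ring.
  have d1 := derD (der_expsum (mn aP) (mn wP) iP j te) (derN (der_expsum (mn aN) (mn wN) iN j te)).
  have d2 : der (fun t => expsum cnt aP wP j t - expsum cnt aN wN j t) t 0.
    apply: (@der_near _ (fun=> 0) _ t 0 (e - `|t|)); first by rewrite subr_gt0.
      move=> u ut; rewrite IH//; have : `|u| <= `|u - t| + `|t|.
        by rewrite -{1}(subrK t u) ler_normD.
      by lra.
    exact: der_cst.
  exact: der_unique d1 d2.
(* All derivatives agree at angle 0, so the ladder carries the equality along the circle x0 exp (i
   t), with an arbitrary phase [delta]. *)
have T0 delta j t : 0 <= t -> trigsum cnt aP wP delta j t - trigsum cnt aN wN delta j t = 0.
  apply: (@ladder _ (fun j t => trigsum cnt aP wP delta j t - trigsum cnt aN wN delta j t) (2 / e)).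
  - by rewrite divr_gt0.
  - move=> i u; apply: derD; first exact: (der_trigsum (mn aP) (mn wP) e0 iP).
    by apply: derN; exact: (der_trigsum (mn aN) (mn wN) e0 iN).
  - move=> i; have [C1 h1] := trigsum_bound (mn aP) (mn wP) e0 iP delta i.
    have [C2 h2] := trigsum_bound (mn aN) (mn wN) e0 iN delta i.
    exists (C1 + C2) => k u; apply: (le_trans (ler_normB _ _)).
    by rewrite -mulrA mulrDl !mulrA; apply: lerD; [exact: h1|exact: h2].
  - move=> i; rewrite (trigsum0 (mn aP) (mn wP) e0 iP) (trigsum0 (mn aN) (mn wN) e0 iN).
    by rewrite -mulrBl D0 ?mul0r// normr0.
have iaP := expsum_coeff_integrable (mn aP) e0 iP.
have iaN := expsum_coeff_integrable (mn aN) e0 iN.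
(* The frequencies after multiplication by exp (i (m + 1) t): those of [aP] are positive, and among
   those of [aN] only n = m gives zero. *)
pose vP (k : nat) : R := (k + m.+1)%:R; pose vN (n : nat) : R := m%:R - n%:R.
have vP1 k : vP k != 0 -> 1 <= `|vP k| by rewrite /vP normr_nat ler1n addnS.
have vN1 k : vN k != 0 -> 1 <= `|vN k|.
  rewrite /vN; have [mk|km|->] := ltngtP m k; last by rewrite subrr eqxx.
    by move=> _; rewrite distrC -natrB 1?ltnW// normr_nat ler1n subn_gt0.
  by move=> _; rewrite -natrB 1?ltnW// normr_nat ler1n subn_gt0.
pose Q t := trigprim cnt aP vP t - trigprim cnt aN vN t.
pose dQ t := \int[cnt]_y (aP y * (cos (t * vP y) * (vP y / vP y)))
  - \int[cnt]_y (aN y * (cos (t * vN y) * (vN y / vN y))).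
have hQ t : der Q t (dQ t).
  apply: derD; first exact: (der_trigprim (mn vP) (mn _) iaP vP1).
  by apply: derN; exact: (der_trigprim (mn vN) (mn _) iaN vN1).
(* The phase [delta] = t (m + 1) performs that multiplication. What remains is the sum of aN k cos
   (t vN k) (1 - vN k / vN k), in which only k = m survives, as 0 / 0 = 0. *)
have dQE t : 0 <= t -> dQ t = aN m.
  move=> t0; have := T0 (t * m.+1%:R) 0%N t t0.
  rewrite /trigsum /dQ => /eqP; rewrite subr_eq0 => /eqP E.
  have -> : \int[cnt]_y (aP y * (cos (t * vP y) * (vP y / vP y))) =
            \int[cnt]_y (aP y * wP y ^+ 0 * cos (t * wP y + 0%:R * (pi / 2) + t * m.+1%:R)).
    apply: eq_Rintegral => k _; rewrite expr0 mulr1 mul0r addr0 divff; last first.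
      by rewrite /vP addnS pnatr_eq0.
    by rewrite mulr1 /wP /vP natrD mulrDr.
  rewrite E -RintegralB//; last 2 first.
    apply: (Rintegrable_le _ _ (integrable_norm iaN)) => // k.
    by rewrite expr0 mulr1 normrM ler_piMr// cos_max.
    apply: (Rintegrable_le _ _ (integrable_norm iaN)) => // k.
    rewrite normrM ler_piMr// normrM mulr_ile1// ?cos_max//.
    by have [->|w0] := eqVneq (vN k) 0; rewrite ?mul0r ?normr0// divff// normr1.
  rewrite -[RHS](Rintegral_counting_single aN m); apply: eq_Rintegral => k _.
  have -> : t * wN k + 0%:R * (pi / 2) + t * m.+1%:R = t * vN k.
    by rewrite /wN /vN -!natr1; ring.
  rewrite expr0 mulr1 -mulrBr mulrC; congr (_ * _).
  case: eqVneq => [->|km]; first by rewrite /vN subrr mul0r mulr0 subr0 mulr0 cos0.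
  rewrite divff ?mulr1 ?subrr// /vN subr_eq0 eqr_nat eq_sym; exact: km.
have Q0 : Q 0 = 0.
  rewrite /Q /trigprim; under eq_Rintegral do rewrite mul0r sin0 mul0r mulr0.
  under [X in _ - X]eq_Rintegral do rewrite mul0r sin0 mul0r mulr0.
  by rewrite subrr.
have QE t : 0 <= t -> Q t = aN m * t.
  move=> t0.
  have h1 := @der_ndecr _ (fun t => Q t - aN m * t) (fun t => dQ t - aN m) 0 t t0.
  have h2 := @der_ndecr _ (fun t => aN m * t - Q t) (fun t => aN m - dQ t) 0 t t0.
  have dm u : der (fun t => aN m * t) u (aN m) by der_auto; rewrite /=; ring.
  have {}h1 : Q 0 - aN m * 0 <= Q t - aN m * t.
    apply: h1; first by move=> u; apply: derD => //; exact: derN.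
    by move=> u /andP[u0 _]; rewrite dQE ?subrr// ltW.
  have {}h2 : aN m * 0 - Q 0 <= aN m * t - Q t.
    apply: h2; first by move=> u; apply: derD => //; exact: derN.
    by move=> u /andP[u0 _]; rewrite dQE ?subrr// ltW.
  by move: h1 h2; rewrite Q0 mulr0; lra.
pose B := \int[cnt]_y `|aP y| + \int[cnt]_y `|aN y|.
have QB t : `|Q t| <= B.
  apply: (le_trans (ler_normB _ _)); apply: lerD.
    exact: (trigprim_bound (mn vP) (mn _) iaP vP1).
  exact: (trigprim_bound (mn vN) (mn _) iaN vN1).
have aN0 : aN m = 0.
  apply/eqP/negPn/negP => a0; have an : 0 < `|aN m| by rewrite normr_gt0.
  have B0 : 0 <= B := le_trans (normr_ge0 _) (QB 0).
  have B1 : 0 <= (B + 1) / `|aN m| by rewrite divr_ge0// (addr_ge0 B0).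
  have := QB ((B + 1) / `|aN m|); rewrite (QE _ B1) normrM (ger0_norm B1).
  by rewrite mulrC divfK ?gt_eqF//; lra.
by move/eqP: aN0; rewrite mulf_eq0 expf_eq0 invr_eq0 (gt_eqF x00) andbF orbF => /eqP.
Qed.

End Laurent.

(** * Odd absolute moments of Gaussians *)

Section GaussianMoments.
Context {R : realType}.
Notation leb := (@lebesgue_measure R).

Lemma expR_gauss_le_k1 (s z : R) : 0 < s -> expR (- (s * z ^+ 2)) <= (1 + s^-1) * k1 z.
Proof.
move=> s0; have z0 := sqr_ge0 z; have sV : 0 < s^-1 by rewrite invr_gt0.
rewrite expRN /k1 -invf_div lef_pV2 ?posrE ?expR_gt0 ?divr_gt0 ?one_add_sqr_gt0//; last by lra.
apply: le_trans (expR_ge1Dx _); rewrite ler_pdivrMr; last by lra.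
have -> : (1 + s * z ^+ 2) * (1 + s^-1) = 1 + z ^+ 2 + (s^-1 + s * z ^+ 2).
  by field; rewrite gt_eqF.
rewrite lerDl; apply: addr_ge0; first exact: ltW.
by apply: mulr_ge0 => //; exact: ltW.
Qed.

Lemma continuous_gauss (s : R) : continuous (fun z : R => expR (- (s * z ^+ 2))).
Proof.
move=> z; apply: (@der_continuous _ _ _ (expR (- (s * z ^+ 2)) * (- (s * (2 * z))))).
by der_auto; rewrite /=; ring.
Qed.

Lemma Rintegrable_gauss (s : R) : 0 < s -> Rintegrable leb (fun z => expR (- (s * z ^+ 2))).
Proof.
move=> s0; apply: (Rintegrable_le _ _ (RintegrableZ (1 + s^-1) (@Rintegrable_k1 R))).
  exact: continuous_measurable_fun (@continuous_gauss s).
by move=> z; rewrite ger0_norm ?expR_ge0// expR_gauss_le_k1.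
Qed.

Lemma pow_gauss_le (t : R) n (z : R) : 0 < t ->
  (z ^+ 2) ^+ n <= n`!%:R * t^-1 ^+ n * expR (t * z ^+ 2).
Proof. by move=> t0; apply: pow_le_expR => //; exact: sqr_ge0. Qed.

Lemma abs_gauss_le (t z : R) : 0 < t -> `|z| <= (1 + t^-1) * expR (t * z ^+ 2).
Proof.
move=> t0; have h0 := @pow_gauss_le t 0 z t0; have h1 := @pow_gauss_le t 1 z t0.
have z1 : `|z| <= 1 + z ^+ 2.
  by rewrite -(real_normK (num_real z)); have := sqr_ge0 (`|z| - 1); have := normr_ge0 z; nra.
apply: (le_trans z1); rewrite mulrDl; apply: lerD.
  by move: h0; rewrite !expr0 fact0 !mulr1.
by move: h1; rewrite !expr1 mul1r.
Qed.

Lemma measurable_abs_pow_gauss (s : R) n :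
  measurable_fun setT (fun z : R => `|z| ^+ n * expR (- (s * z ^+ 2))).
Proof.
apply: measurable_funM; last exact: continuous_measurable_fun (@continuous_gauss s).
by apply: measurable_funX; exact: continuous_measurable_fun (@norm_continuous _ R^o).
Qed.

Lemma abs_pow_gauss_le (s t : R) n z : 0 < t -> t < s ->
  `|z| ^+ n.*2.+1 * expR (- (s * z ^+ 2)) <=
  n`!%:R * t^-1 ^+ n * (`|z| * expR (- ((s - t) * z ^+ 2))).
Proof.
move=> t0 ts; rewrite exprS -mul2n exprM real_normK ?num_real//.
have -> : - (s * z ^+ 2) = - (t * z ^+ 2) + - ((s - t) * z ^+ 2) by ring.
rewrite expRD -mulrA [leRHS]mulrCA ler_wpM2l// mulrA ler_wpM2r ?expR_ge0//.
by rewrite expRN ler_pdivrMr ?expR_gt0//; exact: pow_gauss_le.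
Qed.

Lemma Rintegrable_abs_gauss (s : R) : 0 < s ->
  Rintegrable leb (fun z => `|z| * expR (- (s * z ^+ 2))).
Proof.
move=> s0; have s2 : 0 < s / 2 by rewrite divr_gt0.
apply: (Rintegrable_le _ _ (RintegrableZ (1 + (s / 2)^-1) (Rintegrable_gauss s2))).
  exact: (@measurable_abs_pow_gauss s 1).
move=> z; rewrite ger0_norm ?mulr_ge0 ?expR_ge0//.
have -> : - (s * z ^+ 2) = - (s / 2 * z ^+ 2) + - (s / 2 * z ^+ 2) by field.
rewrite expRD mulrA ler_wpM2r ?expR_ge0// expRN ler_pdivrMr ?expR_gt0//.
exact: abs_gauss_le.
Qed.

Lemma Rintegrable_abs_pow_gauss (s : R) n : 0 < s ->
  Rintegrable leb (fun z => `|z| ^+ n.*2.+1 * expR (- (s * z ^+ 2))).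
Proof.
move=> s0; have s2 : 0 < s / 2 by rewrite divr_gt0.
have s22 : s - s / 2 = s / 2 by field.
apply: (Rintegrable_le _ _
  (RintegrableZ (n`!%:R * (s / 2)^-1 ^+ n) (Rintegrable_abs_gauss s2))).
  exact: measurable_abs_pow_gauss.
move=> z; rewrite ger0_norm ?mulr_ge0 ?exprn_ge0 ?expR_ge0//.
by have := @abs_pow_gauss_le s (s / 2) n z s2; rewrite s22; apply; lra.
Qed.

Lemma Rintegral_abs_gauss (s : R) : 0 < s ->
  \int[leb]_z (`|z| * expR (- (s * z ^+ 2))) = s^-1.
Proof.
move=> s0.
have cf : continuous (fun z : R => `|z| * expR (- (s * z ^+ 2))).
  by move=> z; apply: cvgM; [exact: norm_continuous|exact: continuous_gauss].
have dF z : der (fun z => - (expR (- (s * z ^+ 2)) / (2 * s))) z (z * expR (- (s * z ^+ 2))).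
  by der_auto; rewrite /=; field; rewrite gt_eqF.
have f0 z : 0 <= `|z| * expR (- (s * z ^+ 2)) by rewrite mulr_ge0 ?expR_ge0.
have fe : (fun z : R => `|z| * expR (- (s * z ^+ 2))) =1
          (fun z : R => `|z| * expR (- (s * z ^+ 2))) \o -%R.
  by move=> z /=; rewrite normrN sqrrN.
rewrite /Rintegral (ge0_symfun_integralT f0 cf fe).
have -> : [set x : R | 0 <= x] = `[0, +oo[%classic by rewrite -set_itvcy.
rewrite (@ge0_continuous_FTC2y _ _ (fun z => - (expR (- (s * z ^+ 2)) / (2 * s))) 0 0).
- rewrite -[LHS]/(2 * (0 - - (expR (- (s * 0 ^+ 2)) / (2 * s)))).
  rewrite expr0n/= mulr0 oppr0 expR0.
  by field; rewrite gt_eqF.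
- by move=> z _; rewrite mulr_ge0 ?expR_ge0.
- exact: continuous_subspaceT.
- rewrite -oppr0; apply: cvgN; rewrite -[X in _ --> X](mul0r (2 * s)^-1).
  apply: cvgMl.
  apply: (cvg_comp (fun x => s * x ^+ 2) (fun x => expR (- x))); last exact: cvgr_expR.
  apply/cvgryPge => A; near=> x.
  rewrite -ler_pdivrMl//; near: x.
  by have /cvgryPge := @cvgr_expr2 R; apply.
- by move=> z _; case: (dF z).
- by apply: cvg_at_right_filter; exact: (der_continuous (dF 0)).
- move=> z; rewrite in_itv/= andbT => z0.
  by rewrite derive1E; case: (dF z) => _ ->; rewrite ger0_norm// ltW.
Unshelve. all: by end_near. Qed.

(** The derivative of z |z| z^(2n) exp (- s z^2) has integral zero, which is a recursion between
    consecutive moments. The exact values n! / s^(n+1) turn a Taylor series in z into an expansion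
    in powers of 1/s. *)
Lemma Rintegral_abs_pow_gauss (s : R) n : 0 < s ->
  \int[leb]_z (`|z| ^+ n.*2.+1 * expR (- (s * z ^+ 2))) = n`!%:R / s ^+ n.+1.
Proof.
move=> s0; elim: n => [|n IH].
  by rewrite fact0 expr1 mul1r -[RHS](Rintegral_abs_gauss s0).
(* The factor z |z| is chosen because, unlike |z|, it is differentiable at 0. *)
have absD z : der (fun z : R => z * `|z|) z (2 * `|z|).
  have [z0|z0|->] := ltgtP z 0.
  - apply: (@der_near _ (fun z => - z ^+ 2) _ z _ (- z)); first by rewrite oppr_gt0.
      move=> t tz; rewrite ler0_norm; first by rewrite mulrN expr2.
      by move: tz; rewrite ltr_norml => /andP[]; lra.
    by der_auto; rewrite /= ltr0_norm//; ring.
  - apply: (@der_near _ (fun z => z ^+ 2) _ z _ z) => //.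
      move=> t tz; rewrite ger0_norm; first by rewrite expr2.
      by move: tz; rewrite ltr_norml => /andP[]; lra.
    by der_auto; rewrite /= gtr0_norm//; ring.
  - rewrite normr0 mulr0; apply: (@der_quadratic0 _ _ 1) => h.
    by rewrite normrM normr_id mul1r -expr2 real_normK ?num_real.
have gD z : der (fun z => (z * `|z|) * (z ^+ 2) ^+ n * expR (- (s * z ^+ 2))) z
   (2 * n.+1%:R * (`|z| ^+ n.*2.+1 * expR (- (s * z ^+ 2))) -
    2 * s * (`|z| ^+ n.+1.*2.+1 * expR (- (s * z ^+ 2)))).
  have d2 : der (fun z => (z ^+ 2) ^+ n) z (n%:R * (z ^+ 2) ^+ n.-1 * (2 * z)).
    by der_auto; rewrite /=; ring.
  have d3 : der (fun z => expR (- (s * z ^+ 2))) z (expR (- (s * z ^+ 2)) * - (s * (2 * z))).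
    by der_auto; rewrite /=; ring.
  apply: (der_eq (derM (derM (absD z) d2) d3)).
  have E m : `|z| ^+ m.*2.+1 = `|z| * (z ^+ 2) ^+ m.
    by rewrite exprS -mul2n exprM real_normK ?num_real.
  rewrite !E; clear; case: n => [|n]; rewrite /= ?expr0 !(exprS (z ^+ 2)) -?natr1; ring.
have E m (z : R) : `|z| ^+ m.*2.+1 = `|z| * (z ^+ 2) ^+ m.
  by rewrite exprS -mul2n exprM real_normK ?num_real.
have s2 : 0 < s / 2 by rewrite divr_gt0.
have s4 : 0 < s / 4 by rewrite divr_gt0.
have bd m : exists C, forall z, `|z| ^+ m.*2.+1 * expR (- (s * z ^+ 2)) <= C * k1 z.
  exists (m`!%:R * (s / 2)^-1 ^+ m * ((1 + (s / 4)^-1) * (1 + (s / 4)^-1))) => z.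
  apply: (le_trans (@abs_pow_gauss_le s (s / 2) m z s2 _)); first by lra.
  rewrite -[leRHS]mulrA ler_wpM2l ?mulr_ge0 ?exprn_ge0 ?invr_ge0 ?ler0n ?(ltW s2)//.
  rewrite (_ : - ((s - s / 2) * z ^+ 2) = - (s / 4 * z ^+ 2) + - (s / 4 * z ^+ 2)); last by field.
  rewrite expRD mulrA -[leRHS]mulrA ler_pM ?mulr_ge0 ?expR_ge0//; last exact: expR_gauss_le_k1.
  by rewrite expRN ler_pdivrMr ?expR_gt0//; exact: abs_gauss_le.
have gB : exists C, forall z, `|(z * `|z|) * (z ^+ 2) ^+ n * expR (- (s * z ^+ 2))| <= C * k1 z.
  exists (n.+1`!%:R * (s / 2)^-1 ^+ n.+1 * (1 + (s / 2)^-1)) => z.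
  rewrite !normrM normr_id normrX -expr2 real_normK ?num_real// normrX real_normK ?num_real//.
  rewrite (ger0_norm (expR_ge0 _)) -exprS.
  rewrite (_ : - (s * z ^+ 2) = - (s / 2 * z ^+ 2) + - (s / 2 * z ^+ 2)); last by field.
  rewrite expRD mulrA -[leRHS]mulrA.
  apply: ler_pM; [exact: mulr_ge0 (exprn_ge0 _ (sqr_ge0 z)) (expR_ge0 _)|exact: expR_ge0|
    |exact: expR_gauss_le_k1].
  by rewrite expRN ler_pdivrMr ?expR_gt0//; exact: pow_gauss_le.
have [C1 h1] := bd n; have [C2 h2] := bd n.+1; have [C3 h3] := gB.
pose C := `|C3| + (2 * n.+1%:R * `|C1| + 2 * s * `|C2|).
have kk z : 0 <= @k1 R z by exact/ltW/k1_gt0.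
have ha (c z x : R) : x <= c * k1 z -> x <= `|c| * k1 z.
  by move=> h; apply: (le_trans h); rewrite ler_wpM2r// ler_norm.
have Z := @Rintegral_der_eq0 _ _ _ C _ _ gD.
have : \int[leb]_x (2 * n.+1%:R * (`|x| ^+ n.*2.+1 * expR (- (s * x ^+ 2))) -
       2 * s * (`|x| ^+ n.+1.*2.+1 * expR (- (s * x ^+ 2)))) = 0.
  apply: Z => z.
    apply: (le_trans (ha _ _ _ (h3 z))); rewrite ler_wpM2r// lerDl.
    by apply: addr_ge0; apply: mulr_ge0 => //; apply: mulr_ge0 => //; exact: ltW.
  apply: (le_trans (ler_normB _ _)).
  have X0 m : 0 <= `|z| ^+ m.*2.+1 * expR (- (s * z ^+ 2)).
    by rewrite mulr_ge0 ?expR_ge0// exprn_ge0.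
  rewrite (ger0_norm (mulr_ge0 _ (X0 n))) ?mulr_ge0//.
  rewrite (ger0_norm (mulr_ge0 _ (X0 n.+1))) ?mulr_ge0// ?(ltW s0)//.
  apply: (@le_trans _ _ ((2 * n.+1%:R * `|C1| + 2 * s * `|C2|) * k1 z)); last first.
    by rewrite ler_wpM2r ?(ltW (k1_gt0 _))// /C lerDr.
  rewrite [leRHS]mulrDl; apply: lerD.
    by rewrite -[leRHS]mulrA ler_wpM2l ?mulr_ge0//; exact: ha.
  by rewrite -[leRHS]mulrA ler_wpM2l ?mulr_ge0// ?(ltW s0)//; exact: ha.
rewrite RintegralB//; [|exact: (RintegrableZ _ (Rintegrable_abs_pow_gauss n s0))|
  exact: (RintegrableZ _ (Rintegrable_abs_pow_gauss n.+1 s0))].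
rewrite !RintegralZl//; [|exact: Rintegrable_abs_pow_gauss|exact: Rintegrable_abs_pow_gauss].
rewrite IH => /eqP; rewrite subr_eq0 => /eqP H.
have sn : 2 * s != 0 by rewrite mulf_neq0// gt_eqF.
apply: (mulfI sn); rewrite -H factS natrM (exprS s n.+1); field.
by rewrite expf_neq0 gt_eqF.
Qed.

End GaussianMoments.

(** The second factor is countable and discrete, so a preimage is a countable union of its sections
    times singletons. *)
Lemma measurable_fun_pair_nat d (Y : measurableType d) (R : realType) (F : Y * nat -> R) :
  (forall n, measurable_fun setT (fun y => F (y, n))) -> measurable_fun setT F.
Proof.
move=> mF _ A mA; rewrite setTI.
have -> : F @^-1` A = \bigcup_n (((fun y => F (y, n)) @^-1` A) `*` [set n]).
  apply/seteqP; split => [[y n] /= Fyn|[y n] [m _ [/= Fym ->]]//].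
  by exists n.
apply: bigcup_measurable => n _; apply: measurableX => //.
by rewrite -[X in measurable X]setTI; exact: mF.
Qed.

Lemma exprM_CA (R : comPzRingType) (x y w : R) n :
  (x * (y * w)) ^+ n = x ^+ n * w ^+ n * y ^+ n.
Proof. by rewrite !exprMn; ring. Qed.

Lemma exprNMn (R : comPzRingType) (x y : R) n : (- (x * y)) ^+ n = (-1) ^+ n * (x ^+ n * y ^+ n).
Proof. by rewrite -!exprMn mulN1r. Qed.

(** * The Laplace transform of a sine transform and its two expansions *)

Section Hardy.
Context d (Y : measurableType d) (R : realType).
Variable mu : {sigma_finite_measure set Y -> \bar R}.
Notation cnt := (@counting nat R).
Notation leb := (@lebesgue_measure R).
Variables (v l : Y -> R) (alpha b K : R).
Hypotheses (mv : measurable_fun setT v) (ml : measurable_fun setT l).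
Hypotheses (alpha0 : 0 < alpha) (ab : 1 < 4 * alpha * b).
Hypothesis iv : Rintegrable mu (fun y => `|v y| * `|l y| * expR (alpha * l y ^+ 2)).

Let f z := \int[mu]_y (v y * sin (z * l y)).

Hypothesis fK : forall z, `|f z| <= K * expR (- (b * z ^+ 2)).

Let I0 := \int[mu]_y (`|v y| * `|l y| * expR (alpha * l y ^+ 2)).
Let M n := \int[mu]_y (v y * l y ^+ n.*2.+1).

(** Source of the factor 4 in the threshold: decay at rate alpha bounds the moments by n! / alpha^n,
    and division by (2n+1)! leaves (4 alpha)^-n / n!. *)
Lemma fact_double_le n : 4 ^+ n * (n`!%:R * n`!%:R) <= (n.*2.+1)`!%:R :> R.
Proof.
elim: n => [|n IH]; first by rewrite expr0 !mul1r.
rewrite doubleS (factS n.*2.+2) (factS n.*2.+1) (factS n).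
move: IH; move: (n.*2.+1)`! => X IH; rewrite !natrM exprS.
apply: (@le_trans _ _ ((n.*2.+3%:R * n.*2.+2%:R) * (4 ^+ n * (n`!%:R * n`!%:R)))); last first.
  by rewrite -mulrA; do 2 (apply: ler_wpM2l => //).
have n0 : 0 <= n%:R :> R by [].
rewrite (_ : 4 * 4 ^+ n * _ = (4 * n.+1%:R * n.+1%:R) * (4 ^+ n * (n`!%:R * n`!%:R))); last by ring.
apply: ler_wpM2r; first by rewrite !mulr_ge0 ?exprn_ge0.
rewrite -!natr1 -mul2n natrM; nra.
Qed.

Let fact_ratio n : n`!%:R / (n.*2.+1)`!%:R <= 4^-1 ^+ n / n`!%:R :> R.
Proof.
have h := fact_double_le n.
rewrite ler_pdivrMr ?ltr0n ?fact_gt0//.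
rewrite -mulrA mulrCA ler_pdivlMl ?ltr0n ?fact_gt0// exprVn.
by rewrite ler_pdivlMl ?exprn_gt0.
Qed.

Let ml_pow n : measurable_fun setT (fun y => v y * l y ^+ n).
Proof. by apply: measurable_funM => //; exact: measurable_funX. Qed.

Let bdM n y : `|v y * l y ^+ n.*2.+1| <=
  n`!%:R * alpha^-1 ^+ n * (`|v y| * `|l y| * expR (alpha * l y ^+ 2)).
Proof.
rewrite normrM normrX exprS -mul2n exprM real_normK ?num_real// (mulrA `|v y|).
rewrite [leRHS]mulrCA ler_wpM2l ?mulr_ge0//.
exact: pow_gauss_le.
Qed.

Let iM n : Rintegrable mu (fun y => v y * l y ^+ n.*2.+1).
Proof. exact: (Rintegrable_le (ml_pow _) (bdM n) (RintegrableZ _ iv)). Qed.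

Let I0_ge0 : 0 <= I0.
Proof. by apply: Rintegral_ge0 => y _; rewrite !mulr_ge0 ?expR_ge0. Qed.

Let M_le n : `|M n| <= I0 * (n`!%:R * alpha^-1 ^+ n).
Proof.
rewrite mulrC /I0 -RintegralZl//.
apply: normr_Rintegral_le; [exact: iM|exact: (RintegrableZ _ iv)|exact: bdM].
Qed.

Let rho n z := (-1) ^+ n * z ^+ n.*2.+1 / (n.*2.+1)`!%:R * M n.

Let fE z : f z = \int[cnt]_n rho n z.
Proof.
pose F (yn : Y * nat) := v yn.1 * ((-1) ^+ yn.2 * (z * l yn.1) ^+ yn.2.*2.+1 / yn.2.*2.+1`!%:R).
have mF : measurable_fun setT F.
  apply: measurable_fun_pair_nat => n; rewrite /F /=.
  apply: measurable_funM => //; apply: measurable_funM; last exact: measurable_cst.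
  apply: measurable_funM; first exact: measurable_cst.
  by apply: measurable_funX; exact: measurable_funM.
have bF y n : `|F (y, n)| <= (`|v y| * `|l y| * expR (alpha * l y ^+ 2)) *
    (`|z| * ((z ^+ 2 / (4 * alpha)) ^+ n / n`!%:R)).
  rewrite /F/= !normrM normrX normrN1 expr1n mul1r normrX normrM normfV normr_nat exprMn.
  have := bdM n y; rewrite normrM normrX => h.
  have -> : `|v y| * (`|z| ^+ n.*2.+1 * `|l y| ^+ n.*2.+1 / (n.*2.+1)`!%:R) =
     (`|v y| * `|l y| ^+ n.*2.+1) * (`|z| ^+ n.*2.+1 / (n.*2.+1)`!%:R) by ring.
  apply: (le_trans (ler_wpM2r _ h)); first by rewrite divr_ge0// exprn_ge0.
  have -> : n`!%:R * alpha^-1 ^+ n * (`|v y| * `|l y| * expR (alpha * l y ^+ 2)) *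
    (`|z| ^+ n.*2.+1 / (n.*2.+1)`!%:R) = (`|v y| * `|l y| * expR (alpha * l y ^+ 2)) *
     (`|z| ^+ n.*2.+1 * alpha^-1 ^+ n * (n`!%:R / (n.*2.+1)`!%:R)) by ring.
  rewrite ler_wpM2l ?mulr_ge0 ?expR_ge0//.
  rewrite exprS -[X in _ ^+ X]mul2n exprM real_normK ?num_real// -!mulrA ler_wpM2l//.
  rewrite (_ : z * (z / (4 * alpha)) = z ^+ 2 * (4^-1 * alpha^-1)); last by rewrite invfM; ring.
  rewrite exprM_CA -!mulrA ler_wpM2l ?(exprn_ge0 n (sqr_ge0 z))//.
  by rewrite ler_wpM2l ?exprn_ge0 ?invr_ge0 ?(ltW alpha0).
have := @Rintegral_Fubini R _ _ Y nat mu (@nat_counting R) F _ _ mF iv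
  (RintegrableZ `|z| (Rintegrable_exp_coeff (z ^+ 2 / (4 * alpha)))) bF.
rewrite /F /= => E; rewrite -[LHS]/(\int[mu]_y (v y * sin (z * l y))).
transitivity (\int[mu]_y \int[cnt]_n (v y * ((-1) ^+ n * (z * l y) ^+ n.*2.+1 / n.*2.+1`!%:R))).
  apply: eq_Rintegral => y _.
  by rewrite RintegralZl ?Rintegral_sin_coeff//; exact: Rintegrable_sin_coeff.
apply: (etrans E); apply: eq_Rintegral => n _; rewrite /rho /M -RintegralZl//; last exact: iM.
by apply: eq_Rintegral => y _; rewrite exprMn; ring.
Qed.

(** The Taylor series bounds [f] by a multiple of |z| exp (sigma z^2), whence the expansion of [L]
    in powers of 1/s for s > sigma; the hypothesis [ab] says that sigma < b. *)
Let sigma := (4 * alpha)^-1.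
Let sigma0 : 0 < sigma. Proof. by rewrite invr_gt0 mulr_gt0. Qed.
Let sigmab : sigma < b.
Proof. by rewrite -[sigma]mulr1 ltr_pdivrMl ?mulr_gt0. Qed.

Let g n := (-1) ^+ n / (n.*2.+1)`!%:R * M n * n`!%:R.

Let g_le n : `|g n| <= I0 * sigma ^+ n.
Proof.
rewrite /g !normrM normrX normrN1 expr1n mul1r normfV !normr_nat.
have -> : (n.*2.+1)`!%:R^-1 * `|M n| * n`!%:R = `|M n| * (n`!%:R / (n.*2.+1)`!%:R) by ring.
apply: (le_trans (ler_wpM2r _ (M_le n))); first by rewrite divr_ge0.
rewrite -mulrA ler_wpM2l//.
apply: (le_trans (ler_wpM2l _ (fact_ratio n))).
  by rewrite mulr_ge0 ?exprn_ge0 ?invr_ge0 ?(ltW alpha0).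
rewrite /sigma invfM exprMn le_eqVlt; apply/orP; left; apply/eqP.
by field; rewrite pnatr_eq0 -lt0n fact_gt0.
Qed.

Let rho_le n z : `|rho n z| <= (I0 * `|z|) * ((z ^+ 2 * sigma) ^+ n / n`!%:R).
Proof.
rewrite /rho !normrM normrX normrN1 expr1n mul1r normrX normfV normr_nat.
apply: (le_trans (ler_wpM2l _ (M_le n))); first by rewrite divr_ge0// exprn_ge0.
rewrite exprS -[X in _ ^+ X]mul2n exprM real_normK ?num_real//.
have -> : `|z| * (z ^+ 2) ^+ n / (n.*2.+1)`!%:R * (I0 * (n`!%:R * alpha^-1 ^+ n)) =
   (I0 * `|z|) * ((z ^+ 2) ^+ n * alpha^-1 ^+ n * (n`!%:R / (n.*2.+1)`!%:R)) by ring.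
rewrite ler_wpM2l ?mulr_ge0//.
rewrite /sigma invfM exprM_CA -!mulrA ler_wpM2l ?(exprn_ge0 n (sqr_ge0 z))//.
by rewrite ler_wpM2l ?exprn_ge0 ?invr_ge0 ?(ltW alpha0).
Qed.

Let rho_le_abs n z : `|rho n `|z| | <= (I0 * `|z|) * ((z ^+ 2 * sigma) ^+ n / n`!%:R).
Proof. by have := rho_le n `|z|; rewrite normr_id real_normK ?num_real. Qed.

Let mf : measurable_fun setT f.
Proof.
have rho_int z : Rintegrable cnt (fun n => rho n z).
  apply: (Rintegrable_le _ _ (RintegrableZ (I0 * `|z|) (Rintegrable_exp_coeff (z ^+ 2 * sigma)))) => //.
apply: (@measurable_fun_cvg _ _ _ setT (fun N z => series (rho ^~ z) N)).
  move=> N; rewrite /series/=; elim: N => [|N IH].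
    by under eq_fun do rewrite big_geq//; exact: measurable_cst.
  under eq_fun do rewrite big_nat_recr//=.
  apply: measurable_funD => //; rewrite /rho.
  apply: measurable_funM => //; apply: measurable_funM => //.
  by apply: measurable_funM => //; exact: measurable_funX.
by move=> z _; rewrite fE; exact: cvg_series_Rintegral.
Qed.

(** Giving up the part b' of the decay rate bounds the coefficients [c k] by a multiple of b'^-k;
    the remaining b - b' ensures integrability, and sigma < b' keeps an overlap. *)
Let b' := (sigma + b) / 2.
Let sigmab' : sigma < b'. Proof. exact: (midf_lt sigmab).1. Qed.
Let b'b : b' < b. Proof. exact: (midf_lt sigmab).2. Qed.
Let b'0 : 0 < b'. Proof. exact: lt_trans sigma0 sigmab'. Qed.

(** As [f] is odd, the absolute value keeps the integral over the whole line from cancelling. *)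
Let L s := \int[leb]_z (f `|z| * expR (- (s * z ^+ 2))).

Let mf_abs : measurable_fun setT (fun z : R => f `|z|).
Proof. by apply: (measurableT_comp mf); exact: continuous_measurable_fun (@norm_continuous _ R^o). Qed.

Let LE s : sigma < s -> L s = \int[cnt]_n (g n * s^-1 ^+ n.+1).
Proof.
move=> ss; have s0 : 0 < s := lt_trans sigma0 ss.
(* An intermediate rate: sigma / t < 1 sums the series, and s - t > 0 makes the integral in [z]
   converge. *)
pose t := (sigma + s) / 2.
have ts : t < s := (midf_lt ss).2; have st : sigma < t := (midf_lt ss).1.
have t0 : 0 < t := lt_trans sigma0 st.
pose F (zn : measurableTypeR R * nat) := rho zn.2 `|zn.1| * expR (- (s * zn.1 ^+ 2)).
have mF : measurable_fun setT F.
  apply: measurable_fun_pair_nat => n; rewrite /F /rho /=.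
  under eq_fun do rewrite -mulrA -mulrA.
  apply: (@measurable_funM _ _ _ setT (fun z : R => (-1) ^+ n * `|z| ^+ n.*2.+1)).
    apply: measurable_funM => //; apply: measurable_funX.
    exact: continuous_measurable_fun (@norm_continuous _ R^o).
  apply: measurable_funM => //; apply: measurable_funM => //.
  exact: continuous_measurable_fun (@continuous_gauss R s).
have bF z n : `|F (z, n)| <= (`|z| * expR (- ((s - t) * z ^+ 2))) * (I0 * (sigma / t) ^+ n).
  rewrite /F /rho /= !normrM normrX normrN1 expr1n mul1r normrX normr_id normfV normr_nat.
  rewrite (ger0_norm (expR_ge0 _)).
  have -> : `|z| ^+ n.*2.+1 / (n.*2.+1)`!%:R * `|M n| * expR (- (s * z ^+ 2)) =
    `|M n| / (n.*2.+1)`!%:R * (`|z| ^+ n.*2.+1 * expR (- (s * z ^+ 2))) by ring.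
  apply: (le_trans (ler_wpM2l _ (abs_pow_gauss_le n z t0 ts))); first by rewrite divr_ge0.
  have -> : `|M n| / (n.*2.+1)`!%:R * (n`!%:R * t^-1 ^+ n * (`|z| * expR (- ((s - t) * z ^+ 2)))) =
    `|z| * expR (- ((s - t) * z ^+ 2)) * (`|g n| * t^-1 ^+ n).
    by rewrite /g !normrM normrX normrN1 expr1n mul1r normfV !normr_nat; ring.
  rewrite ler_wpM2l ?mulr_ge0 ?expR_ge0// exprMn mulrA ler_wpM2r//.
  by rewrite exprn_ge0// invr_ge0 ltW.
have ts0 : 0 < s - t by rewrite subr_gt0.
have iu := Rintegrable_abs_gauss ts0.
have st01 : 0 <= sigma / t < 1.
  by rewrite divr_ge0 ?(ltW sigma0) ?(ltW t0)//= ltr_pdivrMr// mul1r.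
have := @Rintegral_Fubini R _ _ _ nat (@leb1 R) (@nat_counting R) F _ _ mF iu (Rintegrable_geometric I0 st01) bF.
rewrite /F/= => E.
transitivity (\int[@leb1 R]_z \int[cnt]_n (rho n `|z| * expR (- (s * z ^+ 2)))).
  apply: eq_Rintegral => z _; rewrite fE RintegralZr//.
  apply: (Rintegrable_le _ _ (RintegrableZ (I0 * `|z|) (Rintegrable_exp_coeff (z ^+ 2 * sigma)))) => //.
apply: (etrans E); apply: eq_Rintegral => n _.
have Jn := Rintegral_abs_pow_gauss n s0.
transitivity (\int[leb]_x ((-1) ^+ n / (n.*2.+1)`!%:R * M n * (`|x| ^+ n.*2.+1 * expR (- (s * x ^+ 2))))).
  by apply: eq_Rintegral => z _; rewrite /rho; ring.
rewrite RintegralZl//; last exact: Rintegrable_abs_pow_gauss.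
by rewrite Jn /g exprVn; ring.
Qed.

Let c k := (-1) ^+ k / k`!%:R * \int[leb]_z (f `|z| * (z ^+ 2) ^+ k).

Let K0 : 0 <= K.
Proof. by have := le_trans (normr_ge0 _) (fK 0); rewrite expr0n/= mulr0 oppr0 expR0 mulr1. Qed.

Let f_abs z : `|f `|z| | <= K * expR (- (b * z ^+ 2)).
Proof. by have := fK `|z|; rewrite real_normK ?num_real. Qed.

Let bc k z : `|f `|z| * (z ^+ 2) ^+ k| <= (k`!%:R * b'^-1 ^+ k * K) * expR (- ((b - b') * z ^+ 2)).
Proof.
rewrite normrM (ger0_norm (exprn_ge0 _ (sqr_ge0 _))).
apply: (le_trans (ler_pM _ _ (f_abs z) (pow_gauss_le k z b'0))) => //.
  by rewrite exprn_ge0// sqr_ge0.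
rewrite (_ : - (b * z ^+ 2) = - (b' * z ^+ 2) + - ((b - b') * z ^+ 2)); last by ring.
rewrite expRD (expRN (b' * z ^+ 2)) le_eqVlt; apply/orP; left; apply/eqP.
move: (b'^-1 ^+ k) (expR (b' * z ^+ 2)) (expR_gt0 (b' * z ^+ 2)) => B X X0.
by field; rewrite gt_eqF.
Qed.

Let bb'0 : 0 < b - b'. Proof. by rewrite subr_gt0. Qed.

Let C1 := \int[leb]_z expR (- ((b - b') * z ^+ 2)).

Let ic k : Rintegrable leb (fun z => f `|z| * (z ^+ 2) ^+ k).
Proof.
apply: (Rintegrable_le _ _ (RintegrableZ (k`!%:R * b'^-1 ^+ k * K) (Rintegrable_gauss bb'0))).
  by apply: measurable_funM => //; apply: measurable_funX; exact: measurable_funX.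
exact: bc.
Qed.

Let c_le k : `|c k| <= (K * C1) * b'^-1 ^+ k.
Proof.
rewrite /c !normrM normrX normrN1 expr1n mul1r normfV normr_nat.
have h : `|\int[leb]_z (f `|z| * (z ^+ 2) ^+ k)| <= (k`!%:R * b'^-1 ^+ k * K) * C1.
  rewrite /C1 -RintegralZl//; last exact: Rintegrable_gauss.
  apply: normr_Rintegral_le; [exact: ic|exact: (RintegrableZ _ (Rintegrable_gauss bb'0))|exact: bc].
apply: (le_trans (ler_wpM2l _ h)); first by rewrite invr_ge0.
rewrite le_eqVlt; apply/orP; left; apply/eqP; field.
by rewrite pnatr_eq0 -lt0n fact_gt0.
Qed.

Let LE' s : 0 < s -> s < b' -> L s = \int[cnt]_k (c k * s ^+ k).
Proof.
move=> s0 sb'.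
pose F (zn : measurableTypeR R * nat) := f `|zn.1| * ((- (s * zn.1 ^+ 2)) ^+ zn.2 / zn.2`!%:R).
have mF : measurable_fun setT F.
  apply: measurable_fun_pair_nat => n; rewrite /F /=.
  apply: measurable_funM => //; apply: measurable_funM => //; apply: measurable_funX.
  by apply: measurableT_comp => //; apply: measurable_funM => //; exact: measurable_funX.
have bF z n : `|F (z, n)| <= expR (- ((b - b') * z ^+ 2)) * (K * (s / b') ^+ n).
  rewrite /F /= normrM normrM normfV normr_nat normrX normrN normrM (gtr0_norm s0).
  rewrite (ger0_norm (sqr_ge0 _)) (exprMn _ s).
  have h := bc n z; rewrite normrM (ger0_norm (exprn_ge0 _ (sqr_ge0 _))) in h.
  have -> : `|f `|z| | * (s ^+ n * (z ^+ 2) ^+ n / n`!%:R) =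
    (`|f `|z| | * (z ^+ 2) ^+ n) * (s ^+ n / n`!%:R) by ring.
  apply: (le_trans (ler_wpM2r _ h)); first by rewrite divr_ge0// exprn_ge0// ltW.
  rewrite exprMn le_eqVlt; apply/orP; left; apply/eqP; field.
  by rewrite pnatr_eq0 -lt0n fact_gt0.
have sb01 : 0 <= s / b' < 1.
  by rewrite divr_ge0 ?(ltW s0) ?(ltW b'0)//= ltr_pdivrMr// mul1r.
have := @Rintegral_Fubini R _ _ _ nat (@leb1 R) (@nat_counting R) F _ _ mF (Rintegrable_gauss bb'0)
  (Rintegrable_geometric K sb01) bF.
rewrite /F/= => E.
transitivity (\int[@leb1 R]_z \int[cnt]_n (f `|z| * ((- (s * z ^+ 2)) ^+ n / n`!%:R))).
  apply: eq_Rintegral => z _; rewrite RintegralZl ?Rintegral_exp_coeff//.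
  exact: Rintegrable_exp_coeff.
apply: (etrans E); apply: eq_Rintegral => n _.
transitivity (\int[leb]_x ((-1) ^+ n * s ^+ n / n`!%:R * (f `|x| * (x ^+ 2) ^+ n))).
  by apply: eq_Rintegral => z _; rewrite exprNMn; ring.
rewrite RintegralZl//; last exact: ic.
by rewrite /c; ring.
Qed.

(** Each [g n] is a nonzero multiple of the moment [M n], and the moments determine the Taylor
    series of [f]. *)
Lemma hardy_sine z : f z = 0.
Proof.
have g0 n : g n = 0.
  have C10 : 0 <= C1 by apply: Rintegral_ge0 => x _; exact: expR_ge0.
  apply: (@laurent_eq0 _ c g (K * C1 + I0) sigma b').
  - exact: sigma0.
  - exact: sigmab'.
  - move=> k; apply: (le_trans (c_le k)); rewrite ler_wpM2r ?lerDl//.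
    by rewrite exprn_ge0// invr_ge0 ltW.
  - move=> k; apply: (le_trans (g_le k)); rewrite ler_wpM2r ?exprn_ge0 ?(ltW sigma0)//.
    by rewrite lerDr mulr_ge0.
  - by move=> x /andP[x1 x2]; rewrite -LE// -LE'//; exact: lt_trans sigma0 x1.
have M0 n : M n = 0.
  have := g0 n; rewrite /g => /eqP; rewrite !mulf_eq0 invr_eq0 !pnatr_eq0 signr_eq0.
  by rewrite !(gtn_eqF (fact_gt0 _)) !orbF /= => /eqP.
rewrite fE /rho; under eq_Rintegral do rewrite M0 mulr0.
by rewrite /Rintegral integral0.
Qed.

End Hardy.

(** * Fourier inversion in the plane *)

Section Continuity.
Context {R : realType} {X : topologicalType}.
Implicit Types f g : X -> R.

Lemma contD f g : continuous f -> continuous g -> continuous (fun x => f x + g x).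
Proof. by move=> cf cg x; apply: (@continuousD _ R^o); [exact: cf|exact: cg]. Qed.

Lemma contN f : continuous f -> continuous (fun x => - f x).
Proof. by move=> cf x; apply: (@continuousN _ R^o); exact: cf. Qed.

Lemma contM f g : continuous f -> continuous g -> continuous (fun x => f x * g x).
Proof. by move=> cf cg x; apply: continuousM; [exact: cf|exact: cg]. Qed.

Lemma contX f n : continuous f -> continuous (fun x => f x ^+ n).
Proof.
move=> cf; elim: n => [|n IH]; first exact: cst_continuous.
by under eq_fun do rewrite exprS; exact: contM.
Qed.

Lemma cont_comp (h : R -> R) f : continuous h -> continuous f -> continuous (fun x => h (f x)).
Proof. by move=> ch cf x; apply: continuous_comp; [exact: cf|exact: ch]. Qed.

Lemma cont_expR f : continuous f -> continuous (fun x => expR (f x)).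
Proof. exact: cont_comp (@continuous_expR R). Qed.

Lemma cont_cos f : continuous f -> continuous (fun x => cos (f x)).
Proof. exact: cont_comp (@continuous_cos R). Qed.

Lemma cont_sin f : continuous f -> continuous (fun x => sin (f x)).
Proof. exact: cont_comp (@continuous_sin R). Qed.

Lemma cont_comp2 (H : R * R -> R) f g :
  continuous H -> continuous f -> continuous g -> continuous (fun x => H (f x, g x)).
Proof.
move=> cH cf cg x; apply: (@continuous_comp _ _ _ (fun x => (f x, g x)) H); last exact: cH.
exact: (cvg_pair (cf x) (cg x)).
Qed.

Lemma cont_cst (c : R) : continuous ((fun=> c) : X -> R).
Proof. by move=> x; exact: cst_continuous. Qed.

End Continuity.

Lemma cont_fst (R : realType) : continuous (fun x : R * R => x.1).
Proof. by move=> x; exact: cvg_fst. Qed.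

Lemma cont_snd (R : realType) : continuous (fun x : R * R => x.2).
Proof. by move=> x; exact: cvg_snd. Qed.

Lemma cont_id (R : realType) : continuous (fun x : R => x).
Proof. by move=> x; exact: cvg_id. Qed.

Ltac cont_tac :=
  lazymatch goal with
  | |- continuous (fun _ => ?c) => exact (@cont_cst _ _ c)
  | |- continuous (fun t => t.1) => exact (@cont_fst _)
  | |- continuous (fun t => t.2) => exact (@cont_snd _)
  | |- continuous (fun t => t) => exact (@cont_id _)
  | |- continuous (fun t => @?f t + @?g t) => refine (@contD _ _ f g _ _); cont_tac
  | |- continuous (fun t => - @?f t) => refine (@contN _ _ f _); cont_tac
  | |- continuous (fun t => @?f t * @?g t) => refine (@contM _ _ f g _ _); cont_tac
  | |- continuous (fun t => @?f t ^+ ?n) => refine (@contX _ _ f n _); cont_tac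
  | |- continuous (fun t => expR (@?f t)) => refine (@cont_expR _ _ f _); cont_tac
  | |- continuous (fun t => cos (@?f t)) => refine (@cont_cos _ _ f _); cont_tac
  | |- continuous (fun t => sin (@?f t)) => refine (@cont_sin _ _ f _); cont_tac
  | |- _ => try assumption
  end.

(** * Fourier transform of the Gaussian *)

Section GaussianFourier.
Context {R : realType}.
Notation leb := (@lebesgue_measure R).
Notation plane := (measurableTypeR R * measurableTypeR R)%type.

Definition gauss (x : R) : R := expR (- (2^-1 * x ^+ 2)).
Definition gauss2 (x : R * R) : R := gauss x.1 * gauss x.2.
(** The square root of 2 pi, left unevaluated: only its positivity enters. *)
Definition gauss_mass : R := \int[leb]_x gauss x.

Lemma continuous_gauss1 : continuous gauss.
Proof. exact: continuous_gauss. Qed.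

Lemma gauss_gt0 x : 0 < gauss x. Proof. exact: expR_gt0. Qed.

Lemma gauss_le1 x : gauss x <= 1.
Proof. by rewrite -expR0 ler_expR oppr_le0 mulr_ge0 ?sqr_ge0. Qed.

Lemma gauss_le x : gauss x <= 3 * k1 x.
Proof.
have := @expR_gauss_le_k1 _ 2^-1 x; rewrite invrK (_ : 1 + 2 = 3); last by ring.
by apply; rewrite invr_gt0.
Qed.

Lemma abs_gauss_le_k1 : exists2 C, 0 <= C & forall x, `|x| * gauss x <= C * k1 x.
Proof.
have t0 : 0 < 4^-1 :> R by rewrite invr_gt0.
exists ((1 + 4) * (1 + 4)) => // x; rewrite /gauss.
have h := abs_gauss_le x t0; have h2 := expR_gauss_le_k1 x t0; rewrite !invrK in h h2.
rewrite (_ : 2^-1 * x ^+ 2 = 4^-1 * x ^+ 2 + 4^-1 * x ^+ 2); last by field.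
rewrite opprD expRD mulrA -[leRHS]mulrA; apply: ler_pM => //; try exact: expR_ge0.
by rewrite expRN ler_pdivrMr ?expR_gt0.
Qed.

Lemma Rintegrable_gauss1 : Rintegrable leb gauss.
Proof. by apply: Rintegrable_gauss; rewrite invr_gt0. Qed.

Lemma gauss_mass_gt0 : 0 < gauss_mass.
Proof.
have m0 : 0 <= gauss_mass by apply: Rintegral_ge0 => x _; exact/ltW/gauss_gt0.
rewrite lt_neqAle m0 andbT; apply/negP => /eqP E.
have : \int[leb]_x gauss x >= \int[leb]_x (expR (- 2^-1) * \1_`[0, 1] x).
  apply: le_Rintegral => //.
  - apply: RintegrableZ; apply/integrableP; split.
      by apply/measurable_EFinP; exact: measurable_indic.
    under eq_integral do rewrite /= ger0_norm//.
    by rewrite integral_indic//= setIT lebesgue_measure_itv/= lte_fin ltr01 -EFinB ltry.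
  - exact: Rintegrable_gauss1.
  - move=> x _; rewrite indicE; case: (boolP (x \in _)) => h; last by rewrite mulr0 ltW ?gauss_gt0.
    rewrite mulr1 ler_expR lerN2 -[leRHS]mulr1 ler_wpM2l ?invr_ge0//.
    by move: h; rewrite inE/= in_itv/= => /andP[h1 h2]; rewrite expr_le1.
rewrite -[X in _ <= X]/gauss_mass -E leNgt => /negP; apply.
rewrite RintegralZl//; last first.
  apply/integrableP; split; first by apply/measurable_EFinP; exact: measurable_indic.
  under eq_integral do rewrite /= ger0_norm//.
  by rewrite integral_indic//= setIT lebesgue_measure_itv/= lte_fin ltr01 -EFinB ltry.
rewrite mulr_gt0 ?expR_gt0// /Rintegral integral_indic//= setIT.
by rewrite lebesgue_measure_itv/= lte_fin ltr01 -EFinB/= subr0.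
Qed.

(* Both sides solve [G' = - x G]. *)
Lemma gauss_fourier (x c : R) :
  \int[leb]_p (gauss p * cos (p * x + c)) = gauss_mass * (gauss x * cos c).
Proof.
have [C C0 HC] := abs_gauss_le_k1.
have mF (h : R -> R) : continuous h -> measurable_fun setT (fun p => gauss p * h p).
  move=> ch; apply: continuous_measurable_fun; apply: contM => //; exact: continuous_gauss1.
have bF (h : R -> R) p : `|h p| <= 1 -> `|gauss p * h p| <= 3 * k1 p.
  move=> h1; rewrite normrM ger0_norm ?(ltW (gauss_gt0 _))//.
  by rewrite -[leRHS]mulr1 ler_pM ?(ltW (gauss_gt0 _))// gauss_le.
have ik := RintegrableZ 3 (@Rintegrable_k1 R).
have icos y : Rintegrable leb (fun p => gauss p * cos (p * y + c)).
  apply: (Rintegrable_le _ _ ik); last by move=> p; apply: (bF (fun p => cos (p * y + c))); rewrite cos_max.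
  by apply: (mF (fun p => cos (p * y + c))); cont_tac.
pose G y := \int[leb]_p (gauss p * cos (p * y + c)).
have dG y : der G y (- y * G y).
  have D : der G y (\int[leb]_p (- (p * gauss p * sin (p * y + c)))).
    apply: (@der_Rintegral _ _ R leb _ (fun y p => - (p * gauss p * sin (p * y + c)))
      (fun p => C * k1 p) y 1 ltr01).
    - by move=> z _; exact: icos.
    - by move=> z p _; der_auto; rewrite /=; ring.
    - move=> z p _; rewrite normrN !normrM (ger0_norm (ltW (gauss_gt0 _))).
      apply: le_trans (HC p); rewrite -[leRHS]mulr1 ler_pM ?sin_max//.
      by rewrite mulr_ge0 ?(ltW (gauss_gt0 _)).
    - exact: RintegrableZ (@Rintegrable_k1 R).
  apply: (der_eq D).
  have ips : Rintegrable leb (fun p => p * gauss p * sin (p * y + c)).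
    apply: (Rintegrable_le _ _ (RintegrableZ C (@Rintegrable_k1 R))).
      under eq_fun do rewrite (mulrC _ (gauss _)) -mulrA.
      by apply: (mF (fun p => p * sin (p * y + c))); cont_tac.
    move=> p; rewrite !normrM (ger0_norm (ltW (gauss_gt0 _))).
    apply: le_trans (HC p); rewrite -[leRHS]mulr1 ler_pM ?sin_max//.
    by rewrite mulr_ge0 ?(ltW (gauss_gt0 _)).
  (* Integration by parts: the integrand is the derivative in [p] of gauss p sin (p y + c). *)
  have Z : \int[leb]_p (y * (gauss p * cos (p * y + c)) - p * gauss p * sin (p * y + c)) = 0.
    have C3 : 0 <= 3 + (`|y| * 3 + C) by rewrite !addr_ge0 ?mulr_ge0.
    apply: (@Rintegral_der_eq0 R (fun p => gauss p * sin (p * y + c)) _ (3 + (`|y| * 3 + C))).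
    - move=> p; apply: (le_trans (bF (fun p => sin (p * y + c)) p _)); first exact: sin_max.
      by rewrite ler_wpM2r ?(ltW (k1_gt0 _))// lerDl addr_ge0 ?mulr_ge0.
    - move=> p; apply: (@le_trans _ _ ((`|y| * 3 + C) * k1 p)); last first.
        by rewrite ler_wpM2r ?(ltW (k1_gt0 _))// lerDr.
      apply: (le_trans (ler_normB _ _)); rewrite [leRHS]mulrDl; apply: lerD.
        by rewrite normrM -mulrA ler_wpM2l//; apply: (bF (fun p => cos (p * y + c))); rewrite cos_max.
      rewrite !normrM (ger0_norm (ltW (gauss_gt0 _))).
      apply: le_trans (HC p); rewrite -[leRHS]mulr1 ler_pM ?sin_max//.
      by rewrite mulr_ge0 ?(ltW (gauss_gt0 _)).
    - move=> p; rewrite /gauss; der_auto; rewrite /=; by field.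
  rewrite RintegralB// in Z; last exact: (RintegrableZ _ (icos y)).
  rewrite RintegralZl// in Z; last exact: icos.
  under eq_Rintegral do rewrite -mulN1r.
  rewrite RintegralZl//; move: Z => /eqP; rewrite subr_eq0 => /eqP <-.
  by rewrite mulN1r mulNr.
have Hc : G x * expR (2^-1 * x ^+ 2) = G 0 * expR (2^-1 * 0 ^+ 2).
  apply: (@is_derive_0_is_cst _ (fun x => G x * expR (2^-1 * x ^+ 2))) => y.
  have dGy := dG y.
  suff : der (fun x => G x * expR (2^-1 * x ^+ 2)) y 0 by [].
  der_auto; rewrite /=; by field.
have G0 : G 0 = gauss_mass * cos c.
  rewrite /G; under eq_Rintegral do rewrite mulr0 add0r mulrC.
  rewrite RintegralZl//; last exact: Rintegrable_gauss1.
  by rewrite [LHS]mulrC.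
rewrite expr0n/= mulr0 expR0 mulr1 G0 in Hc.
rewrite -[LHS]/(G x) /gauss expRN mulrCA mulrC -Hc mulrK//.
by rewrite unitfE gt_eqF ?expR_gt0.
Qed.

(** In the inner integral the phase of the first variable joins the constant [c] of the
    one-dimensional formula. *)
Lemma gauss2_fourier (x : R * R) (c : R) :
  \int[leb2]_p (gauss2 p * cos (p.1 * x.1 + p.2 * x.2 + c)) =
  gauss_mass ^+ 2 * (gauss2 x * cos c).
Proof.
pose F (p : plane) := gauss2 p * cos (p.1 * x.1 + p.2 * x.2 + c).
have cF : continuous (F : R * R -> R).
  rewrite /F /gauss2 /gauss; cont_tac.
have mF : measurable_fun setT F := continuous_measurable_plane cF.
have bF (p1 p2 : measurableTypeR R) : `|F (p1, p2)| <= gauss p1 * gauss p2.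
  rewrite normrM ger0_norm ?mulr_ge0 ?(ltW (gauss_gt0 _))//.
  by rewrite ler_piMr ?mulr_ge0 ?(ltW (gauss_gt0 _))// cos_max.
have iF : Rintegrable (@leb1 R \x @leb1 R)%E F.
  apply: (Rintegrable_le mF _ (Rintegrable_prod (Rintegrable_gauss1 : Rintegrable (@leb1 R) gauss)
    (Rintegrable_gauss1 : Rintegrable (@leb1 R) gauss))).
  by move=> -[p1 p2]; exact: bF.
have -> : \int[leb2]_p F p = \int[@leb1 R]_p1 \int[@leb1 R]_p2 F (p1, p2).
  transitivity (fine (\int[@leb1 R]_p1 fubini_F (@leb1 R) (EFin \o F) p1)%E).
    by congr fine; exact: (esym (integral12_prod_meas1 iF)).
  congr fine; apply: eq_integral => p1 _; rewrite /fubini_F.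
  rewrite fineK//; apply: integrable_fin_num => //.
  exact: (Rintegrable_section p1 mF (Rintegrable_gauss1 : Rintegrable (@leb1 R) gauss) bF).
transitivity (\int[@leb1 R]_p1 ((gauss_mass * gauss x.2) * (gauss p1 * cos (p1 * x.1 + c)))).
  apply: eq_Rintegral => p1 _.
  transitivity (\int[leb]_p2 (gauss p1 * (gauss p2 * cos (p2 * x.2 + (p1 * x.1 + c))))).
    by apply: eq_Rintegral => p2 _; rewrite /F /gauss2/= -mulrA; congr (_ * (_ * cos _)); ring.
  rewrite RintegralZl ?gauss_fourier//; first by ring.
  apply: (Rintegrable_le _ _ Rintegrable_gauss1).
    apply: continuous_measurable_fun; rewrite /gauss; cont_tac.
  move=> p; rewrite normrM ger0_norm ?(ltW (gauss_gt0 _))//.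
  by rewrite ler_piMr ?(ltW (gauss_gt0 _))// cos_max.
rewrite RintegralZl//.
  rewrite -[X in _ * X]/(\int[leb]_p (gauss p * cos (p * x.1 + c))) gauss_fourier /gauss2; ring.
apply: (Rintegrable_le _ _ (Rintegrable_gauss1 : Rintegrable (@leb1 R) gauss)).
  apply: continuous_measurable_fun; rewrite /gauss; cont_tac.
move=> p; rewrite normrM ger0_norm ?(ltW (gauss_gt0 _))//.
by rewrite ler_piMr ?(ltW (gauss_gt0 _))// cos_max.
Qed.

End GaussianFourier.

(** * Inversion at the origin *)

Section FourierInversion.
Context {R : realType}.
Notation leb := (@lebesgue_measure R).
Notation plane := (measurableTypeR R * measurableTypeR R)%type.

Lemma measurable_phase (h : R -> R) (H : R * R -> R) :
  continuous h -> measurable_fun [set: plane] H ->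
  measurable_fun [set: (plane * plane)%type]
    (fun z => H z.1 * h (z.2.1 * z.1.1 + z.2.2 * z.1.2)).
Proof.
move=> ch mH; apply: measurable_funM; first exact: (measurableT_comp mH measurable_fst).
have mh : measurable_fun [set: measurableTypeR R] h := continuous_measurable_fun ch.
apply: (measurableT_comp mh); apply: measurable_funD; apply: measurable_funM.
- exact: (measurableT_comp (@measurable_fst _ _ (measurableTypeR R) (measurableTypeR R)) measurable_snd).
- exact: (measurableT_comp (@measurable_fst _ _ (measurableTypeR R) (measurableTypeR R)) measurable_fst).
- exact: (measurableT_comp (@measurable_snd _ _ (measurableTypeR R) (measurableTypeR R)) measurable_snd).
- exact: (measurableT_comp (@measurable_snd _ _ (measurableTypeR R) (measurableTypeR R)) measurable_fst).
Qed.

Variables (H1 H2 : R * R -> R) (C1 C2 C3 : R).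
Hypotheses (cH1 : continuous H1) (cH2 : continuous H2).
Hypotheses (bH1 : forall x, `|H1 x| <= C1 * k2 x) (bH2 : forall x, `|H2 x| <= C2 * k2 x).

Let phase (x p : R * R) := p.1 * x.1 + p.2 * x.2.
(** The real part of the Fourier transform of H1 + i H2; its integral over all frequencies isolates
    [H1] at the origin. *)
Let F (p : R * R) := \int[leb2]_x (H1 x * cos (phase x p) + H2 x * sin (phase x p)).

Hypothesis bF : forall p, `|F p| <= C3 * k2 p.

Let bint x p : `|H1 x * cos (phase x p) + H2 x * sin (phase x p)| <= (C1 + C2) * k2 x.
Proof.
rewrite mulrDl; apply: (le_trans (ler_normD _ _)); rewrite !normrM.
by apply: lerD; [apply: le_trans (bH1 x)|apply: le_trans (bH2 x)];
  rewrite ler_piMr ?cos_max ?sin_max.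
Qed.

Let mHH : measurable_fun [set: (plane * plane)%type]
  (fun z => H1 z.1 * cos (phase z.1 z.2) + H2 z.1 * sin (phase z.1 z.2)).
Proof.
apply: measurable_funD; apply: measurable_phase.
- exact: continuous_cos.
- exact: continuous_measurable_plane.
- exact: continuous_sin.
- exact: continuous_measurable_plane.
Qed.

Let iHH p : Rintegrable leb2 (fun x : plane => H1 x * cos (phase x p) + H2 x * sin (phase x p)).
Proof.
apply: (@Rintegrable_le _ plane R leb2 _ (fun x => (C1 + C2) * k2 x)).
- exact: (measurable_fun_pair1 p mHH).
- by move=> x; exact: bint.
- exact: (RintegrableZ _ (@Rintegrable_k2 R)).
Qed.

(** Measurability of this parameter integral is drawn from Fubini's theorem: the factor [k2 p] makes
    the integrand jointly integrable and is divided out afterwards. *)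
Let mF : measurable_fun [set: plane] F.
Proof.
have mk2 : measurable_fun [set: (plane * plane)%type] (fun z => k2 z.1).
  exact: (measurableT_comp (@measurable_k2 R) measurable_fst).
have msw : measurable_fun [set: (plane * plane)%type] (fun z => (z.2, z.1)) by apply: measurable_fun_pair.
have h := @Rintegrable_Fubini R _ _ plane plane leb2 leb2
  (fun z => k2 z.1 * (H1 z.2 * cos (phase z.2 z.1) + H2 z.2 * sin (phase z.2 z.1)))
  k2 (fun x => (C1 + C2) * k2 x)
  (measurable_funM mk2 (measurableT_comp mHH msw)) (@Rintegrable_k2 R)
  (RintegrableZ _ (@Rintegrable_k2 R)).
have {}h : Rintegrable (@leb2 R) (fun p => k2 p * F p).
  have {}h := h (fun p x => _).
  have {h} := h _; move=> h.
  have {h} : Rintegrable (@leb2 R) (fun p => \int[leb2]_x (k2 p * (H1 x * cos (phase x p) + H2 x * sin (phase x p)))).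
    by apply: h => p x /=; rewrite normrM (ger0_norm (ltW (k2_gt0 _))) ler_wpM2l ?(ltW (k2_gt0 _)).
  apply: eq_integrable => // p _ /=; rewrite RintegralZl//.
  exact: iHH.
have := Rintegrable_measurable h => mkF.
have E : F = fun p => (1 + p.1 ^+ 2) * (1 + p.2 ^+ 2) * (k2 p * F p).
  apply/funext => p; rewrite /k2 /k1; field.
  by rewrite !gt_eqF ?one_add_sqr_gt0.
rewrite E; apply: measurable_funM => //; apply: continuous_measurable_plane.
by cont_tac.
Qed.

Lemma Rintegrable_fourier : Rintegrable leb2 (F : plane -> R).
Proof. exact: (Rintegrable_le mF bF (RintegrableZ _ (@Rintegrable_k2 R))). Qed.

Let reg (n : nat) (p : R * R) := gauss2 (n.+1%:R^-1 * p.1, n.+1%:R^-1 * p.2).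

Let reg_gt0 n p : 0 < reg n p. Proof. by rewrite mulr_gt0 ?gauss_gt0. Qed.

Let reg_le1 n p : reg n p <= 1.
Proof. by rewrite mulr_ile1 ?gauss_le1 ?(ltW (gauss_gt0 _)). Qed.

Let continuous_reg n : continuous (reg n).
Proof. by rewrite /reg /gauss2 /gauss /=; cont_tac. Qed.

Let gauss2_le (p : R * R) : gauss2 p <= 9 * k2 p.
Proof.
rewrite /k2 (_ : 9 * _ = (3 * k1 p.1) * (3 * k1 p.2)); last by ring.
by rewrite ler_pM ?gauss_le ?(ltW (gauss_gt0 _)).
Qed.

Let invS_cvg : (n.+1%:R^-1 : R) @[n --> \oo] --> (0 : R).
Proof. exact: cvg_harmonic. Qed.

Let reg_cvg p : reg n p @[n --> \oo] --> (1 : R).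
Proof.
have -> : 1 = gauss2 (0 * p.1, 0 * p.2).
  by rewrite /gauss2 /gauss !mul0r expr0n/= mulr0 oppr0 expR0 mulr1.
pose g (t : R) := gauss2 (t * p.1, t * p.2).
have cg : continuous g by rewrite /g /gauss2 /gauss /=; cont_tac.
exact: (continuous_cvg _ (cg 0) invS_cvg).
Qed.

Let reg_fourier n x c :
  \int[leb2]_p (reg n p * cos (phase x p + c)) =
  n.+1%:R ^+ 2 * (gauss_mass ^+ 2 * (gauss2 (n.+1%:R * x.1, n.+1%:R * x.2) * cos c)).
Proof.
have n0 : 0 < n.+1%:R :> R by [].
have cf : continuous (fun p => reg n p * cos (phase x p + c)).
  by rewrite /phase; apply: contM; [exact: continuous_reg|cont_tac].
have E p : reg n (n.+1%:R * p.1 + 0, n.+1%:R * p.2 + 0) * cos (phase x (n.+1%:R * p.1 + 0, n.+1%:R * p.2 + 0) + c)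
    = gauss2 p * cos (p.1 * (n.+1%:R * x.1) + p.2 * (n.+1%:R * x.2) + c).
  rewrite /reg /phase /= !addr0 !mulKf ?gt_eqF// -surjective_pairing.
  by congr (_ * cos _); ring.
rewrite (@Rintegral_affine2 _ n.+1%:R 0 0)//; last 2 first.
  exact: continuous_measurable_plane.
  have ig : Rintegrable (@leb2 R) (fun p => 9 * k2 p) by exact: (RintegrableZ _ (@Rintegrable_k2 R)).
  under eq_fun do rewrite E.
  apply: (Rintegrable_le _ _ ig).
    by apply: continuous_measurable_plane; rewrite /gauss2 /gauss; cont_tac.
  move=> p; apply: le_trans (gauss2_le p).
  rewrite normrM ger0_norm ?mulr_ge0 ?(ltW (gauss_gt0 _))//.
  by rewrite ler_piMr ?cos_max ?mulr_ge0 ?(ltW (gauss_gt0 _)).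
congr (_ * _); under eq_Rintegral do rewrite E.
exact: (gauss2_fourier (n.+1%:R * x.1, n.+1%:R * x.2) c).
Qed.

Let integrable_reg n (h : R * R -> R) : continuous h -> (forall p, `|h p| <= 1) ->
  Rintegrable leb2 (fun p => reg n p * h p).
Proof.
move=> ch h1.
have n0 : 0 < n.+1%:R :> R by [].
have n1 : 0 < n.+1%:R^-1 :> R by rewrite invr_gt0.
have ig : Rintegrable (@leb2 R) (fun p => (9 * (n.+1%:R ^+ 2 * n.+1%:R ^+ 2)) * k2 p).
  exact: (RintegrableZ _ (@Rintegrable_k2 R)).
apply: (Rintegrable_le _ _ ig).
  by apply: continuous_measurable_plane; apply: contM => //; exact: continuous_reg.
move=> p; rewrite normrM (gtr0_norm (reg_gt0 _ _)).
apply: (@le_trans _ _ (reg n p)); first by rewrite ler_piMr// ltW.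
apply: (le_trans (gauss2_le _)); rewrite -mulrA ler_wpM2l//.
have mE m (x : R) : m != 0 -> (1 + (m^-1 * x) ^+ 2) * m ^+ 2 = m ^+ 2 + x ^+ 2.
  by move=> m0; field.
have K (x : R) : k1 (n.+1%:R^-1 * x) <= n.+1%:R ^+ 2 * k1 x.
  rewrite /k1 ler_pdivlMr ?one_add_sqr_gt0// ler_pdivrMl ?one_add_sqr_gt0//.
  rewrite mE ?gt_eqF// lerD2r.
  by rewrite exprn_ege1// ler1n.
rewrite /k2/= mulrACA; apply: ler_pM; rewrite ?(ltW (k1_gt0 _))//.
Qed.

(* Test [F] against a wide Gaussian, whose Fourier transform is an approximate
   identity. *)
Lemma fourier_inversion : \int[leb2]_p F p = (gauss_mass ^+ 2) ^+ 2 * H1 (0, 0).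
Proof.
have L1 : \int[leb2]_p (reg n p * F p) @[n --> \oo] --> \int[leb2]_p F p.
  apply: (@Rintegral_dominated _ plane R leb2 (fun n p => reg n p * F p) F (fun p => C3 * k2 p)).
  - by move=> n; exact: (measurable_funM (continuous_measurable_plane (@continuous_reg n)) mF).
  - move=> p; rewrite -[X in _ --> X]mul1r; apply: cvgMl; exact: reg_cvg.
  - move=> n p; rewrite normrM (gtr0_norm (reg_gt0 _ _)); apply: le_trans (bF p).
    by rewrite ler_piMl.
  - exact: (RintegrableZ _ (@Rintegrable_k2 R)).
suff E n : \int[leb2]_p (reg n p * F p) =
    gauss_mass ^+ 2 * \int[leb2]_x (H1 (n.+1%:R^-1 * x.1, n.+1%:R^-1 * x.2) * gauss2 x).
  have L2 : \int[leb2]_x (H1 (n.+1%:R^-1 * x.1, n.+1%:R^-1 * x.2) * gauss2 x) @[n --> \oo] -->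
      \int[leb2]_x (H1 (0, 0) * gauss2 x).
    have C10 : 0 <= C1 by have := le_trans (normr_ge0 _) (bH1 (0, 0)); rewrite pmulr_lge0// k2_gt0.
    apply: (@Rintegral_dominated _ plane R leb2
      (fun n x => H1 (n.+1%:R^-1 * x.1, n.+1%:R^-1 * x.2) * gauss2 x) _ (fun x => (C1 * 9) * k2 x)).
    - move=> n; apply: continuous_measurable_plane; apply: contM.
        by apply: (@cont_comp2 R _ H1 (fun x : R * R => n.+1%:R^-1 * x.1) (fun x : R * R => n.+1%:R^-1 * x.2)) => //; cont_tac.
      by rewrite /gauss2 /gauss /=; cont_tac.
    - move=> x; apply: cvgMl.
      pose g (t : R) := H1 (t * x.1, t * x.2).
      have cg : continuous g.
        by apply: (@cont_comp2 R _ H1 (fun t : R => t * x.1) (fun t : R => t * x.2)) => //; cont_tac.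
      have -> : H1 (0, 0) = g 0 by rewrite /g !mul0r.
      exact: (continuous_cvg _ (cg 0) invS_cvg).
    - move=> n x; rewrite normrM (ger0_norm (mulr_ge0 (ltW (gauss_gt0 _)) (ltW (gauss_gt0 _)))).
      rewrite -mulrA; apply: ler_pM => //; first by rewrite mulr_ge0 ?(ltW (gauss_gt0 _)).
        apply: (le_trans (bH1 _)); rewrite ler_piMr// mulr_ile1 ?k1_le1 ?(ltW (k1_gt0 _))//.
      exact: gauss2_le.
    - exact: (RintegrableZ _ (@Rintegrable_k2 R)).
  have mass : \int[leb2]_x (H1 (0, 0) * gauss2 x) = gauss_mass ^+ 2 * H1 (0, 0).
    rewrite RintegralZl//; last first.
      have := @integrable_reg 0 (fun=> 1) (@cont_cst R _ 1); rewrite normr1 => /(_ (fun=> lexx _)).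
      by apply: eq_integrable => // x _ /=; rewrite /reg/= invr1 !mul1r mulr1 -surjective_pairing.
    rewrite mulrC; congr (_ * _).
    have h : \int[leb2]_p (gauss2 p * cos (p.1 * 0 + p.2 * 0 + 0)) =
        gauss_mass ^+ 2 * (gauss2 (0, 0) * cos 0) :> R := gauss2_fourier (0, 0) 0.
    have g00 : gauss2 (0, 0) = 1 :> R by rewrite /gauss2 /gauss/= expr0n/= mulr0 oppr0 expR0 mulr1.
    rewrite g00 cos0 !mulr1 in h; rewrite -h.
    by apply: eq_Rintegral => x _; rewrite !mulr0 !addr0 cos0 mulr1.
  have L3 : \int[leb2]_p (reg n p * F p) @[n --> \oo] --> gauss_mass ^+ 2 * (gauss_mass ^+ 2 * H1 (0, 0)).
    under eq_fun do rewrite E.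
    by apply: cvgMr; rewrite -mass.
  rewrite expr2 -mulrA; exact: (cvg_unique _ L1 L3).
have n0 : 0 < n.+1%:R :> R by [].
pose G (z : plane * plane) := reg n z.2 * (H1 z.1 * cos (phase z.1 z.2) + H2 z.1 * sin (phase z.1 z.2)).
have mG : measurable_fun setT G.
  apply: measurable_funM => //.
  exact: (measurableT_comp (continuous_measurable_plane (@continuous_reg n)) measurable_snd).
have ireg : Rintegrable leb2 (reg n).
  have := @integrable_reg n (fun=> 1) (@cont_cst R _ 1); rewrite normr1 => /(_ (fun=> lexx _)).
  by apply: eq_integrable => // x _ /=; rewrite mulr1.
have bG x p : `|G (x, p)| <= ((C1 + C2) * k2 x) * reg n p.
  by rewrite normrM (gtr0_norm (reg_gt0 _ _)) mulrC ler_wpM2r ?(ltW (reg_gt0 _ _)).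
have FB := @Rintegral_Fubini R _ _ plane plane leb2 leb2 G _ _ mG (RintegrableZ _ (@Rintegrable_k2 R)) ireg bG.
have S1 : \int[leb2]_p (reg n p * F p) = \int[leb2]_p \int[leb2]_x G (x, p).
  apply: eq_Rintegral => p _.
  rewrite -[RHS]/(\int[leb2]_x (reg n p * (H1 x * cos (phase x p) + H2 x * sin (phase x p)))).
  rewrite RintegralZl//.
  exact: iHH.
(* The sine is a cosine of phase - pi / 2, whose Gaussian transform carries the factor cos (- pi /
   2) = 0: [H2] drops out. *)
have S2 x : \int[leb2]_p G (x, p) =
    n.+1%:R ^+ 2 * gauss_mass ^+ 2 * (H1 x * gauss2 (n.+1%:R * x.1, n.+1%:R * x.2)).
  have ic c : Rintegrable leb2 (fun p => reg n p * cos (phase x p + c)).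
    by apply: integrable_reg; [rewrite /phase; cont_tac|move=> p; exact: cos_max].
  transitivity (\int[leb2]_p (H1 x * (reg n p * cos (phase x p + 0)) +
                 H2 x * (reg n p * cos (phase x p + - (pi / 2))))).
    apply: eq_Rintegral => p _; rewrite /G/= addr0 (cosD (phase x p) (- (pi / 2))) cosN sinN cos_pihalf sin_pihalf; ring.
  rewrite RintegralD; [|exact: measurableT|exact: (RintegrableZ (H1 x) (ic 0))|
    exact: (RintegrableZ (H2 x) (ic (- (pi / 2))))].
  rewrite RintegralZl; [|exact: measurableT|exact: (ic 0)].
  rewrite RintegralZl; [|exact: measurableT|exact: (ic (- (pi / 2)))].
  rewrite !reg_fourier cosN cos_pihalf cos0; ring.
rewrite S1 -FB; under eq_Rintegral do rewrite S2.
have n1 : 0 < n.+1%:R^-1 :> R by rewrite invr_gt0.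
pose f x := H1 x * gauss2 (n.+1%:R * x.1, n.+1%:R * x.2).
have cf : continuous f.
  by apply: contM; [exact: cH1|rewrite /gauss2 /gauss /=; cont_tac].
have E x : f (n.+1%:R^-1 * x.1 + 0, n.+1%:R^-1 * x.2 + 0) = H1 (n.+1%:R^-1 * x.1, n.+1%:R^-1 * x.2) * gauss2 x.
  by rewrite /f /= !addr0 !mulVKf ?gt_eqF// -surjective_pairing.
have If : Rintegrable leb2 f.
  apply: (@Rintegrable_le _ plane _ _ _ (fun x => C1 * k2 x)).
  - exact: continuous_measurable_plane.
  - move=> x; apply: le_trans (bH1 x); rewrite normrM; apply: ler_piMr; first exact: normr_ge0.
    by rewrite ger0_norm ?mulr_ile1 ?mulr_ge0 ?gauss_le1 ?(ltW (gauss_gt0 _)).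
  - exact: (RintegrableZ _ (@Rintegrable_k2 R)).
have IE : Rintegrable leb2 (fun x => f (n.+1%:R^-1 * x.1 + 0, n.+1%:R^-1 * x.2 + 0)).
  apply: (@Rintegrable_le _ plane _ _ _ (fun p => (`|C1| * 9) * k2 p)).
  - apply: continuous_measurable_plane.
    by apply: (@cont_comp2 R _ f (fun x : R * R => n.+1%:R^-1 * x.1 + 0) (fun x : R * R => n.+1%:R^-1 * x.2 + 0) cf); cont_tac.
  - move=> x; rewrite E normrM (ger0_norm (mulr_ge0 (ltW (gauss_gt0 _)) (ltW (gauss_gt0 _)))).
    rewrite -mulrA; apply: ler_pM.
    + exact: normr_ge0.
    + exact: (mulr_ge0 (ltW (gauss_gt0 _)) (ltW (gauss_gt0 _))).
    + apply: (le_trans (bH1 _)); apply: (le_trans (ler_norm _)).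
      rewrite normrM (gtr0_norm (k2_gt0 _)); apply: ler_piMr; first exact: normr_ge0.
      by apply: mulr_ile1; rewrite ?k1_le1 ?(ltW (k1_gt0 _)).
    + exact: gauss2_le.
  - exact: (RintegrableZ _ (@Rintegrable_k2 R)).
rewrite RintegralZl; [|exact: measurableT|exact: If].
rewrite (Rintegral_affine2 n1 (continuous_measurable_plane cf) IE).
under eq_Rintegral do rewrite E.
rewrite mulrA; congr (_ * _).
by rewrite exprVn mulrAC mulfV ?mul1r// expf_neq0// gt_eqF.
Qed.

End FourierInversion.

(** * Schwartz functions and Gaussian wave packets *)

Section SchwartzPlane.
Context {R : realType}.
Implicit Types (f g df : R * R -> R) (P : (R * R -> R) -> Prop).

Definition pder1 f df := forall a b, der (fun a => f (a, b)) a (df (a, b)).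
Definition pder2 f df := forall a b, der (fun b => f (a, b)) b (df (a, b)).

Definition Sw_stable P := forall f, P f ->
  [/\ continuous f, exists C, forall x, `|f x| <= C,
      P (fun x => x.1 * f x) /\ P (fun x => x.2 * f x),
      exists2 df, P df & pder1 f df & exists2 df, P df & pder2 f df].

(* The largest class of bounded continuous functions stable under partial
   derivatives and multiplication by the coordinates. *)
Definition Sw f := exists2 P, Sw_stable P & P f.

Lemma pder1_unique f df dg : pder1 f df -> pder1 f dg -> df = dg.
Proof. by move=> h1 h2; apply/funext => -[a b]; exact: der_unique (h1 a b) (h2 a b). Qed.

Lemma pder2_unique f df dg : pder2 f df -> pder2 f dg -> df = dg.
Proof. by move=> h1 h2; apply/funext => -[a b]; exact: der_unique (h1 a b) (h2 a b). Qed.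

Lemma Sw_continuous f : Sw f -> continuous f.
Proof. by move=> [P PS Pf]; have [] := PS _ Pf. Qed.

Lemma Sw_bounded f : Sw f -> exists C, forall x, `|f x| <= C.
Proof. by move=> [P PS Pf]; have [] := PS _ Pf. Qed.

Lemma Sw_x1 f : Sw f -> Sw (fun x => x.1 * f x).
Proof. by move=> [P PS Pf]; have [_ _ [? _] _ _] := PS _ Pf; exists P. Qed.

Lemma Sw_x2 f : Sw f -> Sw (fun x => x.2 * f x).
Proof. by move=> [P PS Pf]; have [_ _ [_ ?] _ _] := PS _ Pf; exists P. Qed.

Lemma Sw_has_pder1 f : Sw f -> exists2 df, Sw df & pder1 f df.
Proof. by move=> [P PS Pf]; have [_ _ _ [d Pd fd] _] := PS _ Pf; exists d => //; exists P. Qed.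

Lemma Sw_has_pder2 f : Sw f -> exists2 df, Sw df & pder2 f df.
Proof. by move=> [P PS Pf]; have [_ _ _ _ [d Pd fd]] := PS _ Pf; exists d => //; exists P. Qed.

(** Membership in a greatest class is shown by exhibiting a stable class, here the linear
    combinations of a member of [P] and a member of [Q]. *)
Lemma Sw_lin c1 c2 f g : Sw f -> Sw g -> Sw (fun x => c1 * f x + c2 * g x).
Proof.
move=> [P PS Pf] [Q QS Qg].
exists (fun h => exists c1 c2 f g, [/\ P f, Q g & h = fun x => c1 * f x + c2 * g x]); last first.
  by exists c1, c2, f, g.
move=> _ [{}c1 [{}c2 [{Pf}f [{Qg}g [Pf Qg ->]]]]].
have [cf [Cf bf] [f1 f2] [df1 Pf1 hf1] [df2 Pf2 hf2]] := PS _ Pf.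
have [cg [Cg bg] [g1 g2] [dg1 Qg1 hg1] [dg2 Qg2 hg2]] := QS _ Qg.
split.
- by apply: contD; apply: contM => //; exact: cont_cst.
- exists (`|c1| * Cf + `|c2| * Cg) => x; apply: (le_trans (ler_normD _ _)).
  by rewrite !normrM; apply: lerD; rewrite ler_wpM2l.
- split; [exists c1, c2, (fun x => x.1 * f x), (fun x => x.1 * g x)|
          exists c1, c2, (fun x => x.2 * f x), (fun x => x.2 * g x)];
  by split => //; apply/funext => x; ring.
- exists (fun x => c1 * df1 x + c2 * dg1 x); first by exists c1, c2, df1, dg1.
  move=> a b; have h1 := hf1 a b; have h2 := hg1 a b.
  by der_auto; rewrite /=; ring.
- exists (fun x => c1 * df2 x + c2 * dg2 x); first by exists c1, c2, df2, dg2.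
  move=> a b; have h1 := hf2 a b; have h2 := hg2 a b.
  by der_auto; rewrite /=; ring.
Qed.

Lemma SwD f g : Sw f -> Sw g -> Sw (fun x => f x + g x).
Proof.
by move=> Sf Sg; have := Sw_lin 1 1 Sf Sg; under eq_fun do rewrite !mul1r.
Qed.

Lemma SwZ c f : Sw f -> Sw (fun x => c * f x).
Proof.
by move=> Sf; have := Sw_lin c 0 Sf Sf; under eq_fun do rewrite mul0r addr0.
Qed.

Lemma SwN f : Sw f -> Sw (fun x => - f x).
Proof. by move=> /(SwZ (-1)); under eq_fun do rewrite mulN1r. Qed.

Lemma Sw_pder1 f df : Sw f -> pder1 f df -> Sw df.
Proof. by move=> /Sw_has_pder1[d Sd fd] /pder1_unique /(_ fd) ->. Qed.

Lemma Sw_pder2 f df : Sw f -> pder2 f df -> Sw df.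
Proof. by move=> /Sw_has_pder2[d Sd fd] /pder2_unique /(_ fd) ->. Qed.

(** Boundedness is applied to (1 + x1^2) (1 + x2^2) f, which is obtained from [f] by multiplying by
    coordinates and adding. *)
Lemma Sw_le_k2 f : Sw f -> exists2 C, 0 <= C & forall x, `|f x| <= C * k2 x.
Proof.
move=> Sf; have S11 := Sw_x1 (Sw_x1 Sf).
have [C HC] := Sw_bounded (SwD (SwD Sf S11) (Sw_x2 (Sw_x2 (SwD Sf S11)))).
exists C; first exact: le_trans (normr_ge0 _) (HC (0, 0)).
move=> x; have := HC x.
rewrite (_ : f x + _ + _ = (1 + x.1 ^+ 2) * (1 + x.2 ^+ 2) * f x); last by ring.
have h1 := one_add_sqr_gt0 x.1; have h2 := one_add_sqr_gt0 x.2.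
rewrite normrM ger0_norm ?mulr_ge0 ?(ltW h1) ?(ltW h2)// => h.
by rewrite /k2 /k1 -invfM ler_pdivlMr ?mulr_gt0// mulrC.
Qed.

Lemma Sw_measurable f : Sw f ->
  measurable_fun [set: (measurableTypeR R * measurableTypeR R)%type] f.
Proof. by move=> /Sw_continuous; exact: continuous_measurable_plane. Qed.

End SchwartzPlane.

Ltac nneg :=
  first [ assumption | exact: sqr_ge0 | exact: normr_ge0 | exact: expR_ge0
  | (apply: ltW; assumption) | by []
  | lazymatch goal with
    | |- is_true (0 <= _ + _) => apply: addr_ge0; nneg
    | |- is_true (0 <= _ * _) => apply: mulr_ge0; nneg
    | |- is_true (0 <= _ ^+ _) => apply: exprn_ge0; nneg
    | |- is_true (0 <= _^-1) => rewrite invr_ge0; nneg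
    end ].

Lemma Rintegral_comb d (T : measurableType d) (R : realType) (mu : {measure set T -> \bar R})
    (f g h : T -> R) (c1 c2 : R) : Rintegrable mu f -> Rintegrable mu g -> Rintegrable mu h ->
  \int[mu]_x (f x + (c1 * g x + c2 * h x)) =
  \int[mu]_x f x + (c1 * \int[mu]_x g x + c2 * \int[mu]_x h x).
Proof.
move=> If Ig Ih; have J1 := RintegrableZ c1 Ig; have J2 := RintegrableZ c2 Ih.
rewrite RintegralD; [|exact: measurableT|exact: If|exact: (RintegrableD J1 J2)].
rewrite RintegralD; [|exact: measurableT|exact: J1|exact: J2].
by rewrite RintegralZl; [rewrite RintegralZl; [by []|exact: measurableT|exact: Ih]|exact: measurableT|exact: Ig].
Qed.

(** * Gaussian wave packets and decay of the pairings *)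

Section Packets.
Context {R : realType}.
Notation plane := (measurableTypeR R * measurableTypeR R)%type.
Implicit Types (r s lr ls : R * R -> R) (x : R * R).

(** A phase space point together with a phase [pdl]; shifting the phase by pi / 2 exchanges real and
    imaginary parts. *)
Record point : Type := Point { pq1 : R; pq2 : R; pp1 : R; pp2 : R; pdl : R }.
Implicit Type z : point.

Variables omega theta a b gam : R.
Hypotheses (a0 : 0 < a) (b0 : 0 < b) (om0 : 0 < omega) (thom : theta ^+ 2 < omega ^+ 2).
(** The stationary Riccati equation of exp (- (a x1^2 + b x2^2) / 2 - i gam x1 x2) for the
    normalized Hamiltonian (p1^2 + p2^2) / 2 + theta x2 p1 + omega^2 (x1^2 + x2^2) / 2. *)
Hypotheses (Ha : a ^+ 2 = omega ^+ 2 + gam ^+ 2)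
  (Hb : b ^+ 2 = omega ^+ 2 + gam ^+ 2 - 2 * theta * gam)
  (Hg : gam * (a + b) = theta * a).

Definition envelope z x : R :=
  expR (- (a / 2 * (x.1 - pq1 z) ^+ 2 + b / 2 * (x.2 - pq2 z) ^+ 2)).
(** The term - p.q / 2 is the symmetric (Weyl) normalization of the displacement: as the Hamiltonian
    is quadratic, it accounts for the classical action, and [pdl] evolves at a constant rate. *)
Definition psi z x : R :=
  - gam * (x.1 - pq1 z) * (x.2 - pq2 z) + pp1 z * x.1 + pp2 z * x.2
  - (pp1 z * pq1 z + pp2 z * pq2 z) / 2 + pdl z.
Definition ecos z x : R := envelope z x * cos (psi z x).
Definition esin z x : R := envelope z x * sin (psi z x).

(* [packet r s z] is the real part of [(r + i s)] times the conjugate of a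
   Gaussian wave packet centred at the phase space point [z]. *)
Definition packet r s z x : R := ecos z x * r x + esin z x * s x.
Definition pairing r s z : R := \int[leb2]_x packet r s z x.

Lemma envelope_gt0 z x : 0 < envelope z x. Proof. exact: expR_gt0. Qed.

Lemma envelope_le1 z x : envelope z x <= 1.
Proof.
rewrite -expR0 ler_expR oppr_le0 addr_ge0// mulr_ge0 ?sqr_ge0 ?divr_ge0 ?(ltW a0) ?(ltW b0)//.
Qed.

Lemma norm_ecos z x : `|ecos z x| <= envelope z x.
Proof.
by rewrite normrM (gtr0_norm (envelope_gt0 _ _)) ler_piMr ?cos_max ?(ltW (envelope_gt0 _ _)).
Qed.

Lemma norm_esin z x : `|esin z x| <= envelope z x.
Proof.
by rewrite normrM (gtr0_norm (envelope_gt0 _ _)) ler_piMr ?sin_max ?(ltW (envelope_gt0 _ _)).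
Qed.

Lemma norm_packet r s z x : `|packet r s z x| <= envelope z x * (`|r x| + `|s x|).
Proof.
rewrite mulrDr; apply: (le_trans (ler_normD _ _)); rewrite (normrM (ecos z x)) (normrM (esin z x)).
by apply: lerD; rewrite ler_wpM2r ?norm_ecos ?norm_esin.
Qed.

Lemma norm_packet_le r s z x : `|packet r s z x| <= `|r x| + `|s x|.
Proof. by apply: (le_trans (norm_packet _ _ _ _)); rewrite ler_piMl ?envelope_le1 ?addr_ge0. Qed.

Lemma continuous_ecos z : continuous (ecos z).
Proof. by rewrite /ecos /envelope /psi /=; cont_tac. Qed.

Lemma continuous_esin z : continuous (esin z).
Proof. by rewrite /esin /envelope /psi /=; cont_tac. Qed.

Definition decos1 z x := - (a * (x.1 - pq1 z)) * ecos z x - (pp1 z - gam * (x.2 - pq2 z)) * esin z x.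
Definition desin1 z x := - (a * (x.1 - pq1 z)) * esin z x + (pp1 z - gam * (x.2 - pq2 z)) * ecos z x.
Definition decos2 z x := - (b * (x.2 - pq2 z)) * ecos z x - (pp2 z - gam * (x.1 - pq1 z)) * esin z x.
Definition desin2 z x := - (b * (x.2 - pq2 z)) * esin z x + (pp2 z - gam * (x.1 - pq1 z)) * ecos z x.

Lemma pder1_ecos z : pder1 (ecos z) (decos1 z).
Proof.
by move=> u v; rewrite /decos1 /ecos /esin /envelope /psi /=; der_auto; rewrite /=; field.
Qed.

Lemma pder1_esin z : pder1 (esin z) (desin1 z).
Proof.
by move=> u v; rewrite /desin1 /ecos /esin /envelope /psi /=; der_auto; rewrite /=; field.
Qed.

Lemma pder2_ecos z : pder2 (ecos z) (decos2 z).
Proof.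
by move=> u v; rewrite /decos2 /ecos /esin /envelope /psi /=; der_auto; rewrite /=; field.
Qed.

Lemma pder2_esin z : pder2 (esin z) (desin2 z).
Proof.
by move=> u v; rewrite /desin2 /ecos /esin /envelope /psi /=; der_auto; rewrite /=; field.
Qed.

(** Packets with coefficients in [Sw] form a stable class: differentiating the Gaussian factor only
    multiplies the coefficients by affine functions and mixes them. *)
Lemma Sw_packet r s z : Sw r -> Sw s -> Sw (packet r s z).
Proof.
move=> Sr Ss; exists (fun f => exists r s, [/\ Sw r, Sw s & f = packet r s z]); last by exists r, s.
move=> _ [{Sr}r [{Ss}s [Sr Ss ->]]].
have [r1 Sr1 hr1] := Sw_has_pder1 Sr; have [s1 Ss1 hs1] := Sw_has_pder1 Ss.
have [r2 Sr2 hr2] := Sw_has_pder2 Sr; have [s2 Ss2 hs2] := Sw_has_pder2 Ss.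
split.
- apply: contD; apply: contM.
  + exact: continuous_ecos.
  + exact: Sw_continuous.
  + exact: continuous_esin.
  + exact: Sw_continuous.
- have [Cr br] := Sw_bounded Sr; have [Cs bs] := Sw_bounded Ss.
  by exists (Cr + Cs) => x; apply: (le_trans (norm_packet_le _ _ _ _)); exact: lerD.
- split; [exists (fun x => x.1 * r x), (fun x => x.1 * s x)|exists (fun x => x.2 * r x), (fun x => x.2 * s x)].
    by split; [exact: Sw_x1|exact: Sw_x1|apply/funext => x; rewrite /packet; ring].
  by split; [exact: Sw_x2|exact: Sw_x2|apply/funext => x; rewrite /packet; ring].
- exists (packet
    (fun x => r1 x + ((- a) * (x.1 * r x) + (a * pq1 z) * r x) + ((pp1 z + gam * pq2 z) * s x + (- gam) * (x.2 * s x)))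
    (fun x => s1 x + ((- a) * (x.1 * s x) + (a * pq1 z) * s x) + ((- (pp1 z + gam * pq2 z)) * r x + gam * (x.2 * r x))) z).
    eexists; eexists; split; last reflexivity.
      by apply: SwD; first apply: SwD => //; apply: Sw_lin => //; [exact: Sw_x1|exact: Sw_x2].
    by apply: SwD; first apply: SwD => //; apply: Sw_lin => //; [exact: Sw_x1|exact: Sw_x2].
  move=> u v; have h1 := hr1 u v; have h2 := hs1 u v.
  have h3 := pder1_ecos z u v; have h4 := pder1_esin z u v.
  rewrite /packet; der_auto; rewrite /= /decos1 /desin1 /=; ring.
- exists (packet
    (fun x => r2 x + ((- b) * (x.2 * r x) + (b * pq2 z) * r x) + ((pp2 z + gam * pq1 z) * s x + (- gam) * (x.1 * s x)))
    (fun x => s2 x + ((- b) * (x.2 * s x) + (b * pq2 z) * s x) + ((- (pp2 z + gam * pq1 z)) * r x + gam * (x.1 * r x))) z).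
    eexists; eexists; split; last reflexivity.
      by apply: SwD; first apply: SwD => //; apply: Sw_lin => //; [exact: Sw_x2|exact: Sw_x1].
    by apply: SwD; first apply: SwD => //; apply: Sw_lin => //; [exact: Sw_x2|exact: Sw_x1].
  move=> u v; have h1 := hr2 u v; have h2 := hs2 u v.
  have h3 := pder2_ecos z u v; have h4 := pder2_esin z u v.
  rewrite /packet; der_auto; rewrite /= /decos2 /desin2 /=; ring.
Qed.

Lemma Rintegrable_Sw (f : R * R -> R) : Sw f -> Rintegrable leb2 (f : plane -> R).
Proof.
move=> Sf; have [C C0 HC] := Sw_le_k2 Sf.
apply: (@Rintegrable_le _ plane _ _ _ (fun x => C * k2 x)) HC _; first exact: Sw_measurable.
exact: (RintegrableZ _ (@Rintegrable_k2 R)).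
Qed.

Lemma Rintegral_pder1 (f df : R * R -> R) : Sw f -> pder1 f df -> \int[leb2]_x df x = 0.
Proof.
move=> Sf hf; have Sdf := Sw_pder1 Sf hf.
have [C C0 HC] := Sw_le_k2 Sf; have [D D0 HD] := Sw_le_k2 Sdf.
apply: (@Rintegral_partial1_eq0 _ f df (C + D)) => //; first exact: Sw_measurable.
- by move=> x; apply: (le_trans (HC x)); rewrite ler_wpM2r ?lerDl ?(ltW (k2_gt0 _)).
- by move=> x; apply: (le_trans (HD x)); rewrite ler_wpM2r ?lerDr ?(ltW (k2_gt0 _)).
Qed.

Lemma Rintegral_pder2 (f df : R * R -> R) : Sw f -> pder2 f df -> \int[leb2]_x df x = 0.
Proof.
move=> Sf hf; have Sdf := Sw_pder2 Sf hf.
have [C C0 HC] := Sw_le_k2 Sf; have [D D0 HD] := Sw_le_k2 Sdf.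
apply: (@Rintegral_partial2_eq0 _ f df (C + D)) => //; try exact: Sw_measurable.
- by move=> x; apply: (le_trans (HC x)); rewrite ler_wpM2r ?lerDl ?(ltW (k2_gt0 _)).
- by move=> x; apply: (le_trans (HD x)); rewrite ler_wpM2r ?lerDr ?(ltW (k2_gt0 _)).
Qed.

Lemma pairingZ r s c z : Sw r -> Sw s ->
  pairing (fun x => c * r x) (fun x => c * s x) z = c * pairing r s z.
Proof.
move=> Sr Ss; rewrite /pairing -RintegralZl; [|exact: measurableT|exact: (Rintegrable_Sw (Sw_packet z Sr Ss))].
by apply: eq_Rintegral => x _; rewrite /packet; ring.
Qed.

Lemma norm_pairing_le r s : Sw r -> Sw s -> exists C, forall z, `|pairing r s z| <= C.
Proof.
move=> Sr Ss; have [C C0 HC] := Sw_le_k2 Sr; have [D D0 HD] := Sw_le_k2 Ss.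
exists (\int[leb2]_x ((C + D) * k2 x)) => z.
apply: normr_Rintegral_le; first exact: (Rintegrable_Sw (Sw_packet z Sr Ss)).
- exact: (RintegrableZ _ (@Rintegrable_k2 R)).
- move=> x; apply: (le_trans (norm_packet_le _ _ _ _)); rewrite mulrDl; exact: lerD.
Qed.

(** Integration by parts against the packet, which solves a first-order equation: a first-order
    operator on r + i s becomes multiplication of the complex pairing by a linear function of [z].
    The imaginary part of that pairing is the pairing of [s] and [- r]. *)
Lemma pairing_lower1 r s r1 s1 z : Sw r -> Sw s -> pder1 r r1 -> pder1 s s1 ->
  pairing (fun x => r1 x + (- a) * (x.1 * r x) + (- gam) * (x.2 * s x))
          (fun x => s1 x + (- a) * (x.1 * s x) + gam * (x.2 * r x)) z =
  - (a * pq1 z * pairing r s z + (pp1 z + gam * pq2 z) * pairing s (fun x => - r x) z).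
Proof.
move=> Sr Ss hr hs; have Sr1 := Sw_pder1 Sr hr; have Ss1 := Sw_pder1 Ss hs.
have Z : \int[leb2]_x (decos1 z x * r x + ecos z x * r1 x + (desin1 z x * s x + esin z x * s1 x)) = 0.
  apply: (Rintegral_pder1 (Sw_packet z Sr Ss)) => u v.
  have h1 := hr u v; have h2 := hs u v.
  have h3 := pder1_ecos z u v; have h4 := pder1_esin z u v.
  by rewrite /packet; der_auto; rewrite /=; ring.
have I1 := Rintegrable_Sw (Sw_packet z Sr Ss).
have I2 := Rintegrable_Sw (Sw_packet z Ss (SwN Sr)).
set v1 := (fun x => r1 x + _ + _); set v2 := (fun x => s1 x + _ + _).
have S1 : Sw v1 by apply: SwD; [apply: SwD => //|]; apply: SwZ; [exact: Sw_x1|exact: Sw_x2].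
have S2 : Sw v2 by apply: SwD; [apply: SwD => //|]; apply: SwZ; [exact: Sw_x1|exact: Sw_x2].
have I3 := Rintegrable_Sw (Sw_packet z S1 S2).
rewrite (_ : \int[leb2]_x _ = \int[leb2]_x (packet v1 v2 z x + ((a * pq1 z) * packet r s z x +
    (pp1 z + gam * pq2 z) * packet s (fun x => - r x) z x))) in Z; last first.
  by apply: eq_Rintegral => x _; rewrite /packet /v1 /v2 /decos1 /desin1; ring.
rewrite (Rintegral_comb _ _ I3 I1 I2) in Z.
by move/eqP: Z; rewrite addr_eq0 => /eqP.
Qed.

Lemma pairing_lower2 r s r2 s2 z : Sw r -> Sw s -> pder2 r r2 -> pder2 s s2 ->
  pairing (fun x => r2 x + (- b) * (x.2 * r x) + (- gam) * (x.1 * s x))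
          (fun x => s2 x + (- b) * (x.2 * s x) + gam * (x.1 * r x)) z =
  - (b * pq2 z * pairing r s z + (pp2 z + gam * pq1 z) * pairing s (fun x => - r x) z).
Proof.
move=> Sr Ss hr hs; have Sr1 := Sw_pder2 Sr hr; have Ss1 := Sw_pder2 Ss hs.
have Z : \int[leb2]_x (decos2 z x * r x + ecos z x * r2 x + (desin2 z x * s x + esin z x * s2 x)) = 0.
  apply: (Rintegral_pder2 (Sw_packet z Sr Ss)) => u v.
  have h1 := hr u v; have h2 := hs u v.
  have h3 := pder2_ecos z u v; have h4 := pder2_esin z u v.
  by rewrite /packet; der_auto; rewrite /=; ring.
have I1 := Rintegrable_Sw (Sw_packet z Sr Ss).
have I2 := Rintegrable_Sw (Sw_packet z Ss (SwN Sr)).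
set v1 := (fun x => r2 x + _ + _); set v2 := (fun x => s2 x + _ + _).
have S1 : Sw v1 by apply: SwD; [apply: SwD => //|]; apply: SwZ; [exact: Sw_x2|exact: Sw_x1].
have S2 : Sw v2 by apply: SwD; [apply: SwD => //|]; apply: SwZ; [exact: Sw_x2|exact: Sw_x1].
have I3 := Rintegrable_Sw (Sw_packet z S1 S2).
rewrite (_ : \int[leb2]_x _ = \int[leb2]_x (packet v1 v2 z x + ((b * pq2 z) * packet r s z x +
    (pp2 z + gam * pq1 z) * packet s (fun x => - r x) z x))) in Z; last first.
  by apply: eq_Rintegral => x _; rewrite /packet /v1 /v2 /decos2 /desin2; ring.
rewrite (Rintegral_comb _ _ I3 I1 I2) in Z.
by move/eqP: Z; rewrite addr_eq0 => /eqP.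
Qed.

(** The squared modulus of the complex pairing: a complex multiplier acts on it through its own
    squared modulus, [weight1] or [weight2]. *)
Definition pairing2 r s z := pairing r s z ^+ 2 + pairing s (fun x => - r x) z ^+ 2.

Definition weight1 z := (a * pq1 z) ^+ 2 + (pp1 z + gam * pq2 z) ^+ 2.
Definition weight2 z := (b * pq2 z) ^+ 2 + (pp2 z + gam * pq1 z) ^+ 2.

Lemma pairing_opp r s z : Sw r -> Sw s -> pairing (fun x => - r x) (fun x => - s x) z = - pairing r s z.
Proof.
move=> Sr Ss; rewrite -mulN1r -pairingZ//; congr pairing; apply/funext => x; ring.
Qed.

Lemma pairing2_lower1 r s : Sw r -> Sw s ->
  exists r' s', [/\ Sw r', Sw s' & forall z, pairing2 r' s' z = weight1 z * pairing2 r s z].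
Proof.
move=> Sr Ss; have [r1 Sr1 hr] := Sw_has_pder1 Sr; have [s1 Ss1 hs] := Sw_has_pder1 Ss.
exists (fun x => r1 x + (- a) * (x.1 * r x) + (- gam) * (x.2 * s x)).
exists (fun x => s1 x + (- a) * (x.1 * s x) + gam * (x.2 * r x)); split; last first.
- move=> z; rewrite /pairing2 (pairing_lower1 z Sr Ss hr hs).
  have hr' : pder1 (fun x => - r x) (fun x => - r1 x) by move=> u v; have h := hr u v; der_auto.
  have := pairing_lower1 z Ss (SwN Sr) hs hr'.
  rewrite (_ : (fun x => s1 x + _ + _) = (fun x => s1 x + - a * (x.1 * s x) + gam * (x.2 * r x))); last first.
    by apply/funext => x; ring.
  rewrite (_ : (fun x => - r1 x + _ + _) = (fun x => - (r1 x + - a * (x.1 * r x) + - gam * (x.2 * s x)))); last first.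
    by apply/funext => x; ring.
  move=> ->; rewrite pairing_opp// /weight1; ring.
- by apply: SwD; [apply: SwD => //|]; apply: SwZ; [exact: Sw_x1|exact: Sw_x2].
- by apply: SwD; [apply: SwD => //|]; apply: SwZ; [exact: Sw_x1|exact: Sw_x2].
Qed.

Lemma pairing2_lower2 r s : Sw r -> Sw s ->
  exists r' s', [/\ Sw r', Sw s' & forall z, pairing2 r' s' z = weight2 z * pairing2 r s z].
Proof.
move=> Sr Ss; have [r1 Sr1 hr] := Sw_has_pder2 Sr; have [s1 Ss1 hs] := Sw_has_pder2 Ss.
exists (fun x => r1 x + (- b) * (x.2 * r x) + (- gam) * (x.1 * s x)).
exists (fun x => s1 x + (- b) * (x.2 * s x) + gam * (x.1 * r x)); split; last first.
- move=> z; rewrite /pairing2 (pairing_lower2 z Sr Ss hr hs).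
  have hr' : pder2 (fun x => - r x) (fun x => - r1 x) by move=> u v; have h := hr u v; der_auto.
  have := pairing_lower2 z Ss (SwN Sr) hs hr'.
  rewrite (_ : (fun x => s1 x + _ + _) = (fun x => s1 x + - b * (x.2 * s x) + gam * (x.1 * r x))); last first.
    by apply/funext => x; ring.
  rewrite (_ : (fun x => - r1 x + _ + _) = (fun x => - (r1 x + - b * (x.2 * r x) + - gam * (x.1 * s x)))); last first.
    by apply/funext => x; ring.
  move=> ->; rewrite pairing_opp// /weight2; ring.
- by apply: SwD; [apply: SwD => //|]; apply: SwZ; [exact: Sw_x2|exact: Sw_x1].
- by apply: SwD; [apply: SwD => //|]; apply: SwZ; [exact: Sw_x2|exact: Sw_x1].
Qed.

Lemma weight1_ge0 z : 0 <= weight1 z. Proof. by rewrite addr_ge0 ?sqr_ge0. Qed.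
Lemma weight2_ge0 z : 0 <= weight2 z. Proof. by rewrite addr_ge0 ?sqr_ge0. Qed.

Lemma pairing2_decay n r s : Sw r -> Sw s ->
  exists M, forall z, (1 + (weight1 z + weight2 z)) ^+ n * pairing2 r s z <= M.
Proof.
elim: n r s => [|n IH] r s Sr Ss.
  have [C HC] := norm_pairing_le Sr Ss; have [D HD] := norm_pairing_le Ss (SwN Sr).
  exists (C ^+ 2 + D ^+ 2) => z; rewrite expr0 mul1r.
  by apply: lerD; rewrite -[leLHS]real_normK ?num_real// lerXn2r// nnegrE (le_trans _ (HC z), le_trans _ (HD z)).
have [r1 [s1 [Sr1 Ss1 E1]]] := pairing2_lower1 Sr Ss.
have [r2 [s2 [Sr2 Ss2 E2]]] := pairing2_lower2 Sr Ss.
have [M0 H0] := IH _ _ Sr Ss; have [M1 H1] := IH _ _ Sr1 Ss1; have [M2 H2] := IH _ _ Sr2 Ss2.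
exists (M0 + (M1 + M2)) => z.
rewrite (_ : _ ^+ n.+1 * _ = (1 + (weight1 z + weight2 z)) ^+ n * pairing2 r s z +
  ((1 + (weight1 z + weight2 z)) ^+ n * pairing2 r1 s1 z + (1 + (weight1 z + weight2 z)) ^+ n * pairing2 r2 s2 z)).
  by apply: lerD => //; exact: lerD.
by rewrite E1 E2 exprS; ring.
Qed.

(** The classical Hamiltonian. It is constant along trajectories, so decay is restated in terms of
    it by [energy_le_weight]. *)
Definition energy z : R :=
  (pp1 z ^+ 2 + pp2 z ^+ 2) / 2 + theta * pq2 z * pp1 z + omega ^+ 2 / 2 * (pq1 z ^+ 2 + pq2 z ^+ 2).

Let kap := omega ^+ 2 - theta ^+ 2.
Let kap0 : 0 < kap. Proof. by rewrite subr_gt0. Qed.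
Let om20 : 0 < omega ^+ 2. Proof. by rewrite exprn_gt0. Qed.

Lemma energy_ge_q z : kap / 2 * (pq1 z ^+ 2 + pq2 z ^+ 2) + pp2 z ^+ 2 / 2 <= energy z.
Proof.
rewrite -subr_ge0 (_ : _ - _ = theta ^+ 2 / 2 * pq1 z ^+ 2 + (pp1 z + theta * pq2 z) ^+ 2 / 2).
  by nneg.
by rewrite /energy /kap; field.
Qed.

Lemma energy_ge_p z : kap / (2 * omega ^+ 2) * pp1 z ^+ 2 + pp2 z ^+ 2 / 2 <= energy z.
Proof.
rewrite -subr_ge0 (_ : _ - _ = omega ^+ 2 / 2 * pq1 z ^+ 2 + (omega * pq2 z + theta * pp1 z / omega) ^+ 2 / 2).
  by nneg.
by rewrite /energy /kap; field; rewrite gt_eqF.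
Qed.

Lemma energy_ge0 z : 0 <= energy z.
Proof.
apply: le_trans (energy_ge_q z).
by nneg.
Qed.

(** The two weights together form a positive definite quadratic form on phase space, hence dominate
    the energy. *)
Lemma energy_le_weight : exists2 c, 0 < c & forall z, 1 + energy z <= c * (1 + (weight1 z + weight2 z)).
Proof.
have ia : 0 < (a ^+ 2)^-1 by rewrite invr_gt0 exprn_gt0.
have ib : 0 < (b ^+ 2)^-1 by rewrite invr_gt0 exprn_gt0.
pose d := omega ^+ 2 + 2 * gam ^+ 2.
have d0 : 0 < d by rewrite ltr_pwDl// mulr_ge0// sqr_ge0.
exists (2 + d * ((a ^+ 2)^-1 + (b ^+ 2)^-1)).
  by rewrite ltr_pwDl//; nneg.
move=> z.
have h1 : energy z <= 2 * ((pp1 z + gam * pq2 z) ^+ 2 + (pp2 z + gam * pq1 z) ^+ 2) + d * (pq1 z ^+ 2 + pq2 z ^+ 2).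
  rewrite -subr_ge0 (_ : _ - _ = (pp1 z - theta * pq2 z) ^+ 2 / 2 + kap / 2 * pq2 z ^+ 2 + omega ^+ 2 / 2 * pq1 z ^+ 2
     + (pp1 z + 2 * gam * pq2 z) ^+ 2 + (pp2 z + 2 * gam * pq1 z) ^+ 2 + pp2 z ^+ 2 / 2).
    by nneg.
  by rewrite /energy /kap /d; field.
have h2 : pq1 z ^+ 2 = (a ^+ 2)^-1 * (a * pq1 z) ^+ 2 by field; rewrite gt_eqF.
have h3 : pq2 z ^+ 2 = (b ^+ 2)^-1 * (b * pq2 z) ^+ 2 by field; rewrite gt_eqF.
rewrite h2 h3 in h1; rewrite /weight1 /weight2.
move: h1; move: (a * pq1 z) (b * pq2 z) (pp1 z + _) (pp2 z + _) (a ^+ 2)^-1 (b ^+ 2)^-1 ia ib => X1 X2 Y1 Y2 ia ib ia0 ib0 h1.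
have := sqr_ge0 X1; have := sqr_ge0 X2; have := sqr_ge0 Y1; have := sqr_ge0 Y2.
move: (X1 ^+ 2) (X2 ^+ 2) (Y1 ^+ 2) (Y2 ^+ 2) h1 => x1 x2 y1 y2 h1 g4 g3 g2 g1.
have e1 : 0 <= d * ia by rewrite mulr_ge0 ?ltW.
have e2 : 0 <= d * ib by rewrite mulr_ge0 ?ltW.
have e3 : 0 <= d * ia * (x2 + (y1 + y2)) by rewrite mulr_ge0 ?addr_ge0.
have e4 : 0 <= d * ib * (x1 + (y1 + y2)) by rewrite mulr_ge0 ?addr_ge0.
nra.
Qed.

Lemma pairing_decay r s : Sw r -> Sw s ->
  exists M, forall z, (1 + energy z) ^+ 2 * `|pairing r s z| <= M.
Proof.
(* The exponent 4, because [pairing2] is a square: it leaves the second power on the pairing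
   itself. *)
move=> Sr Ss; have [M HM] := pairing2_decay 4 Sr Ss; have [c c0 Hc] := energy_le_weight.
exists (c ^+ 2 * (1 + M)) => z.
have W0 : 0 <= 1 + (weight1 z + weight2 z) by apply: addr_ge0 => //; apply: addr_ge0; [exact: weight1_ge0|exact: weight2_ge0].
have e0 : 0 <= 1 + energy z by rewrite addr_ge0 ?energy_ge0.
set t := (1 + (weight1 z + weight2 z)) ^+ 2 * `|pairing r s z|.
have t0 : 0 <= t by rewrite mulr_ge0 ?exprn_ge0.
have tM : t ^+ 2 <= M.
  apply: le_trans (HM z); rewrite exprMn -exprM real_normK ?num_real// ler_wpM2l ?exprn_ge0//.
  by rewrite lerDl sqr_ge0.
apply: (@le_trans _ _ (c ^+ 2 * t)); last first.
  by rewrite ler_wpM2l ?exprn_ge0 ?(ltW c0)//; nra.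
rewrite /t mulrA ler_wpM2r// -exprMn lerXn2r// nnegrE// mulr_ge0// ltW//.
Qed.

End Packets.

(** * Classical trajectories and packets moving along them *)

Section Trajectories.
Context {R : realType}.
Notation plane := (measurableTypeR R * measurableTypeR R)%type.
Notation point := (@point R).
Implicit Types (r s lr ls : R * R -> R) (x : R * R) (z : point) (c : R -> point).

Variables omega theta a b gam : R.
Hypotheses (a0 : 0 < a) (b0 : 0 < b) (om0 : 0 < omega) (thom : theta ^+ 2 < omega ^+ 2).
Hypotheses (Ha : a ^+ 2 = omega ^+ 2 + gam ^+ 2)
  (Hb : b ^+ 2 = omega ^+ 2 + gam ^+ 2 - 2 * theta * gam)
  (Hg : gam * (a + b) = theta * a).

Notation envelope := (envelope a b).
Notation ecos := (ecos a b gam).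
Notation esin := (esin a b gam).
Notation packet := (packet a b gam).
Notation pairing := (pairing a b gam).
Notation energy := (energy omega theta).

(** Hamilton's equations for [energy]. *)
Definition vq1 z := pp1 z + theta * pq2 z.
Definition vq2 z := pp2 z.
Definition vp1 z := - (omega ^+ 2 * pq1 z).
Definition vp2 z := - (theta * pp1 z) - omega ^+ 2 * pq2 z.

Definition traj c := forall t,
  [/\ der (fun t => pq1 (c t)) t (vq1 (c t)), der (fun t => pq2 (c t)) t (vq2 (c t)),
      der (fun t => pp1 (c t)) t (vp1 (c t)), der (fun t => pp2 (c t)) t (vp2 (c t)) &
      der (fun t => pdl (c t)) t (- ((a + b) / 2))].

Lemma traj_shift c e : traj c -> traj (fun t => c (t + e)).
Proof.
have D t : der (fun t => t + e) t 1 by der_auto; rewrite addr0.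
by move=> tc t; have [h1 h2 h3 h4 h5] := tc (t + e); split;
  [have := der_comp (D t) h1|have := der_comp (D t) h2|have := der_comp (D t) h3
  |have := der_comp (D t) h4|have := der_comp (D t) h5]; rewrite mulr1.
Qed.

Lemma traj_energy c t t' : traj c -> energy (c t) = energy (c t').
Proof.
move=> tc; apply: (@is_derive_0_is_cst _ (fun t => energy (c t))) => u.
suff : der (fun t => energy (c t)) u 0 by [].
have [h1 h2 h3 h4 _] := tc u; rewrite /energy.
by der_auto; rewrite /= /vq1 /vq2 /vp1 /vp2; field.
Qed.

Definition dpsi z x :=
  gam * (vq1 z * (x.2 - pq2 z) + (x.1 - pq1 z) * vq2 z)
  + (vp1 z * (x.1 - pq1 z) + vp2 z * (x.2 - pq2 z))
  + (vp1 z * pq1 z + vp2 z * pq2 z - pp1 z * vq1 z - pp2 z * vq2 z) / 2 - (a + b) / 2.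

Definition dlogenv z x := a * (x.1 - pq1 z) * vq1 z + b * (x.2 - pq2 z) * vq2 z.

Definition dpacket r s z x :=
  dlogenv z x * (ecos z x * r x + esin z x * s x) +
  dpsi z x * (ecos z x * s x - esin z x * r x).

Lemma der_packet (rt st : R -> R * R -> R) (dr ds : R) c t x : traj c ->
  der (fun t => rt t x) t dr -> der (fun t => st t x) t ds ->
  der (fun t => packet (rt t) (st t) (c t) x) t
    (packet (fun=> dr) (fun=> ds) (c t) x + dpacket (rt t) (st t) (c t) x).
Proof.
move=> tc hr hs; have [h1 h2 h3 h4 h5] := tc t.
rewrite /packet /ecos /esin /envelope /psi.
der_auto; rewrite /= /dpacket /dlogenv /dpsi /ecos /esin /envelope /psi; by field.
Qed.

(** The normalized Schrödinger operator in real form: lr + i ls = - i H (r + i s), with the partial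
    derivatives as witnesses. *)
Definition schr r s lr ls : Prop := exists r1 r2 s1 s2 r11 r22 s11 s22,
  [/\ [/\ pder1 r r1, pder2 r r2, pder1 s s1 & pder2 s s2],
      [/\ pder1 r1 r11, pder2 r2 r22, pder1 s1 s11 & pder2 s2 s22],
      lr = (fun x => - 2^-1 * (s11 x + s22 x) + (- theta) * (x.2 * r1 x)
                     + omega ^+ 2 / 2 * (x.1 * (x.1 * s x) + x.2 * (x.2 * s x))) &
      ls = (fun x => 2^-1 * (r11 x + r22 x) + (- theta) * (x.2 * s1 x)
                     + (- (omega ^+ 2 / 2)) * (x.1 * (x.1 * r x) + x.2 * (x.2 * r x)))].

Lemma schr_Sw r s lr ls : Sw r -> Sw s -> schr r s lr ls -> Sw lr /\ Sw ls.
Proof.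
move=> Sr Ss [r1 [r2 [s1 [s2 [r11 [r22 [s11 [s22 [[h1 h2 h3 h4] [h5 h6 h7 h8] -> ->]]]]]]]]].
have S1 := Sw_pder1 Sr h1; have S2 := Sw_pder2 Sr h2.
have S3 := Sw_pder1 Ss h3; have S4 := Sw_pder2 Ss h4.
have S5 := Sw_pder1 S1 h5; have S6 := Sw_pder2 S2 h6.
have S7 := Sw_pder1 S3 h7; have S8 := Sw_pder2 S4 h8.
split.
  apply: SwD; [apply: SwD; apply: SwZ; [exact: SwD|exact: Sw_x2]|apply: SwZ].
  by apply: SwD; [apply: Sw_x1; exact: Sw_x1|apply: Sw_x2; exact: Sw_x2].
apply: SwD; [apply: SwD; apply: SwZ; [exact: SwD|exact: Sw_x2]|apply: SwZ].
by apply: SwD; [apply: Sw_x1; exact: Sw_x1|apply: Sw_x2; exact: Sw_x2].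
Qed.

(* The integrand is a divergence: the probability current between the wave
   function and the packet, which solves the same equation along [traj]. *)
Lemma packet_conservation r s lr ls z : Sw r -> Sw s -> schr r s lr ls ->
  Rintegrable leb2 (fun x : plane => packet lr ls z x + dpacket r s z x) /\
  \int[leb2]_x (packet lr ls z x + dpacket r s z x) = 0.
Proof.
move=> Sr Ss [r1 [r2 [s1 [s2 [r11 [r22 [s11 [s22 [[h1 h2 h3 h4] [h5 h6 h7 h8] -> ->]]]]]]]]].
have S1 := Sw_pder1 Sr h1; have S2 := Sw_pder2 Sr h2.
have S3 := Sw_pder1 Ss h3; have S4 := Sw_pder2 Ss h4.
(* [packet F1 G1 z] and [packet F2 G2 z] are the two components of the current. *)
pose F1 x := (- 2^-1 * s1 x + (- (pp1 z + gam * pq2 z) / 2) * r x + (gam / 2) * (x.2 * r x)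
   + (- a / 2) * (x.1 * s x) + (a * pq1 z / 2) * s x) + (- theta) * (x.2 * r x).
pose G1 x := (2^-1 * r1 x + (- (pp1 z + gam * pq2 z) / 2) * s x + (gam / 2) * (x.2 * s x)
   + (a / 2) * (x.1 * r x) + (- a * pq1 z / 2) * r x) + (- theta) * (x.2 * s x).
pose F2 x := - 2^-1 * s2 x + (- (pp2 z + gam * pq1 z) / 2) * r x + (gam / 2) * (x.1 * r x)
   + (- b / 2) * (x.2 * s x) + (b * pq2 z / 2) * s x.
pose G2 x := 2^-1 * r2 x + (- (pp2 z + gam * pq1 z) / 2) * s x + (gam / 2) * (x.1 * s x)
   + (b / 2) * (x.2 * r x) + (- b * pq2 z / 2) * r x.
have SF1 : Sw F1 by do 5 (apply: SwD; last by apply: SwZ => //; (exact: Sw_x1 || exact: Sw_x2)); exact: SwZ.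
have SG1 : Sw G1 by do 5 (apply: SwD; last by apply: SwZ => //; (exact: Sw_x1 || exact: Sw_x2)); exact: SwZ.
have SF2 : Sw F2 by do 4 (apply: SwD; last by apply: SwZ => //; (exact: Sw_x1 || exact: Sw_x2)); exact: SwZ.
have SG2 : Sw G2 by do 4 (apply: SwD; last by apply: SwZ => //; (exact: Sw_x1 || exact: Sw_x2)); exact: SwZ.
have SJ1 := Sw_packet gam a0 b0 z SF1 SG1; have SJ2 := Sw_packet gam a0 b0 z SF2 SG2.
pose dF1 x := (- 2^-1 * s11 x + (- (pp1 z + gam * pq2 z) / 2) * r1 x + (gam / 2) * (x.2 * r1 x)
   + (- a / 2) * (s x + x.1 * s1 x) + (a * pq1 z / 2) * s1 x) + (- theta) * (x.2 * r1 x).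
pose dG1 x := (2^-1 * r11 x + (- (pp1 z + gam * pq2 z) / 2) * s1 x + (gam / 2) * (x.2 * s1 x)
   + (a / 2) * (r x + x.1 * r1 x) + (- a * pq1 z / 2) * r1 x) + (- theta) * (x.2 * s1 x).
pose dF2 x := - 2^-1 * s22 x + (- (pp2 z + gam * pq1 z) / 2) * r2 x + (gam / 2) * (x.1 * r2 x)
   + (- b / 2) * (s x + x.2 * s2 x) + (b * pq2 z / 2) * s2 x.
pose dG2 x := 2^-1 * r22 x + (- (pp2 z + gam * pq1 z) / 2) * s2 x + (gam / 2) * (x.1 * s2 x)
   + (b / 2) * (r x + x.2 * r2 x) + (- b * pq2 z / 2) * r2 x.
have HF1 : pder1 F1 dF1.
  move=> u v; have k1 := h7 u v; have k2 := h1 u v; have k3 := h3 u v.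
  by rewrite /F1 /dF1 /=; der_auto; rewrite /=; ring.
have HG1 : pder1 G1 dG1.
  move=> u v; have k1 := h5 u v; have k2 := h1 u v; have k3 := h3 u v.
  by rewrite /G1 /dG1 /=; der_auto; rewrite /=; ring.
have HF2 : pder2 F2 dF2.
  move=> u v; have k1 := h8 u v; have k2 := h2 u v; have k3 := h4 u v.
  by rewrite /F2 /dF2 /=; der_auto; rewrite /=; ring.
have HG2 : pder2 G2 dG2.
  move=> u v; have k1 := h6 u v; have k2 := h2 u v; have k3 := h4 u v.
  by rewrite /G2 /dG2 /=; der_auto; rewrite /=; ring.
pose dJ1 x := decos1 a b gam z x * F1 x + ecos z x * dF1 x + (desin1 a b gam z x * G1 x + esin z x * dG1 x).
pose dJ2 x := decos2 a b gam z x * F2 x + ecos z x * dF2 x + (desin2 a b gam z x * G2 x + esin z x * dG2 x).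
have HJ1 : pder1 (packet F1 G1 z) dJ1.
  move=> u v; have k1 := HF1 u v; have k2 := HG1 u v.
  have k3 := pder1_ecos a b gam z u v; have k4 := pder1_esin a b gam z u v.
  by rewrite /packet /dJ1; der_auto; rewrite /=; ring.
have HJ2 : pder2 (packet F2 G2 z) dJ2.
  move=> u v; have k1 := HF2 u v; have k2 := HG2 u v.
  have k3 := pder2_ecos a b gam z u v; have k4 := pder2_esin a b gam z u v.
  by rewrite /packet /dJ2; der_auto; rewrite /=; ring.
set l1 := (fun x => - 2^-1 * (s11 x + s22 x) + _ + _).
set l2 := (fun x => 2^-1 * (r11 x + r22 x) + _ + _).
have E : (fun x : plane => packet l1 l2 z x + dpacket r s z x) = (fun x => dJ1 x + dJ2 x).
  apply/funext => x; apply/eqP; rewrite -subr_eq0; apply/eqP.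
  (* The two sides differ by multiples of the residuals of the three Riccati identities. *)
  transitivity (
    (ecos z x * s x - esin z x * r x) *
      ((omega ^+ 2 + gam ^+ 2 - a ^+ 2) * (x.1 - pq1 z) ^+ 2
       + (omega ^+ 2 + gam ^+ 2 - 2 * theta * gam - b ^+ 2) * (x.2 - pq2 z) ^+ 2) / 2
    + (gam * (a + b) - theta * a) * (x.1 - pq1 z) * (x.2 - pq2 z) * (ecos z x * r x + esin z x * s x)).
    rewrite /packet /dpacket /dlogenv /dpsi /vq1 /vq2 /vp1 /vp2 /l1 /l2 /dJ1 /dJ2.
    by rewrite /F1 /G1 /F2 /G2 /dF1 /dG1 /dF2 /dG2 /decos1 /desin1 /decos2 /desin2; field.
  by rewrite Ha Hb Hg; ring.
have I1 := Rintegrable_Sw (Sw_pder1 SJ1 HJ1); have I2 := Rintegrable_Sw (Sw_pder2 SJ2 HJ2).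
rewrite E; split; first exact: (RintegrableD I1 I2).
rewrite RintegralD; [|exact: measurableT|exact: I1|exact: I2].
by rewrite (Rintegral_pder1 SJ1 HJ1) (Rintegral_pder2 SJ2 HJ2) addr0.
Qed.

Lemma affine_gauss_le_k1 (s : R) : 0 < s ->
  exists2 C, 0 <= C & forall u : R, (1 + `|u|) * expR (- (s * u ^+ 2)) <= C * k1 u.
Proof.
move=> s0; have t0 : 0 < s / 2 by rewrite divr_gt0.
have iv : 0 < (s / 2)^-1 by rewrite invr_gt0.
exists ((2 + (s / 2)^-1) * (1 + (s / 2)^-1)); first by nneg.
move=> u; have h1 := abs_gauss_le u t0; have h2 := expR_gauss_le_k1 u t0.
have e1 : 1 <= expR (s / 2 * u ^+ 2) by rewrite -expR0 ler_expR; nneg.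
rewrite (_ : - (s * u ^+ 2) = - (s / 2 * u ^+ 2) + - (s / 2 * u ^+ 2)); last by field.
rewrite expRD mulrA -[leRHS]mulrA; apply: ler_pM => //; try exact: expR_ge0.
by rewrite expRN ler_pdivrMr ?expR_gt0//; lra.
Qed.

Lemma envelope_poly_le (B : R) : 0 <= B -> exists2 C, 0 <= C & forall z x,
  `|pq1 z| <= B -> `|pq2 z| <= B ->
  (1 + `|x.1 - pq1 z|) * (1 + `|x.2 - pq2 z|) * envelope z x <= C * k2 x.
Proof.
move=> B0.
have [Ca Ca0 ha] := @affine_gauss_le_k1 (a / 2) (divr_gt0 a0 (@ltr0Sn _ 1)).
have [Cb Cb0 hb] := @affine_gauss_le_k1 (b / 2) (divr_gt0 b0 (@ltr0Sn _ 1)).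
have sh (q u : R) : `|q| <= B -> k1 (u - q) <= 2 * (1 + B ^+ 2) * k1 u.
  move=> qB; apply: (le_trans (k1_shift _ _)); rewrite ler_wpM2r ?(ltW (k1_gt0 _))//.
  by rewrite ler_wpM2l// lerD2l sqrrN -[q ^+ 2]real_normK ?num_real// lerXn2r// nnegrE.
exists (Ca * (2 * (1 + B ^+ 2)) * (Cb * (2 * (1 + B ^+ 2)))); first by nneg.
move=> z x z1 z2; rewrite /envelope opprD expRD mulrACA /k2.
rewrite [leRHS](_ : _ = (Ca * (2 * (1 + B ^+ 2) * k1 x.1)) * (Cb * (2 * (1 + B ^+ 2) * k1 x.2))); last by ring.
have k10 : 0 <= k1 (x.1 - pq1 z) := ltW (k1_gt0 _).
have k20 : 0 <= k1 (x.2 - pq2 z) := ltW (k1_gt0 _).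
apply: ler_pM; [by nneg|by nneg| |].
- by apply: (le_trans (ha _)); rewrite ler_wpM2l// sh.
- by apply: (le_trans (hb _)); rewrite ler_wpM2l// sh.
Qed.

Definition inbox (B : R) z := [/\ `|pq1 z| <= B, `|pq2 z| <= B, `|pp1 z| <= B & `|pp2 z| <= B].

Lemma normM_le (u v X Y : R) : `|u| <= X -> `|v| <= Y -> `|u * v| <= X * Y.
Proof. by move=> h1 h2; rewrite normrM ler_pM. Qed.

(** Both [dlogenv] and [dpsi] are affine in [x], so the envelope absorbs them, uniformly over
    bounded sets of centres and momenta. *)
Lemma packet_box_le (B : R) : 0 <= B -> exists2 C, 0 <= C & forall r s z x, inbox B z ->
  `|packet r s z x| <= C * k2 x * (`|r x| + `|s x|) /\
  `|dpacket r s z x| <= C * k2 x * (`|r x| + `|s x|).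
Proof.
move=> B0; have [C C0 HC] := envelope_poly_le B0.
pose D := (1 + `|theta| + omega ^+ 2) * B.
pose L := (a + b) * D + (2 * `|gam| * D + 2 * D + 2 * B * D + (a + b) / 2).
have D0 : 0 <= D by rewrite /D; nneg.
have L0 : 0 <= L by rewrite /L; nneg.
exists ((1 + L) * C); first by nneg.
move=> r s z x [q1 q2 p1 p2].
set m := (1 + `|x.1 - pq1 z|) * (1 + `|x.2 - pq2 z|).
have hm := HC z x q1 q2; rewrite -/m in hm.
have g1 : 0 <= `|x.1 - pq1 z| by []. have g2 : 0 <= `|x.2 - pq2 z| by [].
have m1 : 1 <= m by rewrite /m; nra.
have mx1 : `|x.1 - pq1 z| <= m by rewrite /m; nra.
have mx2 : `|x.2 - pq2 z| <= m by rewrite /m; nra.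
have m0 : 0 <= m by lra.
have e0 := envelope_gt0 a b z x.
have K0 : 0 <= C * k2 x by apply: mulr_ge0 => //; exact/ltW/k2_gt0.
have eC : envelope z x <= C * k2 x.
  by apply: le_trans hm; rewrite ler_peMl// ltW.
have w0 : 0 <= `|r x| + `|s x| by nneg.
have hA : `|ecos z x * r x + esin z x * s x| <= envelope z x * (`|r x| + `|s x|).
  exact: norm_packet.
have hB : `|ecos z x * s x - esin z x * r x| <= envelope z x * (`|r x| + `|s x|).
  apply: (le_trans (ler_normB _ _)); rewrite addrC mulrDr !(normrM _ (r x)) !(normrM _ (s x)).
  by apply: lerD; rewrite ler_wpM2r ?norm_ecos ?norm_esin.
split.
  apply: (le_trans hA); rewrite ler_wpM2r//; apply: (le_trans eC).
  by rewrite -mulrA ler_peMl// lerDl.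
have D1 : B <= D.
  rewrite /D -[leLHS]mul1r ler_wpM2r//; have := normr_ge0 theta; have := sqr_ge0 omega; lra.
have tn := normr_ge0 theta; have on := sqr_ge0 omega.
have b1 : `|vq1 z| <= D.
  apply: (le_trans (ler_normD _ _)); rewrite normrM /D !mulrDl mul1r.
  have : `|theta| * `|pq2 z| <= `|theta| * B by rewrite ler_wpM2l.
  have : 0 <= omega ^+ 2 * B by nneg.
  lra.
have b2 : `|vq2 z| <= D by exact: le_trans D1.
have b3 : `|vp1 z| <= D.
  rewrite normrN normrM (ger0_norm on) /D !mulrDl mul1r.
  have : omega ^+ 2 * `|pq1 z| <= omega ^+ 2 * B by rewrite ler_wpM2l.
  have : 0 <= `|theta| * B by nneg.
  lra.
have b4 : `|vp2 z| <= D.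
  apply: (le_trans (ler_normB _ _)); rewrite normrN (normrM theta) (normrM (omega ^+ 2)) (ger0_norm on) /D !mulrDl mul1r.
  have : omega ^+ 2 * `|pq2 z| <= omega ^+ 2 * B by rewrite ler_wpM2l.
  have : `|theta| * `|pp1 z| <= `|theta| * B by rewrite ler_wpM2l.
  lra.
have hl : `|dlogenv z x| <= (a + b) * D * m.
  apply: (le_trans (ler_normD _ _)).
  have l1 : `|a * (x.1 - pq1 z) * vq1 z| <= a * m * D by apply: normM_le => //; apply: normM_le => //; rewrite gtr0_norm.
  have l2 : `|b * (x.2 - pq2 z) * vq2 z| <= b * m * D by apply: normM_le => //; apply: normM_le => //; rewrite gtr0_norm.
  lra.
have hp : `|dpsi z x| <= (2 * `|gam| * D + 2 * D + 2 * B * D + (a + b) / 2) * m.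
  have BD : 0 <= B * D by nneg.
  have BDm : B * D <= B * D * m by rewrite ler_peMr.
  have ab0 : 0 <= (a + b) / 2 by nneg.
  have abm : (a + b) / 2 <= (a + b) / 2 * m by rewrite ler_peMr.
  have l1 : `|gam * (vq1 z * (x.2 - pq2 z) + (x.1 - pq1 z) * vq2 z)| <= `|gam| * (D * m + m * D).
    by apply: normM_le => //; apply: (le_trans (ler_normD _ _)); apply: lerD; exact: normM_le.
  have l2 : `|vp1 z * (x.1 - pq1 z) + vp2 z * (x.2 - pq2 z)| <= D * m + D * m.
    by apply: (le_trans (ler_normD _ _)); apply: lerD; exact: normM_le.
  have l3 : `|(vp1 z * pq1 z + vp2 z * pq2 z - pp1 z * vq1 z - pp2 z * vq2 z) / 2| <= (D * B + D * B + B * D + B * D) / 2.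
    rewrite normrM (ger0_norm (_ : 0 <= 2^-1 :> R))//; apply: ler_wpM2r => //.
    apply: (le_trans (ler_normB _ _)); apply: lerD; last exact: normM_le.
    apply: (le_trans (ler_normB _ _)); apply: lerD; last exact: normM_le.
    by apply: (le_trans (ler_normD _ _)); apply: lerD; exact: normM_le.
  rewrite /dpsi; apply: (le_trans (ler_normB _ _)); rewrite (ger0_norm ab0).
  apply: (@le_trans _ _ (`|gam| * (D * m + m * D) + (D * m + D * m) + (D * B + D * B + B * D + B * D) / 2 + (a + b) / 2)).
    rewrite lerD2r; apply: (le_trans (ler_normD _ _)); apply: lerD => //.
    by apply: (le_trans (ler_normD _ _)); apply: lerD.
  lra.
have W0 : 0 <= envelope z x * (`|r x| + `|s x|) by apply: mulr_ge0 => //; exact: ltW.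
apply: (@le_trans _ _ (L * m * (envelope z x * (`|r x| + `|s x|)))).
  rewrite {1}/L (mulrDl ((a + b) * D)) [leRHS]mulrDl.
  by apply: (le_trans (ler_normD _ _)); apply: lerD; exact: normM_le.
rewrite (_ : L * m * _ = L * (m * envelope z x) * (`|r x| + `|s x|)); last by ring.
rewrite ler_wpM2r// -[leRHS]mulrA; apply: ler_pM => //; last by rewrite lerDr.
by apply: mulr_ge0 => //; exact: ltW.
Qed.

(** Since theta^2 < omega^2 the energy is positive definite; by conservation of energy, a trajectory
    therefore stays in one box and one majorant serves all its times. *)
Lemma energy_inbox (h : R) : exists2 B, 0 <= B & forall z, energy z <= h -> inbox B z.
Proof.
pose kap := omega ^+ 2 - theta ^+ 2.
have kap0 : 0 < kap by rewrite subr_gt0.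
have o2 : 0 < omega ^+ 2 by rewrite exprn_gt0.
pose C := 2 / kap + 2 * omega ^+ 2 / kap + 2.
have C0 : 0 <= C by rewrite /C; nneg.
have sq (t H : R) : 0 <= H -> t ^+ 2 <= C * H -> `|t| <= 1 + C * H.
  move=> H0; rewrite -real_normK ?num_real//; have := normr_ge0 t; have : 0 <= C * H by nneg.
  move: (C * H) `|t| => X u; nra.
exists (1 + C * `|h|); first by nneg.
move=> z zh.
have e0 := energy_ge0 thom z.
have hh : energy z <= `|h| := le_trans zh (ler_norm _).
have hq := energy_ge_q omega theta z; have hp := energy_ge_p theta om0 z.
rewrite -/kap in hq hp.
have Ch (d : R) : 0 <= d -> d <= C -> d * energy z <= C * `|h|.
  by move=> d0 dC; apply: ler_pM.
have i1 : 0 <= 2 / kap by nneg.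
have i2 : 0 <= 2 * omega ^+ 2 / kap by nneg.
have s1 := sqr_ge0 (pq1 z); have s2 := sqr_ge0 (pq2 z); have s3 := sqr_ge0 (pp1 z); have s4 := sqr_ge0 (pp2 z).
have f1 : pq1 z ^+ 2 + pq2 z ^+ 2 <= 2 / kap * energy z.
  rewrite mulrAC ler_pdivlMr//; lra.
have f2 : pp1 z ^+ 2 <= 2 * omega ^+ 2 / kap * energy z.
  rewrite mulrAC ler_pdivlMr//.
  have : kap / (2 * omega ^+ 2) * pp1 z ^+ 2 <= energy z by lra.
  by rewrite mulrAC ler_pdivrMr ?mulr_gt0//; lra.
have f3 : pp2 z ^+ 2 <= 2 * energy z.
  have : 0 <= kap / 2 * (pq1 z ^+ 2 + pq2 z ^+ 2) by nneg.
  lra.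
have t1 := Ch _ i1 (_ : 2 / kap <= C); have t2 := Ch _ i2 (_ : 2 * omega ^+ 2 / kap <= C).
have t3 := Ch 2 (ler0n _ 2) (_ : 2 <= C).
by split; apply: sq => //; [have := t1 _|have := t1 _|have := t2 _|have := t3 _]; rewrite /C; lra.
Qed.

End Trajectories.

(** * Conservation of the pairings with moving packets *)

Section LineLemmas.
Context {R : realType}.
Implicit Types f df : R -> R.

Lemma norm_der_le f df K x y : (forall t, der f t (df t)) -> (forall t, `|df t| <= K) ->
  `|f y - f x| <= K * `|y - x|.
Proof.
move=> hf hK; wlog xy : x y / x <= y => [H|].
  by case: (leP x y) => [|/ltW] /H//; rewrite distrC (distrC y).
have cf : {within `[x, y], continuous f}.
  by apply: continuous_subspaceT => t; exact: der_continuous (hf t).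
have [c _ ->] := MVT_segment xy (fun t _ => hf t) cf.
by rewrite normrM ler_wpM2r.
Qed.

Lemma der0_on_cst f x0 e : (forall t, `|t - x0| < e -> der f t 0) ->
  forall x y, `|x - x0| < e -> `|y - x0| < e -> f x = f y.
Proof.
move=> hf x y; wlog xy : x y / x <= y => [H hx hy|].
  by case: (leP x y) => [|/ltW] h; [exact: H|exact/esym/H].
move=> hx hy.
have hI t : x <= t <= y -> `|t - x0| < e.
  move: hx hy; rewrite !ltr_distl => /andP[a1 a2] /andP[b1 b2] /andP[c1 c2].
  by apply/andP; split; [exact: lt_le_trans c1|exact: le_lt_trans b2].
have cf : {within `[x, y], continuous f}.
  apply: derivable_within_continuous => t; rewrite in_itv/= => /hI /hf; by case.
have hd t : t \in `]x, y[ -> is_derive t 1 f ((fun=> 0) t).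
  by rewrite in_itv/= => /andP[t1 t2]; apply/hf/hI; rewrite !ltW.
have [c _ /eqP] := MVT_segment xy hd cf.
by rewrite mul0r subr_eq0 => /eqP ->.
Qed.

Lemma der_le_lip f x l K : der f x l -> (forall e, `|f (x + e) - f x| <= K * `|e|) -> `|l| <= K.
Proof.
move=> [df <-] hK.
have L : `|h^-1 *: (f (h *: 1 + x) - f x)| @[h --> (0 : R)^'] --> `|'D_1 f x|.
  apply: cvg_norm; exact: df.
apply: (ler_cvg_to L (cvg_cst K)).
near=> h; have h0 : h != 0 by near: h; exact: nbhs_dnbhs_neq.
rewrite /GRing.scale/= mulr1 normrM normfV ler_pdivrMl ?normr_gt0//.
by rewrite (mulrC `|h|) (addrC h); exact: hK.
Unshelve. all: by end_near. Qed.

(* A Baire category argument: were the conclusion false, nested balls would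
   avoid all the [X n]. *)
Lemma baire_ball (F : R -> Prop) (X : nat -> R -> Prop) (t0 : R) : F t0 ->
  (forall n t, ~ X n t -> exists2 e, 0 < e & forall u, `|u - t| < e -> ~ X n u) ->
  (forall t, exists n, X n t) ->
  exists n t e, [/\ F t, 0 < e & forall u, F u -> `|u - t| < e -> X n u].
Proof.
move=> Ft0 oX cov; apply/not_existsP => H.
have step n (te : R * R) : F te.1 -> 0 < te.2 -> exists te' : R * R,
    [/\ F te'.1, 0 < te'.2, `|te'.1 - te.1| + te'.2 <= te.2 &
        forall u, `|u - te'.1| <= te'.2 -> ~ X n u].
  move=> Ft e0.
  have [u [Fu ut nX]] : exists u, [/\ F u, `|u - te.1| < te.2 & ~ X n u].
    apply: contrapT => H'; apply: (H n); exists te.1, te.2; split => // u Fu ut.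
    by apply: contrapT => nX; apply: H'; exists u.
  have [e e1 He] := oX n u nX.
  have d0 : 0 < te.2 - `|u - te.1| by rewrite subr_gt0.
  exists (u, Num.min (e / 2) (te.2 - `|u - te.1|)) => /=; split => //.
  - by rewrite lt_min d0 divr_gt0.
  - by rewrite -lerBrDl ge_min lexx orbT.
  - move=> v hv; apply: He; apply: (le_lt_trans hv); rewrite gt_min.
    by rewrite ltr_pdivrMr// ltr_pMr// ltr1n.
pose S := {te : R * R | F te.1 /\ 0 < te.2}.
have stepS (n : nat) (p : S) : {q : S | `|(sval q).1 - (sval p).1| + (sval q).2 <= (sval p).2 /\
    forall u, `|u - (sval q).1| <= (sval q).2 -> ~ X n u}.
  apply: cid; case: p => te [Ft e0]; have [te' [h1 h2 h3 h4]] := step n te Ft e0.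
  by exists (exist _ te' (conj h1 h2)).
pose sq := fix sq n : S := if n is m.+1 then sval (stepS m (sq m))
  else exist _ (t0, 1) (conj Ft0 (ltr01 : 0 < (t0, 1).2)).
pose T n := (sval (sq n)).1; pose E n := (sval (sq n)).2.
have E0 n : 0 < E n by rewrite /E; case: (sval (sq n)) (svalP (sq n)) => ? ? [].
have hs n : `|T n.+1 - T n| + E n.+1 <= E n by have [] := svalP (stepS n (sq n)).
have hX n u : `|u - T n.+1| <= E n.+1 -> ~ X n u by have [_] := svalP (stepS n (sq n)); apply.
have mon n k : `|T (n + k)%N - T n| + E (n + k)%N <= E n.
  elim: k => [|k IH]; first by rewrite addn0 subrr normr0 add0r.
  rewrite addnS; apply: le_trans IH; have := hs (n + k)%N.
  have := ler_normD (T (n + k).+1 - T (n + k)%N) (T (n + k)%N - T n).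
  rewrite addrA subrK; lra.
have lr n m : T n - E n <= T m + E m.
  have e1 := E0 n; have e2 := E0 m.
  case: (leqP n m) => nm.
    by have := mon n (m - n)%N; rewrite subnKC// => h; have := ler_norm (T n - T m); rewrite distrC; lra.
  by have := mon m (n - m)%N; rewrite subnKC ?(ltnW nm)// => h; have := ler_norm (T n - T m); lra.
pose A := range (fun n => T n - E n).
have supA : has_sup A.
  split; first by exists (T 0%N - E 0%N); exists 0%N.
  by exists (T 0%N + E 0%N) => _ [n _ <-].
pose s := sup A.
have s1 n : T n - E n <= s by apply: (sup_upper_bound supA); exists n.
have s2 n : s <= T n + E n by apply: (ge_sup supA.1) => _ [m _ <-].
(* The sets [X n] cover the whole line, so the limit point is covered whether or not it satisfies
   [F]. *)
have [n Xn] := cov s.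
apply: (hX n s) Xn; rewrite ler_norml; have := s1 n.+1; have := s2 n.+1; lra.
Qed.

(** Real induction: [P] holds at the supremum of its initial segments by the limit clause, and the
    extension clause forces that supremum to be 1. *)
Lemma continuous_induction01 (P : R -> Prop) : P 0 ->
  (forall w, 0 < w -> w <= 1 -> (forall v, 0 <= v -> v < w -> P v) -> P w) ->
  (forall w, 0 <= w -> w < 1 -> (forall v, 0 <= v -> v <= w -> P v) ->
    exists2 e, 0 < e & forall v, w < v -> v < w + e -> P v) ->
  P 1.
Proof.
move=> P0 Pl Po.
pose S := [set w : R | 0 <= w <= 1 /\ forall v, 0 <= v -> v <= w -> P v].
have S0 : S 0.
  by split; [rewrite lexx ler01|move=> v v0 v0'; have -> : v = 0 by apply/le_anti; rewrite v0 v0'].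
have supS : has_sup S by split; [exists 0|exists 1 => w [/andP[]]].
have s0 : 0 <= sup S by exact: (sup_upper_bound supS).
have s1 : sup S <= 1 by apply: (ge_sup supS.1) => w [/andP[]].
have below v : 0 <= v -> v < sup S -> P v.
  move=> v0 vs; have d0 : 0 < sup S - v by rewrite subr_gt0.
  have [w [_ Pw]] := sup_adherent d0 supS.
  by rewrite opprB addrC subrK => vw; apply: Pw => //; exact: ltW.
have Ps : P (sup S).
  by move: s0; rewrite le_eqVlt => /predU1P[<-//|s0]; exact: Pl.
have upto v : 0 <= v -> v <= sup S -> P v.
  by move=> v0; rewrite le_eqVlt => /predU1P[->//|]; exact: below.
move: s1; rewrite le_eqVlt => /predU1P[<-//|s1].
have [e e0 He] := Po _ s0 s1 upto.
pose w := Num.min (sup S + e / 2) 1.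
have sw : sup S < w by rewrite lt_min s1 andbT ltrDl divr_gt0.
have Sw' : S w.
  split; first by rewrite (le_trans s0 (ltW sw))/= ge_min lexx orbT.
  move=> v v0 vw; case: (leP v (sup S)) => vs; first exact: upto.
  apply: He => //; apply: (le_lt_trans vw); rewrite gt_min ltrD2l.
  by rewrite ltr_pdivrMr// ltr_pMr// ltr1n.
by have := sup_upper_bound supS Sw'; rewrite leNgt sw.
Qed.

End LineLemmas.

(** * Derivatives of pairings, and recovery of a function from them *)

Section Conservation.
Context {R : realType}.
Notation plane := (measurableTypeR R * measurableTypeR R)%type.
Notation point := (@point R).
Implicit Types (r s lr ls : R * R -> R) (x : R * R) (z : point) (c : R -> point).

Variables omega theta a b gam : R.
Hypotheses (a0 : 0 < a) (b0 : 0 < b) (om0 : 0 < omega) (thom : theta ^+ 2 < omega ^+ 2).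
Hypotheses (Ha : a ^+ 2 = omega ^+ 2 + gam ^+ 2)
  (Hb : b ^+ 2 = omega ^+ 2 + gam ^+ 2 - 2 * theta * gam)
  (Hg : gam * (a + b) = theta * a).

Notation envelope := (envelope a b).
Notation ecos := (ecos a b gam).
Notation esin := (esin a b gam).
Notation packet := (packet a b gam).
Notation dpacket := (dpacket omega theta a b gam).
Notation pairing := (pairing a b gam).
Notation energy := (energy omega theta).
Notation traj := (traj omega theta a b).
Notation schr := (schr omega theta).

Lemma measurable_packet r s z : continuous r -> continuous s ->
  measurable_fun [set: plane] (packet r s z).
Proof.
move=> cr cs; apply: continuous_measurable_plane; apply: contD; apply: contM => //.
  exact: continuous_ecos.
exact: continuous_esin.
Qed.

Lemma Rintegrable_packet r s z C : continuous r -> continuous s ->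
  (forall x, `|r x| <= C) -> (forall x, `|s x| <= C) -> Rintegrable leb2 (packet r s z : plane -> R).
Proof.
move=> cr cs br bs.
pose B := `|pq1 z| + `|pq2 z| + `|pp1 z| + `|pp2 z|.
have n1 := normr_ge0 (pq1 z); have n2 := normr_ge0 (pq2 z).
have n3 := normr_ge0 (pp1 z); have n4 := normr_ge0 (pp2 z).
have B0 : 0 <= B by rewrite /B; nneg.
have zB : inbox B z by split; rewrite /B; lra.
have [D D0 HD] := packet_box_le omega theta gam a0 b0 B0.
apply: (@Rintegrable_le _ plane R _ _ (fun x => (D * (C + C)) * k2 x)); first exact: measurable_packet.
  move=> x; apply: (le_trans (HD r s z x zB).1); rewrite mulrAC ler_wpM2r ?(ltW (k2_gt0 _))//.
  by rewrite ler_wpM2l//; apply: lerD.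
exact: (RintegrableZ _ (@Rintegrable_k2 R)).
Qed.

(** The bounds near [t0] are the crux: for the solution they become available only through the
    category argument. *)
Lemma der_pairing (rt st dr ds : R -> R * R -> R) c t0 e C : 0 < e -> traj c ->
  (forall t, continuous (rt t)) -> (forall t, continuous (st t)) ->
  (forall t x, `|t - t0| < e -> der (fun t => rt t x) t (dr t x)) ->
  (forall t x, `|t - t0| < e -> der (fun t => st t x) t (ds t x)) ->
  (forall t x, `|t - t0| < e -> [/\ `|rt t x| <= C, `|st t x| <= C, `|dr t x| <= C & `|ds t x| <= C]) ->
  der (fun t => pairing (rt t) (st t) (c t)) t0
    (\int[leb2]_x (packet (dr t0) (ds t0) (c t0) x + dpacket (rt t0) (st t0) (c t0) x)).
Proof.
move=> e0 tc crt cst hr hs bd.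
have [B B0 HB] := energy_inbox om0 thom (energy (c t0)).
have cB t : inbox B (c t) by apply: HB; rewrite (traj_energy t t0 tc).
have [D D0 HD] := packet_box_le omega theta gam a0 b0 B0.
apply: (@der_Rintegral _ plane R leb2 (fun t x => packet (rt t) (st t) (c t) x)
  (fun t x => packet (dr t) (ds t) (c t) x + dpacket (rt t) (st t) (c t) x)
  (fun x => (2 * (D * (C + C))) * k2 x) t0 e e0).
- move=> t te; apply: (@Rintegrable_packet _ _ _ C) => //; by move=> x; case: (bd t x te).
- by move=> t x te; exact: (@der_packet R omega theta a b gam rt st (dr t x) (ds t x) c t x tc (hr t x te) (hs t x te)).
- move=> t x te; have [h1 h2 h3 h4] := bd t x te.
  have k0 : 0 <= D * k2 x by apply: mulr_ge0 => //; exact/ltW/k2_gt0.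
  rewrite (_ : 2 * _ * _ = D * k2 x * (C + C) + D * k2 x * (C + C)); last by ring.
  apply: (le_trans (ler_normD _ _)); apply: lerD.
    by apply: (le_trans (HD _ _ _ _ (cB t)).1); rewrite ler_wpM2l//; apply: lerD.
  by apply: (le_trans (HD _ _ _ _ (cB t)).2); rewrite ler_wpM2l//; apply: lerD.
- exact: (RintegrableZ _ (@Rintegrable_k2 R)).
Qed.

(** Only the packet moves, so no uniformity in time is at stake; by [packet_conservation] this
    motion compensates the evolution of r + i s. *)
Lemma der_pairing_fixed r s lr ls c t : Sw r -> Sw s -> schr r s lr ls -> traj c ->
  der (fun t => pairing r s (c t)) t (- pairing lr ls (c t)).
Proof.
move=> Sr Ss hL tc; have [Slr Sls] := schr_Sw Sr Ss hL.
have [Cr br] := Sw_bounded Sr; have [Cs bs] := Sw_bounded Ss.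
have Cr0 := le_trans (normr_ge0 _) (br (0, 0)); have Cs0 := le_trans (normr_ge0 _) (bs (0, 0)).
have D := @der_pairing (fun=> r) (fun=> s) (fun _ _ => 0) (fun _ _ => 0) c t 1 (Cr + Cs) ltr01 tc
  (fun=> Sw_continuous Sr) (fun=> Sw_continuous Ss) (fun t x _ => der_cst _ _) (fun t x _ => der_cst _ _).
apply: der_eq.
  apply: D => u x _; rewrite normr0; split.
  - by apply: (le_trans (br x)); rewrite lerDl.
  - by apply: (le_trans (bs x)); rewrite lerDr.
  - exact: addr_ge0.
  - exact: addr_ge0.
have [I1 E1] := packet_conservation a0 b0 Ha Hb Hg (c t) Sr Ss hL.
have I2 := Rintegrable_Sw (Sw_packet gam a0 b0 (c t) Slr Sls).
transitivity (\int[leb2]_x ((packet lr ls (c t) x + dpacket r s (c t) x) - packet lr ls (c t) x)).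
  by apply: eq_Rintegral => x _; rewrite /packet; ring.
rewrite RintegralB; [|exact: measurableT|exact: I1|exact: I2].
by rewrite E1 sub0r.
Qed.

(** Encodes the decay of the pairing with the time derivative as a Lipschitz bound, which mentions
    only the pairings of [r], [s] and therefore passes to limits. *)
Lemma pairing_lip r s lr ls : Sw r -> Sw s -> schr r s lr ls ->
  exists M, forall c t e, traj c ->
    (1 + energy (c t)) ^+ 2 * `|pairing r s (c (t + e)) - pairing r s (c t)| <= M * `|e|.
Proof.
move=> Sr Ss hL; have [Slr Sls] := schr_Sw Sr Ss hL.
have [M HM] := pairing_decay gam a0 b0 om0 thom Slr Sls.
exists M => c t e tc.
have w0 : 0 < (1 + energy (c t)) ^+ 2.
  by rewrite exprn_gt0// ltr_wpDr ?(energy_ge0 thom).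
have h := @norm_der_le R (fun t => pairing r s (c t)) (fun t => - pairing lr ls (c t))
  (M / (1 + energy (c t)) ^+ 2) t (t + e).
rewrite mulrC -ler_pdivlMr// mulrAC.
rewrite [X in _ * `|X|](_ : e = t + e - t); last by ring.
apply: h => u; first exact: der_pairing_fixed hL tc.
by rewrite normrN ler_pdivlMr// mulrC (traj_energy t u tc).
Qed.

Definition mu0 : R := (omega ^+ 2 - theta ^+ 2) / (2 * omega ^+ 2).

(** Two lower bounds for 1 + energy, one for each momentum, are multiplied; hence the second power
    of the energy controls 1 / [k2] in the momentum. *)
Lemma energy_sqr_ge z : mu0 / 2 <= (1 + energy z) ^+ 2 * (k1 (pp1 z) * k1 (pp2 z)).
Proof.
have o2 : 0 < omega ^+ 2 by rewrite exprn_gt0.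
have m0 : 0 < mu0 by rewrite /mu0 divr_gt0 ?subr_gt0 ?mulr_gt0.
have m1 : mu0 <= 1.
  rewrite /mu0 ler_pdivrMr ?mulr_gt0// mul1r.
  by have := sqr_ge0 theta; lra.
have h := energy_ge_p theta om0 z; rewrite -/mu0 in h.
rewrite /k1 -invfM ler_pdivlMr ?mulr_gt0 ?one_add_sqr_gt0//.
have p1 := sqr_ge0 (pp1 z); have p2 := sqr_ge0 (pp2 z).
move: (pp1 z ^+ 2) (pp2 z ^+ 2) p1 p2 h => X Y X0 Y0 h.
have mX : 0 <= mu0 * X by rewrite mulr_ge0// ltW.
have s1 : 1 + mu0 * X <= 1 + energy z by lra.
have s2 : 1 + Y / 2 <= 1 + energy z by lra.
have h3 : (1 + mu0 * X) * (1 + Y / 2) <= (1 + energy z) ^+ 2.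
  by rewrite expr2; apply: ler_pM => //; lra.
apply: le_trans h3; rewrite (_ : mu0 / 2 * _ = (mu0 * (1 + X)) * ((1 + Y) / 2)); last by ring.
apply: ler_pM; [apply: mulr_ge0; lra|lra|rewrite mulrDr mulr1; lra|lra].
Qed.

Lemma mu0_gt0 : 0 < mu0.
Proof. by rewrite /mu0 divr_gt0 ?subr_gt0 ?mulr_gt0 ?exprn_gt0. Qed.

Lemma pairing_k2 r s M : (forall z, (1 + energy z) ^+ 2 * `|pairing r s z| <= M) ->
  forall z, `|pairing r s z| <= M * (2 / mu0) * k2 (pp1 z, pp2 z).
Proof.
move=> HM z; have m0 := mu0_gt0.
have w0 : 0 < (1 + energy z) ^+ 2 by rewrite exprn_gt0// ltr_wpDr ?(energy_ge0 thom).
have k0 : 0 <= k1 (pp1 z) * k1 (pp2 z) by rewrite mulr_ge0 ?(ltW (k1_gt0 _)).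
have h1 := energy_sqr_ge z; have h2 := HM z; have p0 := normr_ge0 (pairing r s z).
have m2 : 0 < mu0 / 2 by rewrite divr_gt0.
rewrite /k2/= -(ler_pM2l m2).
move: h1 h2 k0; move: (k1 (pp1 z) * k1 (pp2 z)) ((1 + energy z) ^+ 2) `|pairing r s z| p0 => K W P P0 h1 h2 K0.
rewrite (_ : mu0 / 2 * (M * _ * K) = M * K); last by field; rewrite gt_eqF.
have h3 := ler_wpM2r P0 h1; have h4 := ler_wpM2r K0 h2.
by apply: (le_trans h3); apply: le_trans h4; rewrite mulrAC.
Qed.

(** The correction cancels the Weyl phase at the centre: the packet has phase exactly [d] at y for
    every momentum. *)
Definition fpoint (y p : R * R) (d : R) : point :=
  Point y.1 y.2 p.1 p.2 (d - (p.1 * y.1 + p.2 * y.2) / 2).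

(** For a fixed centre y, the pairing as a function of p is a Fourier transform of r + i s times a
    fixed Gaussian about y; inversion at the origin returns the value at y, where the envelope
    equals 1. *)
Lemma pairing_inversion r s M y d : continuous r -> continuous s ->
  (exists C, forall x, `|r x| <= C) -> (exists C, forall x, `|s x| <= C) ->
  (forall z, (1 + energy z) ^+ 2 * `|pairing r s z| <= M) ->
  Rintegrable leb2 (fun p : plane => pairing r s (fpoint y p d)) /\
  \int[leb2]_p pairing r s (fpoint y p d) =
  (gauss_mass ^+ 2) ^+ 2 * (r y * cos d + s y * sin d).
Proof.
move=> cr cs [Cr br] [Cs bs] HM.
pose z0 : point := Point 0 0 0 0 d.
have [D D0 HD] := envelope_poly_le a0 b0 (lexx (0 : R)).
have eD x : envelope z0 x <= D * k2 x.
  apply: le_trans (HD z0 x _ _); rewrite ?normr0//.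
  rewrite ler_peMl ?(ltW (envelope_gt0 _ _ _ _))//.
  by rewrite mulr_ege1// lerDl.
pose H1 x := ecos z0 x * r (x.1 + y.1, x.2 + y.2) + esin z0 x * s (x.1 + y.1, x.2 + y.2).
pose H2 x := ecos z0 x * s (x.1 + y.1, x.2 + y.2) + - (esin z0 x * r (x.1 + y.1, x.2 + y.2)).
have sh (f : R * R -> R) : continuous f -> continuous (fun x : R * R => f (x.1 + y.1, x.2 + y.2)).
  move=> cf; apply: (@cont_comp2 _ _ f (fun x : R * R => x.1 + y.1) (fun x : R * R => x.2 + y.2) cf); cont_tac.
have cec := @continuous_ecos R a b gam z0; have ces := @continuous_esin R a b gam z0.
have cH1 : continuous H1 by apply: contD; apply: contM => //; exact: sh.
have cH2 : continuous H2.
  by apply: contD; [apply: contM => //; exact: sh|apply: contN; apply: contM => //; exact: sh].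
have bc x : `|ecos z0 x| <= D * k2 x := le_trans (norm_ecos _ _ _ _ _) (eD x).
have bs' x : `|esin z0 x| <= D * k2 x := le_trans (norm_esin _ _ _ _ _) (eD x).
have bH1 x : `|H1 x| <= (D * (Cr + Cs)) * k2 x.
  rewrite mulrAC mulrDr; apply: (le_trans (ler_normD _ _)); rewrite (normrM (ecos z0 x)) (normrM (esin z0 x)).
  by apply: lerD; apply: ler_pM.
have bH2 x : `|H2 x| <= (D * (Cs + Cr)) * k2 x.
  rewrite mulrAC mulrDr; apply: (le_trans (ler_normD _ _)); rewrite normrN (normrM (ecos z0 x)) (normrM (esin z0 x)).
  by apply: lerD; apply: ler_pM.
have key p : pairing r s (fpoint y p d) =
    \int[leb2]_x (H1 x * cos (p.1 * x.1 + p.2 * x.2) + H2 x * sin (p.1 * x.1 + p.2 * x.2)).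
  have Ip := @Rintegrable_packet r s (fpoint y p d) (Cr + Cs) cr cs
    (fun x => le_trans (br x) (_ : Cr <= Cr + Cs)) (fun x => le_trans (bs x) (_ : Cs <= Cr + Cs)).
  have Cr0 := le_trans (normr_ge0 _) (br (0, 0)); have Cs0 := le_trans (normr_ge0 _) (bs (0, 0)).
  have {}Ip : Rintegrable leb2 (packet r s (fpoint y p d) : plane -> R).
    by apply: Ip; rewrite ?lerDl ?lerDr.
  have E x : packet r s (fpoint y p d) (x.1 + y.1, x.2 + y.2) =
      H1 x * cos (p.1 * x.1 + p.2 * x.2) + H2 x * sin (p.1 * x.1 + p.2 * x.2).
    rewrite /packet /H1 /H2 /ecos /esin.
    have -> : envelope (fpoint y p d) (x.1 + y.1, x.2 + y.2) = envelope z0 x.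
      by rewrite /envelope /=; congr expR; ring.
    have -> : psi gam (fpoint y p d) (x.1 + y.1, x.2 + y.2) = psi gam z0 x + (p.1 * x.1 + p.2 * x.2).
      by rewrite /psi /=; field.
    by rewrite cosD sinD; ring.
  rewrite -[LHS](@Rintegral_shift2 _ y.1 y.2 (packet r s (fpoint y p d))).
  - by apply: eq_Rintegral => x _; exact: E.
  - exact: measurable_packet.
  - apply: (@Rintegrable_le _ plane R _ _ (fun x => (D * (Cr + Cs) + D * (Cs + Cr)) * k2 x)).
    + by apply: continuous_measurable_plane; apply: sh; apply: contD; apply: contM => //;
        [exact: continuous_ecos|exact: continuous_esin].
    + move=> x; rewrite E [leRHS]mulrDl; apply: (le_trans (ler_normD _ _)).
      rewrite (normrM (H1 x)) (normrM (H2 x)); apply: lerD.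
        by apply: le_trans (bH1 x); rewrite ler_piMr ?cos_max.
      by apply: le_trans (bH2 x); rewrite ler_piMr ?sin_max.
    + exact: (RintegrableZ _ (@Rintegrable_k2 R)).
have bF p : `|\int[leb2]_x (H1 x * cos (p.1 * x.1 + p.2 * x.2) + H2 x * sin (p.1 * x.1 + p.2 * x.2))|
    <= M * (2 / mu0) * k2 p.
  rewrite -key; apply: (le_trans (pairing_k2 HM _)).
  by rewrite -surjective_pairing.
split.
  under eq_fun do rewrite key.
  exact: (Rintegrable_fourier cH1 cH2 bH1 bH2 bF).
transitivity (\int[leb2]_p \int[leb2]_x (H1 x * cos (p.1 * x.1 + p.2 * x.2) + H2 x * sin (p.1 * x.1 + p.2 * x.2))).
  by apply: eq_Rintegral => p _; exact: key.
rewrite (fourier_inversion cH1 cH2 bH1 bH2 bF).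
rewrite /H1 /ecos /esin.
have -> : envelope z0 (0, 0) = 1.
  by rewrite /envelope /= subrr expr0n/= !mulr0 addr0 oppr0 expR0.
have -> : psi gam z0 (0, 0) = d by rewrite /psi /=; field.
by rewrite /= !add0r !mul1r -surjective_pairing; ring.
Qed.

Definition inv_const : R := (2 / mu0) * (\int[leb2]_(p in [set: plane]) k2 p) / (gauss_mass ^+ 2) ^+ 2.

(** The point is that the sup bound depends on the functions only through [M]. The phases 0 and pi /
    2 give [r] and [s]. *)
Lemma bound_of_pairing r s M : continuous r -> continuous s ->
  (exists C, forall x, `|r x| <= C) -> (exists C, forall x, `|s x| <= C) ->
  (forall z, (1 + energy z) ^+ 2 * `|pairing r s z| <= M) ->
  forall x, `|r x| <= inv_const * M /\ `|s x| <= inv_const * M.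
Proof.
move=> cr cs br bs HM x.
have g0 : 0 < (gauss_mass ^+ 2) ^+ 2 :> R by rewrite !exprn_gt0 ?gauss_mass_gt0.
have H d : `|r x * cos d + s x * sin d| <= inv_const * M.
  have [If E] := pairing_inversion x d cr cs br bs HM.
  rewrite -(ler_pM2l g0) -[X in X * `|_|](gtr0_norm g0) -normrM -E.
  rewrite (_ : _ * (inv_const * M) = \int[leb2]_p ((M * (2 / mu0)) * k2 p)); last first.
    rewrite RintegralZl; [|exact: measurableT|exact: Rintegrable_k2].
    by rewrite /inv_const; field; rewrite !gt_eqF ?gauss_mass_gt0 ?mu0_gt0.
  apply: (normr_Rintegral_le If (RintegrableZ _ (@Rintegrable_k2 R))) => p.
  by apply: (le_trans (pairing_k2 HM _)); rewrite /= -surjective_pairing.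
split.
  by have := H 0; rewrite cos0 sin0 mulr1 mulr0 addr0.
by have := H (pi / 2); rewrite cos_pihalf sin_pihalf mulr1 mulr0 add0r.
Qed.

End Conservation.

(** * The explicit classical flow *)

Section Flow.
Context {R : realType}.
Notation point := (@point R).
Implicit Types z : point.

Variables omega theta a b l1 l2 : R.
Hypotheses (om0 : 0 < omega) (l10 : 0 < l1) (l20 : 0 < l2).
Hypotheses (Hl1 : l1 ^+ 2 = omega * (omega + theta)) (Hl2 : l2 ^+ 2 = omega * (omega - theta)).

Definition mode (A B l t : R) : R := A * cos (l * t) + B / l * sin (l * t).
Definition dmode (A B l t : R) : R := B * cos (l * t) - A * l * sin (l * t).

Lemma der_mode A B l t : 0 < l -> der (fun t => mode A B l t) t (dmode A B l t).
Proof. by move=> l0; rewrite /mode /dmode; der_auto; rewrite /=; field; rewrite gt_eqF. Qed.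

Lemma der_dmode A B l t : 0 < l -> der (fun t => dmode A B l t) t (- (l ^+ 2 * mode A B l t)).
Proof. by move=> l0; rewrite /mode /dmode; der_auto; rewrite /=; field; rewrite gt_eqF. Qed.

(** Normal coordinates: [nQ1] and [nP1] are the position and velocity of the oscillator of frequency
    [l1], and [nQ2], [nP2] those of frequency [l2]. *)
Definition nQ1 z := (pp1 z / omega + pq2 z) / 2.
Definition nQ2 z := (pp1 z / omega - pq2 z) / 2.
Definition nP1 z := (pp2 z - omega * pq1 z) / 2.
Definition nP2 z := (- pp2 z - omega * pq1 z) / 2.

(* The classical flow, decoupled into two oscillators of frequencies [l1], [l2]. *)
Definition flow z t : point := Point
  (- (dmode (nQ1 z) (nP1 z) l1 t + dmode (nQ2 z) (nP2 z) l2 t) / omega)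
  (mode (nQ1 z) (nP1 z) l1 t - mode (nQ2 z) (nP2 z) l2 t)
  (omega * (mode (nQ1 z) (nP1 z) l1 t + mode (nQ2 z) (nP2 z) l2 t))
  (dmode (nQ1 z) (nP1 z) l1 t - dmode (nQ2 z) (nP2 z) l2 t)
  (pdl z - (a + b) / 2 * t).

Lemma flow0 z : flow z 0 = z.
Proof.
have o : omega != 0 by rewrite gt_eqF.
case: z => q1 q2 p1 p2 d; rewrite /flow /mode /dmode !mulr0 cos0 sin0 !mulr1 !mulr0 !addr0 !subr0.
by rewrite /nQ1 /nQ2 /nP1 /nP2 /=; congr Point; field.
Qed.

Lemma traj_flow z : traj omega theta a b (flow z).
Proof.
move=> t; have o : omega != 0 by rewrite gt_eqF.
have m1 := der_mode (nQ1 z) (nP1 z) t l10; have m2 := der_mode (nQ2 z) (nP2 z) t l20.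
have d1 := der_dmode (nQ1 z) (nP1 z) t l10; have d2 := der_dmode (nQ2 z) (nP2 z) t l20.
rewrite Hl1 in d1; rewrite Hl2 in d2.
split; rewrite /flow /vq1 /vq2 /vp1 /vp2 /=; der_auto; rewrite /=; by field.
Qed.

Lemma traj_through z t : exists2 c, traj omega theta a b c & c t = z.
Proof.
exists (fun u => flow z (u + - t)); first exact: traj_shift (traj_flow z).
by rewrite subrr flow0.
Qed.

End Flow.

(** * Conservation along the solution *)

Section ConservationLaw.
Context {R : realType}.
Notation plane := (measurableTypeR R * measurableTypeR R)%type.
Notation point := (@point R).
Implicit Types (x : R * R) (z : point) (c : R -> point).

Variables omega theta a b gam l1 l2 : R.
Hypotheses (a0 : 0 < a) (b0 : 0 < b) (om0 : 0 < omega) (thom : theta ^+ 2 < omega ^+ 2).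
Hypotheses (Ha : a ^+ 2 = omega ^+ 2 + gam ^+ 2)
  (Hb : b ^+ 2 = omega ^+ 2 + gam ^+ 2 - 2 * theta * gam)
  (Hg : gam * (a + b) = theta * a).
Hypotheses (l10 : 0 < l1) (l20 : 0 < l2).
Hypotheses (Hl1 : l1 ^+ 2 = omega * (omega + theta)) (Hl2 : l2 ^+ 2 = omega * (omega - theta)).

Notation packet := (packet a b gam).
Notation dpacket := (dpacket omega theta a b gam).
Notation pairing := (pairing a b gam).
Notation energy := (energy omega theta).
Notation traj := (traj omega theta a b).
Notation schr := (schr omega theta).
Notation inv_const := (inv_const omega theta).

Variables rt st dr ds : R -> R * R -> R.
Hypotheses (Srt : forall t, Sw (rt t)) (Sst : forall t, Sw (st t)).
Hypothesis hL : forall t, schr (rt t) (st t) (dr t) (ds t).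
Hypothesis hdr : forall t x, der (fun t => rt t x) t (dr t x).
Hypothesis hds : forall t x, der (fun t => st t x) t (ds t x).

Let pg t z := pairing (rt t) (st t) z.

(** [decays] and [lips] involve only pairings and the conserved energy, so [same t u] transports
    them between times without changing [M]. *)
Let decays t M := forall z, (1 + energy z) ^+ 2 * `|pg t z| <= M.
Let lips t M := forall c u e, traj c ->
  (1 + energy (c u)) ^+ 2 * `|pg t (c (u + e)) - pg t (c u)| <= M * `|e|.
Let same t u := forall c, traj c -> pg t (c t) = pg u (c u).

Let bounded_Sw (f : R * R -> R) : Sw f -> exists C, forall x, `|f x| <= C := @Sw_bounded R f.

Let decays_bound t M : decays t M ->
  forall x, `|rt t x| <= inv_const * M /\ `|st t x| <= inv_const * M.
Proof.
move=> h x.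
exact: (bound_of_pairing a0 b0 om0 thom (Sw_continuous (Srt t)) (Sw_continuous (Sst t))
  (bounded_Sw (Srt t)) (bounded_Sw (Sst t)) h x).
Qed.

(** At a fixed time, the derivative of the pairing along a trajectory is minus the pairing with
    [dr], [ds], so the Lipschitz bound is a decay bound for the latter. *)
Let lips_bound t M : lips t M ->
  forall x, `|dr t x| <= inv_const * M /\ `|ds t x| <= inv_const * M.
Proof.
move=> h x; have [Sdr Sds] := schr_Sw (Srt t) (Sst t) (hL t).
apply: (bound_of_pairing a0 b0 om0 thom (Sw_continuous Sdr) (Sw_continuous Sds)
  (bounded_Sw Sdr) (bounded_Sw Sds)) => z.
have [c tc cz] := traj_through a b om0 l10 l20 Hl1 Hl2 z 0.
have w0 : 0 < (1 + energy z) ^+ 2 by rewrite exprn_gt0// ltr_wpDr ?(energy_ge0 thom).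
have D := der_pairing_fixed a0 b0 om0 thom Ha Hb Hg 0 (Srt t) (Sst t) (hL t) tc.
rewrite mulrC -ler_pdivlMr// -normrN -cz.
apply: (der_le_lip D) => e; rewrite mulrAC ler_pdivlMr ?cz//.
by have := h c 0 e tc; rewrite cz mulrC.
Qed.

Let same_decays t u M : same t u -> decays u M -> decays t M.
Proof.
move=> tu hu z; have [c tc cz] := traj_through a b om0 l10 l20 Hl1 Hl2 z t.
by rewrite -cz tu// (traj_energy t u tc).
Qed.

Let same_lips t u M : same t u -> lips u M -> lips t M.
Proof.
move=> tu hu c v e tc.
have tc1 := traj_shift (v - t) tc; have tc2 := traj_shift (v + e - t) tc.
have := tu _ tc1; have := tu _ tc2.
rewrite (_ : t + (v - t) = v); last by ring.
rewrite (_ : t + (v + e - t) = v + e); last by ring.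
move=> -> ->; have := hu _ u e tc1.
rewrite (_ : u + e + (v - t) = u + (v + e - t)); last by ring.
by rewrite (traj_energy (u + (v - t)) v tc).
Qed.

Let pairing_cvg c (tn : nat -> R) t B M : 0 <= B -> (forall u, inbox B (c u)) ->
  (forall x, packet (rt (tn n)) (st (tn n)) (c (tn n)) x @[n --> \oo] --> packet (rt t) (st t) (c t) x) ->
  (forall n x, `|rt (tn n) x| <= M /\ `|st (tn n) x| <= M) ->
  pg (tn n) (c (tn n)) @[n --> \oo] --> pg t (c t).
Proof.
move=> B0 cB cv bd; have [D D0 HD] := packet_box_le omega theta gam a0 b0 B0.
apply: (@Rintegral_dominated _ plane R leb2 (fun n x => packet (rt (tn n)) (st (tn n)) (c (tn n)) x)
  (packet (rt t) (st t) (c t)) (fun x => (D * (M + M)) * k2 x)).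
- by move=> n; apply: measurable_packet; exact: Sw_continuous.
- exact: cv.
- move=> n x; have [h1 h2] := bd n x.
  apply: (le_trans (HD _ _ _ _ (cB _)).1); rewrite mulrAC ler_wpM2r ?(ltW (k2_gt0 _))//.
  by rewrite ler_wpM2l//; apply: lerD.
- exact: (RintegrableZ _ (@Rintegrable_k2 R)).
Qed.

Let pairing_cvg_traj c (tn : nat -> R) t M : traj c -> tn n @[n --> \oo] --> t ->
  (forall n x, `|rt (tn n) x| <= M /\ `|st (tn n) x| <= M) ->
  pg (tn n) (c (tn n)) @[n --> \oo] --> pg t (c t).
Proof.
move=> tc tnt bd; have [B B0 HB] := energy_inbox om0 thom (energy (c t)).
apply: (pairing_cvg B0 _ _ bd).
  by move=> u; apply: HB; rewrite (traj_energy u t tc).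
move=> x; have D := @der_packet R omega theta a b gam rt st _ _ c t x tc (hdr t x) (hds t x).
exact: (continuous_cvg _ (der_continuous D) tnt).
Qed.

Let pairing_cvg_cst z (tn : nat -> R) t M : tn n @[n --> \oo] --> t ->
  (forall n x, `|rt (tn n) x| <= M /\ `|st (tn n) x| <= M) ->
  pg (tn n) z @[n --> \oo] --> pg t z.
Proof.
move=> tnt bd; have [B B0 HB] := energy_inbox om0 thom (energy z).
apply: (@pairing_cvg (fun=> z) tn t B M B0 _ _ bd).
  by move=> u; exact: HB.
move=> x; pose f u := ecos a b gam z x * rt u x + esin a b gam z x * st u x.
have D : der f t (ecos a b gam z x * dr t x + esin a b gam z x * ds t x).
  by have h1 := hdr t x; have h2 := hds t x; rewrite /f; der_auto; rewrite /=; ring.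
exact: (continuous_cvg _ (der_continuous D) tnt).
Qed.

(** The last two conditions are those the flow transports; the first dominates the convergence of
    pairings and so makes the set of such times closed. *)
Let XM M t := [/\ forall x, `|rt t x| <= M /\ `|st t x| <= M, decays t M & lips t M].

Let XM_cover t : exists n : nat, XM n%:R t.
Proof.
have [C1 h1] := Sw_bounded (Srt t); have [C2 h2] := Sw_bounded (Sst t).
have [C3 h3] := pairing_decay gam a0 b0 om0 thom (Srt t) (Sst t).
have [C4 h4] := pairing_lip a0 b0 om0 thom Ha Hb Hg (Srt t) (Sst t) (hL t).
pose C := `|C1| + `|C2| + `|C3| + `|C4|.
have C0 : 0 <= C by rewrite /C; nneg.
have n1 := normr_ge0 C1; have n2 := normr_ge0 C2; have n3 := normr_ge0 C3; have n4 := normr_ge0 C4.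
have l1' := ler_norm C1; have l2' := ler_norm C2; have l3' := ler_norm C3; have l4' := ler_norm C4.
have hC : C <= (Num.bound C)%:R by apply/ltW/archi_boundP.
rewrite {1}/C in hC; exists (Num.bound C); split.
- by move=> x; split; [apply: (le_trans (h1 x))|apply: (le_trans (h2 x))]; lra.
- by move=> z; apply: (le_trans (h3 z)); lra.
- by move=> c u e tc; apply: (le_trans (h4 c u e tc)); rewrite ler_wpM2r//; lra.
Qed.

Let cvg_norm_le (u : nat -> R) l W M : u n @[n --> \oo] --> l ->
  (forall n, W * `|u n| <= M) -> W * `|l| <= M.
Proof.
move=> ul h.
have L : W * `|u n| @[n --> \oo] --> W * `|l| by apply: cvgMr; exact: cvg_norm.
by apply: (ler_cvg_to L (cvg_cst M)); exact: nearW.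
Qed.

Let XM_closed M t : ~ XM M t -> exists2 e, 0 < e & forall u, `|u - t| < e -> ~ XM M u.
Proof.
move=> nX; apply: contrapT => H; apply: nX.
have /choice[tn Htn] : forall n : nat, exists u, `|u - t| < n.+1%:R^-1 /\ XM M u.
  move=> n; apply: contrapT => H'; apply: H; exists n.+1%:R^-1; first by rewrite invr_gt0.
  by move=> u ut Xu; apply: H'; exists u.
have tnt : tn n @[n --> \oo] --> t.
  apply/cvgrPdist_lt => e e0.
  have /cvgrPdist_lt/(_ e e0) := @cvg_harmonic R; apply: filterS => n.
  rewrite sub0r normrN /= ger0_norm ?invr_ge0// => h; rewrite distrC.
  exact: lt_trans (Htn n).1 h.
have bd n x : `|rt (tn n) x| <= M /\ `|st (tn n) x| <= M by have [_ [h _ _]] := Htn n.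
split.
- move=> x; split; rewrite -[leLHS]mul1r.
    have L : rt (tn n) x @[n --> \oo] --> rt t x.
      exact: (continuous_cvg _ (der_continuous (hdr t x)) tnt).
    by apply: (cvg_norm_le L) => n; rewrite mul1r; exact: (bd n x).1.
  have L : st (tn n) x @[n --> \oo] --> st t x.
    exact: (continuous_cvg _ (der_continuous (hds t x)) tnt).
  by apply: (cvg_norm_le L) => n; rewrite mul1r; exact: (bd n x).2.
- move=> z; have L : pg (tn n) z @[n --> \oo] --> pg t z by exact: pairing_cvg_cst tnt bd.
  apply: (cvg_norm_le L) => n.
  by have [_ [_ h _]] := Htn n.
- move=> c u e tc.
  have L : pg (tn n) (c (u + e)) - pg (tn n) (c u) @[n --> \oo] --> pg t (c (u + e)) - pg t (c u).
    by apply: cvgB; exact: pairing_cvg_cst tnt bd.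
  by apply: (cvg_norm_le L) => n; have [_ [_ _ h]] := Htn n; exact: h.
Qed.

Let good t := exists2 e, 0 < e & forall c, traj c ->
  forall u v, `|u - t| < e -> `|v - t| < e -> pg u (c u) = pg v (c v).

(* Every [t] near [t0] is joined to a bad time by an interval on which the
   pairings are constant. *)
Let reach_bad t0 e0 t : ~ good t0 -> `|t - t0| < e0 ->
  exists u, [/\ ~ good u, `|u - t0| < e0 & same t u].
Proof.
move=> bad0 tt0; apply: contrapT => H.
pose pt w := t + w * (t0 - t).
pose P w := forall c, traj c -> pg (pt w) (c (pt w)) = pg t (c t).
suff P1 : P 1.
  apply: H; exists t0; split => //; first by rewrite subrr normr0 (le_lt_trans _ tt0).
  by move=> c tc; have := P1 c tc; rewrite /pt mul1r addrC subrK.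
apply: continuous_induction01.
- by move=> c tc; rewrite /pt mul0r addr0.
(* Limits from the left: constancy before [w] transports the decay constant of time [t], and the
   resulting sup bound dominates the convergence. *)
- move=> w w0 w1 Pw c tc.
  have [M HM] := pairing_decay gam a0 b0 om0 thom (Srt t) (Sst t).
  pose vn (n : nat) := w - w * n.+1%:R^-1.
  have vn0 n : 0 <= vn n.
    by rewrite /vn subr_ge0 ler_piMr ?(ltW w0)// invf_le1// ler1n.
  have vnw n : vn n < w by rewrite /vn ltrBlDr ltrDl mulr_gt0// invr_gt0.
  have tnt : pt (vn n) @[n --> \oo] --> pt w.
    apply: cvgD; first exact: cvg_cst.
    apply: cvgMl; rewrite -[X in _ --> X]subr0; apply: cvgB; first exact: cvg_cst.
    by rewrite -[X in _ --> X](mulr0 w); apply: cvgMr; exact: cvg_harmonic.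
  have bd n x : `|rt (pt (vn n)) x| <= inv_const * M /\ `|st (pt (vn n)) x| <= inv_const * M.
    apply: decays_bound; apply: (@same_decays _ t) HM => c' tc'.
    exact: Pw tc'.
  have L := pairing_cvg_traj tc tnt bd.
  have L2 : pg (pt (vn n)) (c (pt (vn n))) @[n --> \oo] --> pg t (c t).
    under eq_fun => n do rewrite (Pw (vn n) (vn0 n) (vnw n) c tc).
    exact: cvg_cst.
  exact: (cvg_unique _ L L2).
(* Extension to the right: were [pt w] bad, it would be the bad time sought; being good, it prolongs
   the constancy. *)
- move=> w w0 w1 Pw.
  have [e e1 He] : good (pt w).
    apply: contrapT => bw; apply: H; exists (pt w); split => //.
      rewrite (_ : pt w - t0 = (1 - w) * (t - t0)); last by rewrite /pt; ring.
      rewrite normrM ger0_norm ?subr_ge0 ?(ltW w1)//; apply: le_lt_trans tt0.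
      by rewrite ler_piMl// lerBlDr lerDl.
    by move=> c tc; rewrite (Pw w w0 (lexx _)).
  have d0 : 0 < `|t0 - t| + 1 by rewrite ltr_wpDl.
  exists (e / (`|t0 - t| + 1)); first by rewrite divr_gt0.
  move=> v wv ve c tc; rewrite -(Pw w w0 (lexx _) c tc).
  apply: (He c tc); last by rewrite subrr normr0.
  rewrite (_ : pt v - pt w = (v - w) * (t0 - t)); last by rewrite /pt; ring.
  rewrite normrM gtr0_norm ?subr_gt0//.
  have h : v - w < e / (`|t0 - t| + 1) by rewrite ltrBlDl.
  move: h; rewrite ltr_pdivlMr// => h; apply: le_lt_trans h.
  by rewrite ler_wpM2l ?lerDl// subr_ge0 ltW.
Qed.

(** The category argument bounds the bad times of some interval by one constant; [reach_bad] spreads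
    the bound to all its times. Differentiation under the integral is then justified there, and the
    bad time at its centre is good after all. *)
Let all_good t : good t.
Proof.
apply: contrapT => bad.
have [n [t0 [e0 [bad0 e00 Hn]]]] := @baire_ball R (fun u => ~ good u) (fun n => XM n%:R) t bad
  (fun n => @XM_closed n%:R) XM_cover.
apply: (bad0); exists e0 => //.
pose C := inv_const * n%:R.
have bd u x : `|u - t0| < e0 -> [/\ `|rt u x| <= C, `|st u x| <= C, `|dr u x| <= C & `|ds u x| <= C].
  move=> ut; have [v [bv vt uv]] := reach_bad bad0 ut.
  have [_ h2 h3] := Hn v bv vt.
  have [r1 r2] := decays_bound (same_decays uv h2) x.
  by have [r3 r4] := lips_bound (same_lips uv h3) x.
move=> c tc; apply: (@der0_on_cst R (fun u => pg u (c u))) => u ut.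
have d0 : 0 < e0 - `|u - t0| by rewrite subr_gt0.
have near_u v : `|v - u| < e0 - `|u - t0| -> `|v - t0| < e0.
  move=> h; have := ler_distD u v t0; lra.
have D := @der_pairing R omega theta a b gam a0 b0 om0 thom rt st dr ds c u _ C d0 tc
  (fun t => Sw_continuous (Srt t)) (fun t => Sw_continuous (Sst t))
  (fun t x _ => hdr t x) (fun t x _ => hds t x) (fun v x h => bd v x (near_u v h)).
apply: (der_eq D).
by have [] := packet_conservation a0 b0 Ha Hb Hg (c u) (Srt u) (Sst u) (hL u).
Qed.

Theorem pairing_conserved c t u : traj c ->
  pairing (rt t) (st t) (c t) = pairing (rt u) (st u) (c u).
Proof.
move=> tc; apply: (@is_derive_0_is_cst _ (fun t => pg t (c t))) => v.
have [e e0 He] := all_good v.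
apply: (@der_near _ (fun=> pg v (c v)) _ _ _ e e0 _ (der_cst _ _)) => w wv.
by apply: (He c tc) => //; rewrite subrr normr0.
Qed.

End ConservationLaw.

(** * The propagator and the Hardy argument *)

Section MeasurableExpressions.
Context {R : realType} {d : measure_display} {X : measurableType d}.
Implicit Types f g : X -> R.

Lemma measN f : measurable_fun setT f -> measurable_fun setT (fun x => - f x).
Proof. by move=> mf; exact: measurableT_comp. Qed.

Lemma meas_cont (h : R -> R) f : continuous h -> measurable_fun setT f -> measurable_fun setT (fun x => h (f x)).
Proof. by move=> ch mf; exact: (measurableT_comp (continuous_measurable_fun ch) mf). Qed.

End MeasurableExpressions.

Ltac meas_tac :=
  lazymatch goal with
  | |- measurable_fun _ (fun _ => ?c) => exact: measurable_cst
  | |- measurable_fun _ (fun t => @?f t + @?g t) => refine (@measurable_funD _ _ _ _ f g _ _); meas_tac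
  | |- measurable_fun _ (fun t => - @?f t) => refine (@measN _ _ _ f _); meas_tac
  | |- measurable_fun _ (fun t => @?f t * @?g t) => refine (@measurable_funM _ _ _ _ f g _ _); meas_tac
  | |- measurable_fun _ (fun t => @?f t ^+ ?n) => refine (@measurable_funX _ _ _ _ f n _); meas_tac
  | |- measurable_fun _ (fun t => expR (@?f t)) => refine (@meas_cont _ _ _ expR f (@continuous_expR _) _); meas_tac
  | |- measurable_fun _ (fun t => cos (@?f t)) => refine (@meas_cont _ _ _ cos f (@continuous_cos _) _); meas_tac
  | |- measurable_fun _ (fun t => sin (@?f t)) => refine (@meas_cont _ _ _ sin f (@continuous_sin _) _); meas_tac
  | |- _ => try assumption
  end.

(** * Integral kernel of the inverse propagator *)

Section Kernel.
Context {R : realType}.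
Notation plane := (measurableTypeR R * measurableTypeR R)%type.
Notation point := (@point R).
Implicit Types x y p xi : R * R.

Variables omega theta a b gam e f g b11 b12 b22 E1 : R.
Hypotheses (a0 : 0 < a) (b0 : 0 < b) (om0 : 0 < omega) (thom : theta ^+ 2 < omega ^+ 2).
Let D := b11 * b22 + b12 ^+ 2.
(** [D] is the determinant of the position-from-momentum block; [R1] and [R2] are the symplectic
    relations for these blocks. *)
Hypotheses (D0 : D != 0) (R1 : e ^+ 2 + f * g + omega ^+ 2 * D = 1)
  (R2 : b11 * g + b22 * f + 2 * (b12 * e) = 0).

(* The phase space point reached backwards in time from [(y, p)], through the
   transpose of the symplectic matrix with blocks [A = (e, f; -g, e)],
   [B = (b11, -b12; b12, b22)]. *)
Definition backward (y p : R * R) (d : R) : point := Point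
  (e * y.1 - f * y.2 - b11 * p.1 - b12 * p.2)
  (g * y.1 + e * y.2 + b12 * p.1 - b22 * p.2)
  (e * p.1 - g * p.2 + omega ^+ 2 * (b22 * y.1 + b12 * y.2))
  (f * p.1 + e * p.2 + omega ^+ 2 * (b11 * y.2 - b12 * y.1))
  (d - (p.1 * y.1 + p.2 * y.2) / 2 + E1).

Definition Bmat xi : R * R := (b11 * xi.1 - b12 * xi.2, b12 * xi.1 + b22 * xi.2).

(** (P1, P2) is the momentum p for which [backward y p] is centred at [x]; it exists because [D] is
    nonzero. *)
Let P1 y x := (b22 * (e * y.1 - f * y.2 - x.1) - b12 * (g * y.1 + e * y.2 - x.2)) / D.
Let P2 y x := (b12 * (e * y.1 - f * y.2 - x.1) + b11 * (g * y.1 + e * y.2 - x.2)) / D.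
Let rho1 p := b11 * p.1 + b12 * p.2.
Let rho2 p := - (b12 * p.1) + b22 * p.2.
Let env p := expR (- (a / 2 * rho1 p ^+ 2 + b / 2 * rho2 p ^+ 2)).
Let chi p := - gam * rho1 p * rho2 p
  + ((e * p.1 - g * p.2) * rho1 p + (f * p.1 + e * p.2) * rho2 p) / 2 + E1.
Let nn x := ((b22 * (e * x.1 + f * x.2) + b12 * (- g * x.1 + e * x.2)) * x.1
  + (- b12 * (e * x.1 + f * x.2) + b11 * (- g * x.1 + e * x.2)) * x.2) / (2 * D).

Definition Bphase xi : R := ((e * xi.1 + g * xi.2) * (b11 * xi.1 - b12 * xi.2)
  + (- f * xi.1 + e * xi.2) * (b12 * xi.1 + b22 * xi.2)) / 2.

Let envelope_backward y d x p :
  envelope a b (backward y (p.1 + P1 y x, p.2 + P2 y x) d) x = env p.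
Proof. by rewrite /envelope /env /rho1 /rho2 /P1 /P2 /=; congr expR; rewrite /D; field. Qed.

(** Taking y = B xi turns the part of the phase that is bilinear in y and x into xi.x; the other
    cross terms cancel by [R1] and [R2]. *)
Let psi_backward xi d x p :
  psi gam (backward (Bmat xi) (p.1 + P1 (Bmat xi) x, p.2 + P2 (Bmat xi) x) d) x =
  (xi.1 * x.1 + xi.2 * x.2 + (d - Bphase xi) - nn x) + chi p.
Proof.
apply/eqP; rewrite -subr_eq0; apply/eqP.
pose N1 := (b22 * (e * x.1 + f * x.2) + b12 * (- g * x.1 + e * x.2)) / D.
pose N2 := (- b12 * (e * x.1 + f * x.2) + b11 * (- g * x.1 + e * x.2)) / D.
pose y := Bmat xi.
transitivity ((e ^+ 2 + f * g + omega ^+ 2 * D - 1) / 2 * (x.1 * xi.1 + x.2 * xi.2 + p.1 * y.1 + p.2 * y.2)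
  + (b11 * g + b22 * f + 2 * (b12 * e)) / 2 *
     (N2 * xi.1 - N1 * xi.2 + (p.2 * P1 y x - p.1 * P2 y x))).
  rewrite /psi /chi /nn /Bphase /rho1 /rho2 /N1 /N2 /y /P1 /P2 /Bmat /= /D; field.
  exact: D0.
by rewrite R1 R2 subrr !mul0r addr0.
Qed.

Let env_gt0 p : 0 < env p. Proof. exact: expR_gt0. Qed.

Let env_le : exists2 C, 0 <= C & forall p, env p <= C * k2 p.
Proof.
pose S := 2 * (b22 ^+ 2 + 2 * b12 ^+ 2 + b11 ^+ 2) / D ^+ 2 + 1.
have S0 : 0 < S by rewrite ltr_wpDl//; nneg.
pose W := 2 / a + 2 / b.
have W0 : 0 < W by rewrite addr_gt0 ?divr_gt0.
pose nu := (S * W)^-1; have nu0 : 0 < nu by rewrite invr_gt0 mulr_gt0.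
have nuV : 0 < nu^-1 by rewrite invr_gt0.
exists ((1 + nu^-1) * (1 + nu^-1)); first by nneg.
move=> p; rewrite /k2 mulrACA.
have g1 := expR_gauss_le_k1 p.1 nu0; have g2 := expR_gauss_le_k1 p.2 nu0.
apply: le_trans (ler_pM (expR_ge0 _) (expR_ge0 _) g1 g2).
rewrite -expRD /env ler_expR -opprD lerN2 -mulrDr /nu ler_pdivrMl ?mulr_gt0//.
have h1 : rho1 p ^+ 2 + rho2 p ^+ 2 <= W * (a / 2 * rho1 p ^+ 2 + b / 2 * rho2 p ^+ 2).
  rewrite -subr_ge0 (_ : _ - _ = a / b * rho1 p ^+ 2 + b / a * rho2 p ^+ 2).
    by nneg.
  by rewrite /W; field; rewrite !gt_eqF.
have h2 : p.1 ^+ 2 + p.2 ^+ 2 <= S * (rho1 p ^+ 2 + rho2 p ^+ 2).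
  have e1 : p.1 = (b22 * rho1 p - b12 * rho2 p) / D by rewrite /rho1 /rho2 /D; field.
  have e2 : p.2 = (b12 * rho1 p + b11 * rho2 p) / D by rewrite /rho1 /rho2 /D; field.
  rewrite e1 e2; move: (rho1 p) (rho2 p) => u v.
  rewrite -subr_ge0 (_ : _ - _ = ((b22 * u + b12 * v) ^+ 2 + (b12 * u - b11 * v) ^+ 2
     + 2 * (b12 ^+ 2 + b11 ^+ 2) * u ^+ 2 + 2 * (b22 ^+ 2 + b12 ^+ 2) * v ^+ 2) / D ^+ 2 + u ^+ 2 + v ^+ 2).
    by nneg.
  by rewrite /S; field.
by apply: (le_trans h2); rewrite -[leRHS]mulrA ler_wpM2l// ltW.
Qed.

Let continuous_env : continuous env.
Proof. by rewrite /env /rho1 /rho2 /=; cont_tac. Qed.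

Let continuous_chi : continuous chi.
Proof. by rewrite /chi /rho1 /rho2 /=; cont_tac. Qed.

Let mass_c := \int[leb2]_p (env p * cos (chi p)).
Let mass_s := \int[leb2]_p (env p * sin (chi p)).

Let integrable_env (h : R -> R) : continuous h -> (forall u, `|h u| <= 1) ->
  Rintegrable leb2 (fun p : plane => env p * h (chi p)).
Proof.
move=> ch h1; have [C C0 HC] := env_le.
apply: (@Rintegrable_le _ plane R _ _ (fun p => C * k2 p)).
- by apply: continuous_measurable_plane; apply: contM => //; exact: cont_comp.
- move=> p; rewrite normrM (gtr0_norm (env_gt0 p)); apply: le_trans (HC p).
  by rewrite ler_piMr// ltW.
- exact: (RintegrableZ _ (@Rintegrable_k2 R)).
Qed.

Variables r0 s0 : R * R -> R.
Hypotheses (Sr : Sw r0) (Ss : Sw s0).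

(** V1 + i V2 is (mass_c - i mass_s) (r0 + i s0) exp (i nn): a constant and a unimodular factor, so
    the decay of r0 + i s0 is inherited. *)
Let W1 x := mass_c * r0 x + mass_s * s0 x.
Let W2 x := mass_c * s0 x - mass_s * r0 x.
Let V1 x := W1 x * cos (nn x) - W2 x * sin (nn x).
Let V2 x := W1 x * sin (nn x) + W2 x * cos (nn x).

Let Sw_affine (h : R * R -> R) c1 c2 c3 : Sw h -> Sw (fun x => (c1 * x.1 + c2 * x.2 + c3) * h x).
Proof.
move=> Sh; have := SwD (Sw_lin c1 c2 (Sw_x1 Sh) (Sw_x2 Sh)) (SwZ c3 Sh).
by congr Sw; apply/funext => x; ring.
Qed.

Let Sw_P1 (h : R * R -> R) y : Sw h -> Sw (fun x => P1 y x * h x).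
Proof.
move=> Sh; have := Sw_affine (- b22 / D) (b12 / D)
  ((b22 * (e * y.1 - f * y.2) - b12 * (g * y.1 + e * y.2)) / D) Sh.
by congr Sw; apply/funext => x; rewrite /P1; field.
Qed.

Let Sw_P2 (h : R * R -> R) y : Sw h -> Sw (fun x => P2 y x * h x).
Proof.
move=> Sh; have := Sw_affine (- b12 / D) (- b11 / D)
  ((b12 * (e * y.1 - f * y.2) + b11 * (g * y.1 + e * y.2)) / D) Sh.
by congr Sw; apply/funext => x; rewrite /P2; field.
Qed.

Let weighted_bound (h : R * R -> R) y : Sw h -> exists2 C, 0 <= C & forall x,
  (1 + P1 y x ^+ 2) * (1 + P2 y x ^+ 2) * `|h x| <= C * k2 x.
Proof.
move=> Sh; have S1 := SwD Sh (Sw_P1 y (Sw_P1 y Sh)).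
have [C C0 HC] := Sw_le_k2 (SwD S1 (Sw_P2 y (Sw_P2 y S1))).
exists C => // x; have := HC x.
rewrite (_ : h x + _ + _ = (1 + P1 y x ^+ 2) * (1 + P2 y x ^+ 2) * h x); last by ring.
rewrite normrM ger0_norm// mulr_ge0//; exact/ltW/one_add_sqr_gt0.
Qed.

(** The Gaussian in [p] is centred at an affine function of [x]. Recentring it by Peetre's
    inequality costs a polynomial in [x], which the Schwartz decay of [r0], [s0] absorbs; a product
    majorant for Fubini results. *)
Let packet_bound y d : exists2 C, 0 <= C & forall p x,
  `|packet a b gam r0 s0 (backward y p d) x| <= k2 p * (C * k2 x).
Proof.
have [Ce Ce0 He] := env_le.
have [Cr Cr0 Hr] := weighted_bound y Sr; have [Cs Cs0 Hs] := weighted_bound y Ss.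
exists (Ce * 4 * (Cr + Cs)); first by nneg.
move=> p x; apply: (le_trans (norm_packet _ _ _ _ _ _ _)).
have E : envelope a b (backward y p d) x = env (p.1 - P1 y x, p.2 - P2 y x).
  rewrite -(envelope_backward y d x) /= !subrK; by case: (p).
rewrite E.
have k2s : k2 (p.1 - P1 y x, p.2 - P2 y x) <= 4 * ((1 + P1 y x ^+ 2) * (1 + P2 y x ^+ 2)) * k2 p.
  rewrite /k2 /=; have := k1_shift p.1 (- P1 y x); have := k1_shift p.2 (- P2 y x).
  rewrite !sqrrN => h2 h1.
  apply: (le_trans (ler_pM (ltW (k1_gt0 _)) (ltW (k1_gt0 _)) h1 h2)).
  by rewrite le_eqVlt; apply/orP; left; apply/eqP; ring.
have n0 : 0 <= `|r0 x| + `|s0 x| by nneg.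
apply: (@le_trans _ _ (Ce * (4 * ((1 + P1 y x ^+ 2) * (1 + P2 y x ^+ 2)) * k2 p) * (`|r0 x| + `|s0 x|))).
  by rewrite ler_wpM2r//; apply: (le_trans (He _)); rewrite ler_wpM2l.
rewrite (_ : Ce * _ * _ = (Ce * 4) * k2 p * ((1 + P1 y x ^+ 2) * (1 + P2 y x ^+ 2) * `|r0 x| +
   (1 + P1 y x ^+ 2) * (1 + P2 y x ^+ 2) * `|s0 x|)); last by ring.
rewrite (_ : k2 p * _ = (Ce * 4) * k2 p * (Cr * k2 x + Cs * k2 x)); last by ring.
have kp := ltW (k2_gt0 p).
by apply: ler_wpM2l; [nneg|exact: lerD].
Qed.

Let measurable_packet_backward y d : measurable_fun [set: (plane * plane)%type]
  (fun z => packet a b gam r0 s0 (backward y z.1 d) z.2).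
Proof.
have m11 : measurable_fun [set: (plane * plane)%type] (fun z => z.1.1 : R).
  exact: (measurableT_comp (@measurable_fst _ _ (measurableTypeR R) (measurableTypeR R)) measurable_fst).
have m12 : measurable_fun [set: (plane * plane)%type] (fun z => z.1.2 : R).
  exact: (measurableT_comp (@measurable_snd _ _ (measurableTypeR R) (measurableTypeR R)) measurable_fst).
have m21 : measurable_fun [set: (plane * plane)%type] (fun z => z.2.1 : R).
  exact: (measurableT_comp (@measurable_fst _ _ (measurableTypeR R) (measurableTypeR R)) measurable_snd).
have m22 : measurable_fun [set: (plane * plane)%type] (fun z => z.2.2 : R).
  exact: (measurableT_comp (@measurable_snd _ _ (measurableTypeR R) (measurableTypeR R)) measurable_snd).
have mr : measurable_fun [set: (plane * plane)%type] (fun z => r0 z.2).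
  exact: (measurableT_comp (Sw_measurable Sr) measurable_snd).
have ms : measurable_fun [set: (plane * plane)%type] (fun z => s0 z.2).
  exact: (measurableT_comp (Sw_measurable Ss) measurable_snd).
by rewrite /packet /ecos /esin /envelope /psi /backward /=; meas_tac.
Qed.

(* Mehler's formula in disguise: for each [x] the integral over [p] is moved to
   its stationary point, where the phase splits into a part in [x] and a part
   in [p]. *)
Lemma kernel_formula xi d :
  \int[leb2]_p pairing a b gam r0 s0 (backward (Bmat xi) p d) =
  \int[leb2]_x (V1 x * cos (xi.1 * x.1 + xi.2 * x.2 + (d - Bphase xi)) +
                V2 x * sin (xi.1 * x.1 + xi.2 * x.2 + (d - Bphase xi))).
Proof.
set y := Bmat xi; have [C C0 HC] := packet_bound y d.
have mF := measurable_packet_backward y d.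
pose F (z : plane * plane) := packet a b gam r0 s0 (backward y z.1 d) z.2.
have FB : \int[leb2]_p (\int[leb2]_x F (p, x)) = \int[leb2]_x (\int[leb2]_p F (p, x)).
  exact: (@Rintegral_Fubini R _ _ plane plane leb2 leb2 F _ _ mF (@Rintegrable_k2 R)
    (RintegrableZ C (@Rintegrable_k2 R)) HC).
apply: (etrans FB); apply: eq_Rintegral => x _.
pose h p := packet a b gam r0 s0 (backward y p d) x.
pose th := xi.1 * x.1 + xi.2 * x.2 + (d - Bphase xi).
have hE p : h (p.1 + P1 y x, p.2 + P2 y x) =
    (cos (th - nn x) * r0 x + sin (th - nn x) * s0 x) * (env p * cos (chi p)) +
    (cos (th - nn x) * s0 x - sin (th - nn x) * r0 x) * (env p * sin (chi p)).
  rewrite /h /packet /ecos /esin envelope_backward psi_backward -/th (cosD (th - nn x)) (sinD (th - nn x)); ring.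
have Ic : Rintegrable leb2 (fun p : plane => env p * cos (chi p)).
  by apply: integrable_env; [exact: continuous_cos|exact: cos_max].
have Is : Rintegrable leb2 (fun p : plane => env p * sin (chi p)).
  by apply: integrable_env; [exact: continuous_sin|exact: sin_max].
set c1 := cos (th - nn x) * r0 x + _ in hE; set c2 := cos (th - nn x) * s0 x - _ in hE.
have Z1 := RintegrableZ c1 Ic; have Z2 := RintegrableZ c2 Is.
have mh : measurable_fun [set: plane] h := measurable_fun_pair1 x mF.
rewrite -[LHS](@Rintegral_shift2 R (P1 y x) (P2 y x) h mh); last first.
  by under eq_fun do rewrite hE; exact: (RintegrableD Z1 Z2).
under eq_Rintegral do rewrite hE.
rewrite RintegralD; [|exact: measurableT|exact: Z1|exact: Z2].
rewrite RintegralZl; [|exact: measurableT|exact: Ic].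
rewrite RintegralZl; [|exact: measurableT|exact: Is].
rewrite -/mass_c -/mass_s /c1 /c2 -/th /V1 /V2 /W1 /W2 cosB sinB; ring.
Qed.

Lemma kernel_exists : exists v1 v2 : R * R -> R, exists C : R,
  [/\ continuous v1, continuous v2,
      forall x, `|v1 x| <= C * (`|r0 x| + `|s0 x|), forall x, `|v2 x| <= C * (`|r0 x| + `|s0 x|) &
      forall xi d, \int[leb2]_p pairing a b gam r0 s0 (backward (Bmat xi) p d) =
      \int[leb2]_x (v1 x * cos (xi.1 * x.1 + xi.2 * x.2 + (d - Bphase xi)) +
                    v2 x * sin (xi.1 * x.1 + xi.2 * x.2 + (d - Bphase xi)))].
Proof.
have cr := Sw_continuous Sr; have cs := Sw_continuous Ss.
have cn : continuous nn by rewrite /nn /=; cont_tac.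
pose M := `|mass_c| + `|mass_s|.
have M0 : 0 <= M by rewrite /M; nneg.
have w1 x : `|W1 x| <= M * (`|r0 x| + `|s0 x|).
  apply: (le_trans (ler_normD _ _)); rewrite !normrM /M.
  have := normr_ge0 mass_c; have := normr_ge0 mass_s; have := normr_ge0 (r0 x); have := normr_ge0 (s0 x).
  nra.
have w2 x : `|W2 x| <= M * (`|r0 x| + `|s0 x|).
  apply: (le_trans (ler_normB _ _)); rewrite !normrM /M.
  have := normr_ge0 mass_c; have := normr_ge0 mass_s; have := normr_ge0 (r0 x); have := normr_ge0 (s0 x).
  nra.
have n1 u x (c : R) : `|u| <= M * (`|r0 x| + `|s0 x|) -> `|c| <= 1 -> `|u * c| <= M * (`|r0 x| + `|s0 x|).
  by move=> hu hc; rewrite normrM; apply: le_trans hu; rewrite ler_piMr.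
exists V1, V2, (2 * M); split.
- by rewrite /V1 /W1 /W2; cont_tac.
- by rewrite /V2 /W1 /W2; cont_tac.
- move=> x; apply: (le_trans (ler_normB _ _)); rewrite -mulrA mulr_natl mulr2n.
  by apply: lerD; apply: n1 => //; [exact: cos_max|exact: sin_max].
- move=> x; apply: (le_trans (ler_normD _ _)); rewrite -mulrA mulr_natl mulr2n.
  by apply: lerD; apply: n1 => //; [exact: sin_max|exact: cos_max].
- exact: kernel_formula.
Qed.

End Kernel.

(** * Hardy's principle along lines of the plane *)

Section HardyPlane.
Context {R : realType}.
Notation plane := (measurableTypeR R * measurableTypeR R)%type.
Implicit Types x xi : R * R.

Variables (v1 v2 : R * R -> R) (C K alpha beta G : R) (Bm : R * R -> R * R) (w : R * R).
Hypotheses (cv1 : continuous v1) (cv2 : continuous v2).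
Hypotheses (alpha0 : 0 < alpha) (beta0 : 0 < beta) (large : 1 < 4 * alpha * (beta * G)).
Let nsq x := x.1 ^+ 2 + x.2 ^+ 2.
Hypotheses (hv1 : forall x, `|v1 x| <= C * expR (- (alpha * nsq x)))
  (hv2 : forall x, `|v2 x| <= C * expR (- (alpha * nsq x))).
Hypotheses (w1 : nsq w = 1) (BwG : nsq (Bm w) = G).
Hypothesis Blin : forall xi z, Bm (xi.1 + z * w.1, xi.2 + z * w.2) =
  ((Bm xi).1 + z * (Bm w).1, (Bm xi).2 + z * (Bm w).2).

Let P xi d := \int[leb2]_x (v1 x * cos (xi.1 * x.1 + xi.2 * x.2 + d) +
                            v2 x * sin (xi.1 * x.1 + xi.2 * x.2 + d)).
Hypothesis hP : forall xi d, `|P xi d| <= K * expR (- (beta * nsq (Bm xi))).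

Let X := 4 * alpha * (beta * G).
(** A loss factor below 1 that both rates can afford: lam^2 X = (1 + X)^2 / (4 X) exceeds 1 because
    X does. *)
Let lam := (1 + X) / (2 * X).
Let X1 : 1 < X := large.
Let X0 : 0 < X := lt_trans ltr01 X1.
Let XX0 : 0 < 2 * X. Proof. exact: mulr_gt0 (ltr0Sn _ _) X0. Qed.
Let lam0 : 0 < lam. Proof. exact: divr_gt0 (addr_gt0 ltr01 X0) XX0. Qed.
Let lam1 : lam < 1.
Proof. by rewrite /lam (ltr_pdivrMr _ _ XX0); move: X1; move: X => u; lra. Qed.
Let lamX : 1 < lam ^+ 2 * X.
Proof.
rewrite /lam; move: X X0 X1 => u u0 u1.
rewrite (_ : _ * u = (1 + u) ^+ 2 / (4 * u)); last by field; rewrite gt_eqF.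
rewrite ltr_pdivlMr ?mulr_gt0// mul1r -subr_gt0 (_ : _ - _ = (u - 1) ^+ 2); last by ring.
by rewrite exprn_gt0// subr_gt0.
Qed.

Let C0 : 0 <= C.
Proof. by have := le_trans (normr_ge0 _) (hv1 (0, 0)); rewrite pmulr_lge0// expR_gt0. Qed.
Let K0 : 0 <= K.
Proof. by have := le_trans (normr_ge0 _) (hP (0, 0) 0); rewrite pmulr_lge0// expR_gt0. Qed.

Let shift xi z : R * R := (xi.1 + z * w.1, xi.2 + z * w.2).
Let G0 : 0 < G. Proof. by move: X0; rewrite /X !pmulr_rgt0//. Qed.

(** On the line xi + z w, the square |B xi + z B w|^2 is at least lam G z^2 minus a constant, by
    completing the square. *)
Let P_decay xi : exists2 K', 0 <= K' & forall z d, `|P (shift xi z) d| <= K' * expR (- (lam * beta * G * z ^+ 2)).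
Proof.
have l0 : 0 < 1 - lam by rewrite subr_gt0.
pose c := lam / (1 - lam) * nsq (Bm xi).
exists (K * expR (beta * c)); first by rewrite mulr_ge0 ?expR_ge0.
move=> z d; apply: (le_trans (hP _ _)); rewrite -[leRHS]mulrA ler_wpM2l// -expRD ler_expR.
rewrite Blin /nsq /=.
rewrite [leRHS](_ : _ = - (beta * (lam * G * z ^+ 2 - c))); last by ring.
rewrite lerN2 ler_wpM2l ?(ltW beta0)// -BwG /c /nsq.
move: (Bm xi).1 (Bm xi).2 (Bm w).1 (Bm w).2 => y1 y2 u1 u2.
rewrite -subr_ge0 (_ : _ - _ = (1 - lam) * ((z * u1 + y1 / (1 - lam)) ^+ 2 + (z * u2 + y2 / (1 - lam)) ^+ 2)).
  by nneg.
by field; rewrite gt_eqF.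
Qed.

Let integrable_gaussian (h : R -> R) (v : R * R -> R) (xi : R * R) d : continuous h -> (forall u, `|h u| <= 1) ->
  continuous v -> (forall x, `|v x| <= C * expR (- (alpha * nsq x))) ->
  Rintegrable leb2 (fun x : plane => v x * h (xi.1 * x.1 + xi.2 * x.2 + d)).
Proof.
move=> ch h1 cv hv.
have c0 := (@expR_gauss_le_k1 R alpha _ alpha0).
apply: (@Rintegrable_le _ plane R _ _ (fun x => (C * ((1 + alpha^-1) * (1 + alpha^-1))) * k2 x)).
- apply: continuous_measurable_plane; apply: contM => //.
  by apply: (@cont_comp _ _ h (fun x : R * R => xi.1 * x.1 + xi.2 * x.2 + d)) => //; cont_tac.
- move=> x; rewrite normrM; apply: (@le_trans _ _ `|v x|); first by rewrite ler_piMr.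
  apply: (le_trans (hv x)); rewrite -mulrA ler_wpM2l// /nsq mulrDr opprD expRD /k2 mulrACA.
  by apply: ler_pM; rewrite ?expR_ge0.
- exact: (RintegrableZ _ (@Rintegrable_k2 R)).
Qed.

(** The odd part in [z] is a sine transform in the variable l = w.x. The surplus (1 - lam) alpha of
    the decay of [v1] and [v2] pays for the factor |l| required by [hardy_sine]. *)
Let P_even xi z d : P (shift xi z) d = P (shift xi (- z)) d.
Proof.
pose l x := w.1 * x.1 + w.2 * x.2.
pose th x := xi.1 * x.1 + xi.2 * x.2 + d.
pose v x := - v1 x * sin (th x) + v2 x * cos (th x).
have cth : continuous th by rewrite /th; cont_tac.
have cl : continuous l by rewrite /l; cont_tac.
have cv : continuous v.
  by apply: contD; apply: contM; [exact: contN|exact: cont_sin|done|exact: cont_cos].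
have hv x : `|v x| <= (2 * C) * expR (- (alpha * nsq x)).
  rewrite -mulrA mulr_natl mulr2n; apply: (le_trans (ler_normD _ _)); apply: lerD.
    by rewrite normrM normrN; apply: le_trans (hv1 x); rewrite ler_piMr ?sin_max.
  by rewrite normrM; apply: le_trans (hv2 x); rewrite ler_piMr ?cos_max.
have eps0 : 0 < (1 - lam) * alpha by rewrite mulr_gt0 ?subr_gt0.
have [A A0 HA] := affine_gauss_le_k1 eps0.
have iv : Rintegrable leb2 (fun x : plane => `|v x| * `|l x| * expR (lam * alpha * l x ^+ 2)).
  apply: (@Rintegrable_le _ plane R _ _ (fun x => (2 * C * (A * A)) * k2 x)).
  - apply: continuous_measurable_plane; apply: contM; last first.
      by apply: cont_expR; apply: contM; [exact: cont_cst|exact: contX].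
    by apply: contM; apply: (@cont_comp _ _ (fun u : R => `|u|)) => //; exact: (@norm_continuous _ R^o).
  - move=> x; rewrite !normrM !normr_id (ger0_norm (expR_ge0 _)).
    have hl2 : l x ^+ 2 <= nsq x.
      rewrite -[leRHS]mul1r -w1 /l /nsq -subr_ge0 (_ : _ - _ = (w.1 * x.2 - w.2 * x.1) ^+ 2) ?sqr_ge0//; ring.
    have wle (u u' : R) : u ^+ 2 + u' ^+ 2 = 1 -> `|u| <= 1.
      by move=> h; rewrite -(@expr_le1 _ 2)// real_normK ?num_real// -h lerDl sqr_ge0.
    have hl : `|l x| <= (1 + `|x.1|) * (1 + `|x.2|).
      apply: (@le_trans _ _ (`|x.1| + `|x.2|)).
        apply: (le_trans (ler_normD _ _)); rewrite !normrM; apply: lerD; rewrite ler_piMl//.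
          exact: (wle _ _ w1).
        by apply: (wle _ w.1); rewrite addrC; exact: w1.
      have := normr_ge0 x.1; have := normr_ge0 x.2; nra.
    have hE : expR (- (alpha * nsq x)) * expR (lam * alpha * l x ^+ 2) <=
        expR (- ((1 - lam) * alpha * x.1 ^+ 2)) * expR (- ((1 - lam) * alpha * x.2 ^+ 2)).
      rewrite -!expRD ler_expR; move: hl2; rewrite /nsq => hl2.
      have la : 0 <= lam * alpha by rewrite mulr_ge0 ?ltW.
      have := ler_wpM2l la hl2; lra.
    apply: (@le_trans _ _ ((2 * C * expR (- (alpha * nsq x))) * ((1 + `|x.1|) * (1 + `|x.2|)) * expR (lam * alpha * l x ^+ 2))).
      rewrite ler_wpM2r ?expR_ge0//; apply: ler_pM => //; exact: hv.
    rewrite (_ : _ * _ * expR (lam * _ * _) = (2 * C) * (((1 + `|x.1|) * (1 + `|x.2|)) *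
      (expR (- (alpha * nsq x)) * expR (lam * alpha * l x ^+ 2)))); last by ring.
    rewrite -[leRHS]mulrA ler_wpM2l ?mulr_ge0//.
    apply: (@le_trans _ _ (((1 + `|x.1|) * expR (- ((1 - lam) * alpha * x.1 ^+ 2))) *
       ((1 + `|x.2|) * expR (- ((1 - lam) * alpha * x.2 ^+ 2))))).
      by rewrite [leRHS]mulrACA ler_wpM2l//; nneg.
    by rewrite /k2 [leRHS]mulrACA; apply: ler_pM => //; nneg.
  - exact: (RintegrableZ _ (@Rintegrable_k2 R)).
have E y : P (shift xi y) d - P (shift xi (- y)) d = 2 * \int[leb2]_x (v x * sin (y * l x)).
  have I1 y' : Rintegrable leb2 (fun x : plane => v1 x * cos ((shift xi y').1 * x.1 + (shift xi y').2 * x.2 + d)).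
    by apply: integrable_gaussian => //; [exact: continuous_cos|exact: cos_max].
  have I2 y' : Rintegrable leb2 (fun x : plane => v2 x * sin ((shift xi y').1 * x.1 + (shift xi y').2 * x.2 + d)).
    by apply: integrable_gaussian => //; [exact: continuous_sin|exact: sin_max].
  have I3 y' := RintegrableD (I1 y') (I2 y').
  rewrite /P -RintegralB; [|exact: measurableT|exact: I3|exact: I3].
  rewrite -RintegralZl; [|exact: measurableT|].
    apply: eq_Rintegral => x _ /=.
    have -> : (xi.1 + y * w.1) * x.1 + (xi.2 + y * w.2) * x.2 + d = th x + y * l x by rewrite /th /l; ring.
    have -> : (xi.1 + - y * w.1) * x.1 + (xi.2 + - y * w.2) * x.2 + d = th x - y * l x by rewrite /th /l; ring.
    by rewrite (cosD (th x) (y * l x)) (sinD (th x) (y * l x)) (cosB (th x) (y * l x)) (sinB (th x) (y * l x)) /v; ring.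
  apply: (@Rintegrable_le _ plane R _ _ (fun x => (2 * C * ((1 + alpha^-1) * (1 + alpha^-1))) * k2 x)).
  - apply: continuous_measurable_plane; apply: contM => //.
    by apply: cont_sin; apply: contM => //; exact: cont_cst.
  - move=> x; rewrite normrM; apply: (@le_trans _ _ `|v x|); first by rewrite ler_piMr ?sin_max.
    apply: (le_trans (hv x)); rewrite -[leRHS]mulrA ler_wpM2l ?mulr_ge0// /nsq mulrDr opprD expRD /k2 mulrACA.
    by have c0 := (@expR_gauss_le_k1 R alpha _ alpha0); apply: ler_pM; rewrite ?expR_ge0.
  - exact: (RintegrableZ _ (@Rintegrable_k2 R)).
have [K' K'0 HK'] := P_decay xi.
have Z : \int[leb2]_x (v x * sin (z * l x)) = 0.
  apply: (@hardy_sine _ plane R leb2 v l (lam * alpha) (lam * beta * G) K').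
  - exact: continuous_measurable_plane.
  - exact: continuous_measurable_plane.
  - by rewrite mulr_gt0.
  - by move: lamX; rewrite /X (_ : lam ^+ 2 * _ = 4 * (lam * alpha) * (lam * beta * G))//; ring.
  - exact: iv.
  - move=> y; have h1 := HK' y d; have h2 := HK' (- y) d; rewrite sqrrN in h2.
    have hB := ler_normB (P (shift xi y) d) (P (shift xi (- y)) d).
    rewrite E normrM ger0_norm// in hB; lra.
by have := E z; rewrite Z mulr0 => /eqP; rewrite subr_eq0 => /eqP.
Qed.

Lemma hardy_plane xi d : P xi d = 0.
Proof.
have [K' K'0 HK'] := P_decay xi.
(* Reflection about the midpoint xi + (z / 2) w exchanges xi and xi + z w. *)
have per z : P xi d = P (shift xi z) d.
  have := P_even (shift xi (z / 2)) (z / 2) d; rewrite /shift /= => h.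
  transitivity (P (xi.1 + z / 2 * w.1 + - (z / 2) * w.1, xi.2 + z / 2 * w.2 + - (z / 2) * w.2) d).
    by congr (P _ d); rewrite [LHS]surjective_pairing; congr pair; ring.
  rewrite -h; congr (P _ d); by rewrite /shift; congr pair; field.
apply/eqP; rewrite -normr_eq0 eq_le normr_ge0 andbT leNgt; apply/negP => p0.
pose b := lam * beta * G; have b0 : 0 < b by exact: mulr_gt0 (mulr_gt0 lam0 beta0) G0.
(* Chosen so that |P| b z = |P| b + K' exceeds K', against the decay at [z]. *)
pose z := 1 + K' / (`|P xi d| * b).
have k0 : 0 <= K' / (`|P xi d| * b) by rewrite divr_ge0// mulr_ge0 ?ltW.
have := HK' z d; rewrite -per expRN ler_pdivlMr ?expR_gt0// leNgt => /negP; apply.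
have h1 : 1 + b * z ^+ 2 <= expR (b * z ^+ 2) by exact: expR_ge1Dx.
have h2 : `|P xi d| * (1 + b * z ^+ 2) <= `|P xi d| * expR (b * z ^+ 2) by rewrite ler_wpM2l.
apply: lt_le_trans h2.
have zz : z <= z ^+ 2 by rewrite expr2 ler_peMr// /z; lra.
have h3 : `|P xi d| * (b * z) <= `|P xi d| * (b * z ^+ 2) by rewrite ler_wpM2l// ler_wpM2l// ltW.
have h4 : `|P xi d| * (b * z) = `|P xi d| * b + K' by rewrite /z; field; rewrite !gt_eqF.
have : 0 < `|P xi d| * b by rewrite mulr_gt0.
by rewrite mulrDr mulr1; lra.
Qed.

End HardyPlane.

(** * Uniqueness for hbar = m = 1 *)

Section Normalized.
Context {R : realType}.
Notation plane := (measurableTypeR R * measurableTypeR R)%type.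
Notation point := (@point R).
Implicit Types x xi : R * R.

(** (c, s) lies at half the polar angle of (X, Y), where a trace-free quadratic form attains its
    maximum on the unit circle; the sign of [s] follows that of [Y]. *)
Lemma half_angle (X Y : R) : exists c s : R,
  c ^+ 2 + s ^+ 2 = 1 /\ (c ^+ 2 - s ^+ 2) * X + 2 * (c * s) * Y = Num.sqrt (X ^+ 2 + Y ^+ 2).
Proof.
have XY0 : 0 <= X ^+ 2 + Y ^+ 2 by nneg.
set r := Num.sqrt _; have r0 : 0 <= r by exact: sqrtr_ge0.
have r2 : r ^+ 2 = X ^+ 2 + Y ^+ 2 by rewrite sqr_sqrtr.
have [rz|rn0] := eqVneq r 0.
  exists 1, 0; rewrite rz; rewrite rz expr0n/= in r2.
  have [X0 Y0] : X ^+ 2 = 0 /\ Y ^+ 2 = 0.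
    by have := sqr_ge0 X; have := sqr_ge0 Y; split; lra.
  by move/eqP: X0; rewrite sqrf_eq0 => /eqP ->; split; ring.
have rp : 0 < r by rewrite lt_def rn0.
have Xr : `|X| <= r by rewrite -[`|X|]sqrtr_sqr ler_wsqrtr// lerDl sqr_ge0.
move: Xr; rewrite ler_norml => /andP[Xr1 Xr2].
have hc : 0 <= (1 + X / r) / 2.
  by rewrite divr_ge0// (_ : 1 + X / r = (r + X) / r) ?divr_ge0//; [lra|field].
have hs : 0 <= (1 - X / r) / 2.
  by rewrite divr_ge0// (_ : 1 - X / r = (r - X) / r) ?divr_ge0//; [lra|field].
pose c := Num.sqrt ((1 + X / r) / 2); pose s := Num.sqrt ((1 - X / r) / 2).
have c2 : c ^+ 2 = (1 + X / r) / 2 by rewrite sqr_sqrtr.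
have s2 : s ^+ 2 = (1 - X / r) / 2 by rewrite sqr_sqrtr.
have cs : 2 * (c * s) * r = `|Y|.
  have n0 : 0 <= 2 * (c * s) * r by rewrite !mulr_ge0 ?sqrtr_ge0.
  rewrite -(ger0_norm n0) -2!sqrtr_sqr; congr Num.sqrt.
  rewrite 3!exprMn c2 s2; transitivity (r ^+ 2 - X ^+ 2); last by rewrite r2; ring.
  by field.
have fin s' : s' ^+ 2 = s ^+ 2 -> 2 * (c * s') * r * Y = Y ^+ 2 ->
    c ^+ 2 + s' ^+ 2 = 1 /\ (c ^+ 2 - s' ^+ 2) * X + 2 * (c * s') * Y = r.
  move=> hs' hY; rewrite hs' c2 s2; split; first by field.
  apply: (mulIf rn0); rewrite mulrDl (mulrAC _ Y) hY -expr2 r2; field.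
  exact: rn0.
case: (leP 0 Y) => Y0.
  by exists c, s; apply: fin => //; rewrite cs ger0_norm// expr2.
exists c, (- s); apply: fin; first by rewrite sqrrN.
by rewrite mulrN mulrN !mulNr cs ltr0_norm// mulNr opprK expr2.
Qed.

(** For [sgn] = 1 or -1, the eigenvalues of the Gram matrix of [Bmat], with the square root of the
    discriminant factored. *)
Definition sing_max (b11 b12 b22 sgn : R) : R :=
  (b11 ^+ 2 + b22 ^+ 2 + 2 * b12 ^+ 2) / 2 +
  sgn * (`|b11 - b22| * Num.sqrt ((b11 + b22) ^+ 2 + 4 * b12 ^+ 2)) / 2.

Lemma sing_max_attained b11 b12 b22 : exists w : R * R, w.1 ^+ 2 + w.2 ^+ 2 = 1 /\
  (Bmat b11 b12 b22 w).1 ^+ 2 + (Bmat b11 b12 b22 w).2 ^+ 2 = sing_max b11 b12 b22 1.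
Proof.
have [c [s [cs E]]] := half_angle (b11 ^+ 2 - b22 ^+ 2) (2 * (b12 * (b22 - b11))).
exists (c, s); split => //=.
rewrite /sing_max mul1r.
have -> : `|b11 - b22| * Num.sqrt ((b11 + b22) ^+ 2 + 4 * b12 ^+ 2) =
    Num.sqrt ((b11 ^+ 2 - b22 ^+ 2) ^+ 2 + (2 * (b12 * (b22 - b11))) ^+ 2).
  by rewrite -sqrtr_sqr -sqrtrM ?sqr_ge0//; congr Num.sqrt; ring.
rewrite -E; transitivity ((b11 ^+ 2 + b22 ^+ 2 + 2 * b12 ^+ 2) / 2 * (c ^+ 2 + s ^+ 2) +
  ((c ^+ 2 - s ^+ 2) * (b11 ^+ 2 - b22 ^+ 2) + 2 * (c * s) * (2 * (b12 * (b22 - b11)))) / 2).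
  by rewrite /Bmat /=; field.
by rewrite cs mulr1.
Qed.

(** The product of the squared singular values is the squared determinant; this yields the
    invertibility of [B] from the two nonvanishing hypotheses. *)
Lemma sing_max_det b11 b12 b22 :
  sing_max b11 b12 b22 1 * sing_max b11 b12 b22 (-1) = (b11 * b22 + b12 ^+ 2) ^+ 2.
Proof.
rewrite /sing_max; set u := `|_|; set v := Num.sqrt _.
have u2 : u ^+ 2 = (b11 - b22) ^+ 2 by rewrite real_normK ?num_real.
have v2 : v ^+ 2 = (b11 + b22) ^+ 2 + 4 * b12 ^+ 2 by rewrite sqr_sqrtr//; nneg.
transitivity (((b11 ^+ 2 + b22 ^+ 2 + 2 * b12 ^+ 2) ^+ 2 - u ^+ 2 * v ^+ 2) / 4); first by field.
by rewrite u2 v2; field.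
Qed.

Variables omega theta l1 l2 T : R.
Hypotheses (om0 : 0 < omega) (thom : theta ^+ 2 < omega ^+ 2) (l10 : 0 < l1) (l20 : 0 < l2).
Hypotheses (Hl1 : l1 ^+ 2 = omega * (omega + theta)) (Hl2 : l2 ^+ 2 = omega * (omega - theta)).

(** [Bmat b11 b12 b22] sends the initial momentum of a trajectory issued from the origin to its
    position at time [T]. *)
Let b11 := (l1 * sin (l1 * T) + l2 * sin (l2 * T)) / (2 * omega ^+ 2).
Let b12 := (cos (l1 * T) - cos (l2 * T)) / (2 * omega).
Let b22 := (sin (l1 * T) / l1 + sin (l2 * T) / l2) / 2.
Let G := sing_max b11 b12 b22 1.
Hypothesis D0 : b11 * b22 + b12 ^+ 2 != 0.

Variables rt st dr ds : R -> R * R -> R.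
Hypotheses (Srt : forall t, Sw (rt t)) (Sst : forall t, Sw (st t)).
Hypothesis hL : forall t, schr omega theta (rt t) (st t) (dr t) (ds t).
Hypothesis hdr : forall t x, der (fun t => rt t x) t (dr t x).
Hypothesis hds : forall t x, der (fun t => st t x) t (ds t x).

Variables K alpha beta : R.
Hypotheses (alpha0 : 0 < alpha) (beta0 : 0 < beta) (K0 : 0 < K).
Let nsq x := x.1 ^+ 2 + x.2 ^+ 2.
Hypotheses (hr0 : forall x, `|rt 0 x| <= K * expR (- (alpha * nsq x)))
  (hs0 : forall x, `|st 0 x| <= K * expR (- (alpha * nsq x)))
  (hrT : forall x, `|rt T x| <= K * expR (- (beta * nsq x)))
  (hsT : forall x, `|st T x| <= K * expR (- (beta * nsq x))).
Hypothesis large : 1 < 4 * alpha * (beta * G).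

Let S := l1 + l2.
Let S0 : 0 < S. Proof. exact: addr_gt0. Qed.
(* The width of the packets that the flow transports without deformation. *)
Let a := 2 * omega ^+ 2 / S.
Let b := 2 * (l1 * l2) / S.
Let gam := omega * (l1 - l2) / S.

(** The relation between the frequencies from which the Riccati identities [Ha], [Hb], [Hg]
    follow. *)
Let om2 : 2 * omega ^+ 2 - l1 ^+ 2 - l2 ^+ 2 = 0.
Proof. by rewrite Hl1 Hl2; ring. Qed.
Let thE : theta = (l1 ^+ 2 - l2 ^+ 2) / (2 * omega).
Proof. by rewrite Hl1 Hl2; field; rewrite gt_eqF. Qed.
Let a0 : 0 < a. Proof. by rewrite divr_gt0 ?mulr_gt0 ?exprn_gt0. Qed.
Let b0 : 0 < b. Proof. by rewrite divr_gt0 ?mulr_gt0. Qed.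
Let o : omega != 0. Proof. by rewrite gt_eqF. Qed.
Let l1n : l1 != 0. Proof. by rewrite gt_eqF. Qed.
Let l2n : l2 != 0. Proof. by rewrite gt_eqF. Qed.
Let Sn : l1 + l2 != 0. Proof. by rewrite gt_eqF. Qed.

Let Ha : a ^+ 2 = omega ^+ 2 + gam ^+ 2.
Proof.
apply/eqP; rewrite -subr_eq0; apply/eqP.
transitivity (2 * omega ^+ 2 / S ^+ 2 * (2 * omega ^+ 2 - l1 ^+ 2 - l2 ^+ 2)); last by rewrite om2 mulr0.
by rewrite /a /gam /S; field.
Qed.

Let Hb : b ^+ 2 = omega ^+ 2 + gam ^+ 2 - 2 * theta * gam.
Proof.
rewrite -Ha thE; apply/eqP; rewrite -subr_eq0; apply/eqP.
transitivity (- (2 * omega ^+ 2 - l1 ^+ 2 - l2 ^+ 2) * (l1 ^+ 2 + l2 ^+ 2 + 2 * omega ^+ 2) / S ^+ 2).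
  by rewrite /a /b /gam /S; field; rewrite o Sn.
by rewrite om2 oppr0 !mul0r.
Qed.

Let Hg : gam * (a + b) = theta * a.
Proof.
rewrite thE; apply/eqP; rewrite -subr_eq0; apply/eqP.
transitivity (omega * (l1 - l2) / S ^+ 2 * (2 * omega ^+ 2 - l1 ^+ 2 - l2 ^+ 2)); last by rewrite om2 mulr0.
by rewrite /a /b /gam /S; field; rewrite o Sn.
Qed.

Let e := (cos (l1 * T) + cos (l2 * T)) / 2.
Let f := (l1 * sin (l1 * T) - l2 * sin (l2 * T)) / (2 * omega).
Let g := omega / 2 * (sin (l1 * T) / l1 - sin (l2 * T) / l2).

Let R1 : e ^+ 2 + f * g + omega ^+ 2 * (b11 * b22 + b12 ^+ 2) = 1.
Proof.
transitivity ((cos (l1 * T) ^+ 2 + sin (l1 * T) ^+ 2) / 2 + (cos (l2 * T) ^+ 2 + sin (l2 * T) ^+ 2) / 2).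
  by rewrite /e /f /g /b11 /b12 /b22; field; rewrite o l1n l2n.
by rewrite !cos2Dsin2; field.
Qed.

Let R2 : b11 * g + b22 * f + 2 * (b12 * e) = 0.
Proof.
transitivity (((cos (l1 * T) ^+ 2 + sin (l1 * T) ^+ 2) - (cos (l2 * T) ^+ 2 + sin (l2 * T) ^+ 2)) / (2 * omega)).
  by rewrite /e /f /g /b11 /b12 /b22; field; rewrite o l1n l2n.
by rewrite !cos2Dsin2 subrr mul0r.
Qed.

Let bw y p d := backward omega e f g b11 b12 b22 ((a + b) / 2 * T) y p d.

Let conserved c t u : traj omega theta a b c ->
  pairing a b gam (rt t) (st t) (c t) = pairing a b gam (rt u) (st u) (c u).
Proof.
exact: (pairing_conserved a0 b0 om0 thom Ha Hb Hg l10 l20 Hl1 Hl2 Srt Sst hL hdr hds).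
Qed.

Let pairing_backward y p d :
  pairing a b gam (rt T) (st T) (fpoint y p d) = pairing a b gam (rt 0) (st 0) (bw y p d).
Proof.
have tc := traj_shift (- T) (traj_flow a b om0 l10 l20 Hl1 Hl2 (fpoint y p d)).
have := conserved T 0 tc; rewrite subrr (@flow0 R omega a b l1 l2 om0 (fpoint y p d)) => ->; congr pairing.
rewrite /flow /bw /backward /mode /dmode sub0r !mulrN !cosN !sinN /nQ1 /nQ2 /nP1 /nP2 /fpoint /=.
rewrite /e /f /g /b11 /b12 /b22; congr Point; field; by rewrite ?o ?l1n ?l2n.
Qed.

Let bdd (h : R * R -> R) : Sw h -> exists C, forall x, `|h x| <= C := @Sw_bounded R h.

(** Inversion at time [T] and the kernel formula at time 0, linked by conservation of the
    pairings. *)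
Let inverse_kernel : exists v1 v2 : R * R -> R, exists C : R,
  [/\ continuous v1, continuous v2,
      forall x, `|v1 x| <= C * (`|rt 0 x| + `|st 0 x|), forall x, `|v2 x| <= C * (`|rt 0 x| + `|st 0 x|) &
      forall xi d, \int[leb2]_x (v1 x * cos (xi.1 * x.1 + xi.2 * x.2 + d) +
                    v2 x * sin (xi.1 * x.1 + xi.2 * x.2 + d)) =
        (gauss_mass ^+ 2) ^+ 2 *
        (rt T (Bmat b11 b12 b22 xi) * cos (d + Bphase e f g b11 b12 b22 xi) +
         st T (Bmat b11 b12 b22 xi) * sin (d + Bphase e f g b11 b12 b22 xi))].
Proof.
have [v1 [v2 [C [c1 c2 h1 h2 H]]]] :=
  kernel_exists gam ((a + b) / 2 * T) a0 b0 D0 R1 R2 (Srt 0) (Sst 0).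
exists v1, v2, C; split => // xi d.
have := H xi (d + Bphase e f g b11 b12 b22 xi); rewrite addrK => <-.
have [M HM] := pairing_decay gam a0 b0 om0 thom (Srt T) (Sst T).
have [_ <-] := pairing_inversion a0 b0 om0 thom (Bmat b11 b12 b22 xi) (d + Bphase e f g b11 b12 b22 xi)
  (Sw_continuous (Srt T)) (Sw_continuous (Sst T)) (bdd (Srt T)) (bdd (Sst T)) HM.
by apply: eq_Rintegral => p _; rewrite pairing_backward.
Qed.

Let final_zero x : rt T x = 0 /\ st T x = 0.
Proof.
have [v1 [v2 [C [c1 c2 h1 h2 H]]]] := inverse_kernel.
have [w [w1 wG]] := sing_max_attained b11 b12 b22.
have g0 : 0 < (gauss_mass ^+ 2) ^+ 2 :> R by rewrite !exprn_gt0 ?gauss_mass_gt0.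
have hv (v : R * R -> R) : (forall x, `|v x| <= C * (`|rt 0 x| + `|st 0 x|)) ->
    forall x, `|v x| <= (`|C| * (K + K)) * expR (- (alpha * nsq x)).
  move=> h y; apply: (le_trans (h y)); apply: (@le_trans _ _ (`|C| * (`|rt 0 y| + `|st 0 y|))).
    by rewrite ler_wpM2r ?ler_norm//; nneg.
  by rewrite -mulrA ler_wpM2l// mulrDl; apply: lerD.
have Z xi d : \int[leb2]_x (v1 x * cos (xi.1 * x.1 + xi.2 * x.2 + d) +
                            v2 x * sin (xi.1 * x.1 + xi.2 * x.2 + d)) = 0.
  apply: (@hardy_plane R v1 v2 (`|C| * (K + K)) ((gauss_mass ^+ 2) ^+ 2 * (K + K)) alpha beta G
    (Bmat b11 b12 b22) w c1 c2 alpha0 beta0 large (hv v1 h1) (hv v2 h2) w1 wG).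
    by move=> y z; rewrite /Bmat /=; congr pair; ring.
  move=> y d'; rewrite H normrM (gtr0_norm g0) -mulrA ler_wpM2l ?(ltW g0)// mulrDl.
  apply: (le_trans (ler_normD _ _)); apply: lerD; rewrite normrM.
    by apply: le_trans (hrT _); rewrite ler_piMr ?cos_max.
  by apply: le_trans (hsT _); rewrite ler_piMr ?sin_max.
pose xi : R * R := ((b22 * x.1 + b12 * x.2) / (b11 * b22 + b12 ^+ 2),
  (b11 * x.2 - b12 * x.1) / (b11 * b22 + b12 ^+ 2)).
have Bx : Bmat b11 b12 b22 xi = x.
  by rewrite [RHS]surjective_pairing /Bmat /xi /=; congr pair; field.
have E d : rt T x * cos d + st T x * sin d = 0.
  have := H xi (d - Bphase e f g b11 b12 b22 xi); rewrite Z Bx subrK => /esym/eqP.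
  by rewrite mulf_eq0 (gt_eqF g0) => /eqP.
split; first by have := E 0; rewrite cos0 sin0 mulr1 mulr0 addr0.
by have := E (pi / 2); rewrite cos_pihalf sin_pihalf mulr1 mulr0 add0r.
Qed.

(** Vanishing at time [T] makes every pairing vanish at every time; [bound_of_pairing] with M = 0
    concludes. *)
Theorem normalized_uniqueness t x : rt t x = 0 /\ st t x = 0.
Proof.
have P0 z : pairing a b gam (rt t) (st t) z = 0.
  have [c tc <-] := traj_through a b om0 l10 l20 Hl1 Hl2 z t.
  rewrite (conserved t T tc) /pairing.
  under eq_Rintegral => y _ do
    rewrite /packet (final_zero y).1 (final_zero y).2 !mulr0 addr0.
  by rewrite Rintegral_cst ?mul0r.
have h z : (1 + energy omega theta z) ^+ 2 * `|pairing a b gam (rt t) (st t) z| <= 0.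
  by rewrite P0 normr0 mulr0.
have [] := bound_of_pairing a0 b0 om0 thom (Sw_continuous (Srt t)) (Sw_continuous (Sst t))
  (bdd (Srt t)) (bdd (Sst t)) h x.
by rewrite mulr0 !normr_le0 => /eqP -> /eqP ->.
Qed.

End Normalized.

(** * Return to the original variables *)

Local Open Scope complex_scope.
Local Open Scope ring_scope.

Section Rows.
Context {R : realType}.
Notation V := 'rV[R]_2.

Definition row2 (s t : R) : V := s *: delta_mx 0 0 + t *: delta_mx 0 1.

Lemma row2_0 s t : row2 s t 0 0 = s.
Proof. by rewrite !mxE /= mulr1 mulr0 addr0. Qed.

Lemma row2_1 s t : row2 s t 0 1 = t.
Proof. by rewrite !mxE /= mulr1 mulr0 add0r. Qed.

Lemma row2E (x : V) : x = row2 (x 0 0) (x 0 1).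
Proof.
apply/rowP => j; case: (unliftP 0 j) => [k ->|->]; last by rewrite row2_0.
by rewrite (ord1 k) (_ : lift 0 0 = 1) ?row2_1//; exact/val_inj.
Qed.

Lemma continuous_row2 (l : R) : continuous (fun x : R * R => row2 (l * x.1) (l * x.2)).
Proof.
move=> x; apply: cvgD; (apply: cvgZ; last exact: cvg_cst).
  exact: (contM (@cont_cst _ _ l) (@cont_fst R)).
exact: (contM (@cont_cst _ _ l) (@cont_snd R)).
Qed.

Lemma der_row2_1 (F : V -> R) s t : derivable F (row2 s t) (delta_mx 0 0) ->
  der (fun s => F (row2 s t)) s ('D_(delta_mx 0 0) F (row2 s t)).
Proof.
have E : (fun h : R => h^-1 *: (F (row2 (h *: 1 + s) t) - F (row2 s t))) =
    (fun h : R => h^-1 *: (F (h *: delta_mx 0 0 + row2 s t) - F (row2 s t))).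
  apply/funext => h; congr (_ *: (F _ - _)).
  by rewrite /row2 scalerDl addrA /GRing.scale /= mulr1.
by move=> dF; split; rewrite /derivable /derive /= E.
Qed.

Lemma der_row2_2 (F : V -> R) s t : derivable F (row2 s t) (delta_mx 0 1) ->
  der (fun t => F (row2 s t)) t ('D_(delta_mx 0 1) F (row2 s t)).
Proof.
have E : (fun h : R => h^-1 *: (F (row2 s (h *: 1 + t)) - F (row2 s t))) =
    (fun h : R => h^-1 *: (F (h *: delta_mx 0 1 + row2 s t) - F (row2 s t))).
  apply/funext => h; congr (_ *: (F _ - _)).
  by rewrite /row2 scalerDl addrCA /GRing.scale /= mulr1.
by move=> dF; split; rewrite /derivable /derive /= E.
Qed.

Lemma norm_Re_le (z : R[i]) (M : R) : `|z| <= M%:C -> `|complex.Re z| <= M.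
Proof. by move=> h; rewrite -lecR; exact: le_trans (normc_ge_Re z) h. Qed.

Lemma norm_Im_le (z : R[i]) (M : R) : `|z| <= M%:C -> `|complex.Im z| <= M.
Proof.
rewrite normc_def lecR; apply: le_trans.
by rewrite -sqrtr_sqr ler_wsqrtr// lerDr sqr_ge0.
Qed.

End Rows.

(** * From Schwartz functions to the class [Sw] *)

Section SchwartzConversion.
Context {R : realType}.
Notation V := 'rV[R]_2.
Variables (l : R) (F : V -> R[i]).
Hypotheses (l0 : 0 < l) (SF : schwartz F).

Definition part (b : bool) (z : R[i]) : R := if b then complex.Re z else complex.Im z.
Definition rescaled (b : bool) (s : seq 'I_2) (x : R * R) : R :=
  part b (partials s F (row2 (l * x.1) (l * x.2))).

Lemma pder1_rescaled b s : pder1 (rescaled b s) (fun x => l * rescaled b (0 :: s) x).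
Proof.
move=> u v; rewrite /rescaled /=.
have [h1 h2] := SF.1 s (row2 (l * u) (l * v)).
have dl : der (fun u => l * u) u l by der_auto; rewrite /=; ring.
have D : der (fun s' => part b (partials s F (row2 s' (l * v)))) (l * u)
    (part b (partial 0 (partials s F) (row2 (l * u) (l * v)))).
  case: b.
    by apply: (der_row2_1 (F := fun y => complex.Re (partials s F y))); exact: diff_derivable.
  by apply: (der_row2_1 (F := fun y => complex.Im (partials s F y))); exact: diff_derivable.
by apply: (der_eq (der_comp dl D)); rewrite mulrC.
Qed.

Lemma pder2_rescaled b s : pder2 (rescaled b s) (fun x => l * rescaled b (1 :: s) x).
Proof.
move=> u v; rewrite /rescaled /=.
have [h1 h2] := SF.1 s (row2 (l * u) (l * v)).
have dl : der (fun u => l * u) v l by der_auto; rewrite /=; ring.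
have D : der (fun s' => part b (partials s F (row2 (l * u) s'))) (l * v)
    (part b (partial 1 (partials s F) (row2 (l * u) (l * v)))).
  case: b.
    by apply: (der_row2_2 (F := fun y => complex.Re (partials s F y))); exact: diff_derivable.
  by apply: (der_row2_2 (F := fun y => complex.Im (partials s F y))); exact: diff_derivable.
by apply: (der_eq (der_comp dl D)); rewrite mulrC.
Qed.

(** A stable class containing the rescaled partial derivatives; the linear combinations are forced
    by the product rule for x1 h and x2 h. *)
Inductive generated : (R * R -> R) -> Prop :=
| GenBase b s : generated (rescaled b s)
| GenX1 h : generated h -> generated (fun x => x.1 * h x)
| GenX2 h : generated h -> generated (fun x => x.2 * h x)
| GenLin c h k : generated h -> generated k -> generated (fun x => c * h x + k x).

(** The monomial weight is part of the induction so that multiplication by a coordinate merely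
    raises an exponent. *)
Lemma generated_bounded h : generated h ->
  forall m n, exists M, forall x, `|x.1 ^+ m * x.2 ^+ n * h x| <= M.
Proof.
elim=> {h} [b s|h _ IH|h _ IH|c h k _ IH1 _ IH2] m n.
- have [M HM] := SF.2 (fun j => if j == 0 then m else n) s.
  exists (M / l ^+ (m + n)) => x; rewrite ler_pdivlMr ?exprn_gt0//.
  have := HM (row2 (l * x.1) (l * x.2)).
  rewrite big_ord_recl big_ord1 /= row2_0 (_ : lift 0 0 = 1); last exact/val_inj.
  rewrite row2_1; set z := partials _ _ _ => h; pose c := (l * x.1) ^+ m * (l * x.2) ^+ n.
  rewrite -[l ^+ (m + n)]gtr0_norm ?exprn_gt0// -normrM.
  have -> : x.1 ^+ m * x.2 ^+ n * rescaled b s x * l ^+ (m + n) = c * part b z.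
    by rewrite /rescaled -/z /c !exprMn exprD; ring.
  have E : c * part b z = part b (c%:C * z).
    by case: b; case: (z) => p q; rewrite /= !mul0r ?subr0 ?addr0.
  by rewrite E; case: b {E}; [exact: norm_Re_le h|exact: norm_Im_le h].
- have [M HM] := IH m.+1 n; exists M => x; apply: le_trans (HM x).
  by rewrite le_eqVlt; apply/orP; left; apply/eqP; congr `|_|; rewrite exprS; ring.
- have [M HM] := IH m n.+1; exists M => x; apply: le_trans (HM x).
  by rewrite le_eqVlt; apply/orP; left; apply/eqP; congr `|_|; rewrite exprS; ring.
- have [M HM] := IH1 m n; have [N HN] := IH2 m n; exists (`|c| * M + N) => x.
  rewrite (_ : _ * (_ + _) = c * (x.1 ^+ m * x.2 ^+ n * h x) + x.1 ^+ m * x.2 ^+ n * k x); last by ring.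
  apply: (le_trans (ler_normD _ _)); apply: lerD => //.
  by rewrite normrM ler_wpM2l.
Qed.

Lemma generated_continuous h : generated h -> continuous h.
Proof.
elim=> {h} [b s|h _ IH|h _ IH|c h k _ IH1 _ IH2].
- move=> x; apply: (@continuous_comp _ _ _ (fun x : R * R => row2 (l * x.1) (l * x.2))
    (fun y => part b (partials s F y))); first exact: continuous_row2.
  have [h1 h2] := SF.1 s (row2 (l * x.1) (l * x.2)).
  by case: b; exact: differentiable_continuous.
- by apply: contM => //; exact: cont_fst.
- by apply: contM => //; exact: cont_snd.
- by apply: contD => //; apply: contM => //; exact: cont_cst.
Qed.

Let GenZ c h : generated h -> generated (fun x => c * h x).
Proof.
move=> Gh; have := GenLin (c - 1) Gh Gh; congr generated.
by apply/funext => x; ring.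
Qed.

Let GenD h k : generated h -> generated k -> generated (fun x => h x + k x).
Proof.
move=> Gh Gk; have := GenLin 1 Gh Gk; congr generated.
by apply/funext => x; rewrite mul1r.
Qed.

Lemma generated_pder1 h : generated h -> exists2 dh, generated dh & pder1 h dh.
Proof.
elim=> {h} [b s|h Gh [dh Gdh hd]|h Gh [dh Gdh hd]|c h k Gh [dh Gdh hd] Gk [dk Gdk kd]].
- by exists (fun x => l * rescaled b (0 :: s) x); [apply: GenZ; exact: GenBase|exact: pder1_rescaled].
- exists (fun x => h x + x.1 * dh x); first by apply: GenD => //; exact: GenX1.
  by move=> u v; have H := hd u v; der_auto; rewrite /=; ring.
- exists (fun x => x.2 * dh x); first exact: GenX2.
  by move=> u v; have H := hd u v; der_auto; rewrite /=; ring.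
- exists (fun x => c * dh x + dk x); first exact: GenLin.
  by move=> u v; have H := hd u v; have H' := kd u v; der_auto; rewrite /=; ring.
Qed.

Lemma generated_pder2 h : generated h -> exists2 dh, generated dh & pder2 h dh.
Proof.
elim=> {h} [b s|h Gh [dh Gdh hd]|h Gh [dh Gdh hd]|c h k Gh [dh Gdh hd] Gk [dk Gdk kd]].
- by exists (fun x => l * rescaled b (1 :: s) x); [apply: GenZ; exact: GenBase|exact: pder2_rescaled].
- exists (fun x => x.1 * dh x); first exact: GenX1.
  by move=> u v; have H := hd u v; der_auto; rewrite /=; ring.
- exists (fun x => h x + x.2 * dh x); first by apply: GenD => //; exact: GenX2.
  by move=> u v; have H := hd u v; der_auto; rewrite /=; ring.
- exists (fun x => c * dh x + dk x); first exact: GenLin.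
  by move=> u v; have H := hd u v; have H' := kd u v; der_auto; rewrite /=; ring.
Qed.

Lemma Sw_rescaled b s : Sw (rescaled b s).
Proof.
exists generated; last exact: GenBase.
move=> h Gh; split.
- exact: generated_continuous.
- have [M HM] := generated_bounded Gh 0 0; exists M => x.
  by have := HM x; rewrite !expr0 !mul1r.
- by split; [exact: GenX1|exact: GenX2].
- exact: generated_pder1.
- exact: generated_pder2.
Qed.

End SchwartzConversion.

(** * [Gamma] as a squared singular value, and reduction to unit constants *)

Section GammaSingularValues.
Context {R : realType}.

(** The absolute value in [Gamma] is 2 omega |b11 - b22| and its square root is 2 omega times that
    in [sing_max]. *)
Lemma GammaE (sgn m omega theta T l1 l2 : R) : 0 < m -> 0 < omega -> 0 < l1 -> 0 < l2 ->
  lambda1 omega theta = l1 -> lambda2 omega theta = l2 ->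
  Gamma sgn m omega theta T =
  sing_max ((l1 * sin (l1 * T) + l2 * sin (l2 * T)) / (2 * omega ^+ 2))
    ((cos (l1 * T) - cos (l2 * T)) / (2 * omega))
    ((sin (l1 * T) / l1 + sin (l2 * T) / l2) / 2) sgn / m ^+ 2.
Proof.
move=> m0 om0 l10 l20 E1 E2; rewrite /Gamma E1 E2 /sing_max.
have mn : m != 0 by rewrite gt_eqF. have o : omega != 0 by rewrite gt_eqF.
have l1n : l1 != 0 by rewrite gt_eqF. have l2n : l2 != 0 by rewrite gt_eqF.
move: (sin (l1 * T)) (sin (l2 * T)) (cos (l1 * T)) (cos (l2 * T)) => s1 s2 c1 c2.
set b11 := (l1 * s1 + l2 * s2) / _; set b12 := (c1 - c2) / _; set b22 := (s1 / l1 + s2 / l2) / 2.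
have w0 : 0 <= 2 * omega by rewrite mulr_ge0// ltW.
have -> : `|(omega ^+ 2 - l1 ^+ 2) / (omega * l1) * s1 + (omega ^+ 2 - l2 ^+ 2) / (omega * l2) * s2|
    = (2 * omega) * `|b11 - b22|.
  transitivity (`|2 * omega| * `|b11 - b22|); last by rewrite (ger0_norm w0).
  rewrite -normrM -[RHS]normrN; congr `|_|.
  by rewrite /b11 /b22; field; rewrite o l1n l2n.
have -> : Num.sqrt (((omega ^+ 2 + l1 ^+ 2) / (omega * l1) * s1 +
     (omega ^+ 2 + l2 ^+ 2) / (omega * l2) * s2) ^+ 2 + 4 * (c1 - c2) ^+ 2) =
    (2 * omega) * Num.sqrt ((b11 + b22) ^+ 2 + 4 * b12 ^+ 2).
  transitivity (Num.sqrt ((2 * omega) ^+ 2) * Num.sqrt ((b11 + b22) ^+ 2 + 4 * b12 ^+ 2)); last first.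
    by rewrite sqrtr_sqr (ger0_norm w0).
  rewrite -sqrtrM ?sqr_ge0//; congr Num.sqrt.
  by rewrite /b11 /b12 /b22; field; rewrite o l1n l2n.
move: `|b11 - b22| (Num.sqrt _) => u v.
by rewrite /b11 /b12 /b22; field; rewrite o l1n l2n mn.
Qed.

End GammaSingularValues.

Section SchroedingerComponents.
Context {R : realType}.

Lemma schroedinger_components (h c k v : R) (U L p w : R[i]) :
  'i * h%:C * U = - c%:C * L - 'i * k%:C * p + v%:C * w ->
  h * complex.Re U = - c * complex.Im L - k * complex.Re p + v * complex.Im w /\
  h * complex.Im U = c * complex.Re L - k * complex.Im p - v * complex.Re w.
Proof.
rewrite -complexiE; case: U L p w => [U1 U2] [L1 L2] [p1 p2] [w1 w2] E.
have := congr1 (@complex.Re R) E; have := congr1 (@complex.Im R) E => /=.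
by move=> E1 E2; split; lra.
Qed.

(** The length unit l with h = m l^2 removes both constants at once; each derivative in the new
    variable brings a factor l. *)
Lemma rescale_hamiltonian (h m l omega theta x1 x2 A B P Q : R) : m != 0 -> l != 0 -> h = m * l ^+ 2 ->
  (- (h ^+ 2 / (2 * m)) * (A + B) - h * theta * (l * x2) * P
    + m * omega ^+ 2 / 2 * ((l * x1) ^+ 2 + (l * x2) ^+ 2) * Q) / h =
  - 2^-1 * (l * (l * A) + l * (l * B)) + - theta * (x2 * (l * P))
    + omega ^+ 2 / 2 * (x1 * (x1 * Q) + x2 * (x2 * Q)).
Proof. by move=> m0 l0 ->; field; rewrite l0 m0. Qed.

End SchroedingerComponents.

Theorem corollary4p3 (R : realType) (hbar m omega theta : R)
    (hbar_gt0 : 0 < hbar) (m_gt0 : 0 < m) (omega_gt : `|theta| < omega)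
    (u : 'rV[R]_2 -> R -> R[i])
    (u_schwartz : forall t : R, schwartz (fun x => u x t))
    (u_sol : schroedinger_solution hbar m omega theta u)
    (T alpha beta K : R)
    (alpha_gt0 : 0 < alpha) (beta_gt0 : 0 < beta) (K_gt0 : 0 < K)
    (decay0 : forall x, `|u x 0| <= (K * expR (- alpha * sqnorm2 x))%:C)
    (decayT : forall x, `|u x T| <= (K * expR (- beta * sqnorm2 x))%:C)
    (Gamma_plus_neq0 : Gamma_plus m omega theta T <> 0)
    (Gamma_minus_neq0 : Gamma_minus m omega theta T <> 0)
    (Gamma_plus_large :
       1 < alpha * beta * (2 * hbar) ^+ 2 * Gamma_plus m omega theta T) :
  forall (x : 'rV[R]_2) (t : R), u x t = 0.
Proof.
have om0 : 0 < omega := le_lt_trans (normr_ge0 _) omega_gt.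
have thom : theta ^+ 2 < omega ^+ 2.
  by rewrite -[theta ^+ 2]real_normK ?num_real// ltrXn2r// nnegrE// ltW.
have [th1 th2] : 0 < omega + theta /\ 0 < omega - theta.
  by move: omega_gt; rewrite ltr_norml => /andP[? ?]; split; lra.
pose l1 := lambda1 omega theta; pose l2 := lambda2 omega theta.
have l10 : 0 < l1 by rewrite sqrtr_gt0 mulr_gt0.
have l20 : 0 < l2 by rewrite sqrtr_gt0 mulr_gt0.
have Hl1 : l1 ^+ 2 = omega * (omega + theta) by rewrite sqr_sqrtr// ltW// mulr_gt0.
have Hl2 : l2 ^+ 2 = omega * (omega - theta) by rewrite sqr_sqrtr// ltW// mulr_gt0.
have mn : m != 0 by rewrite gt_eqF. have hn : hbar != 0 by rewrite gt_eqF.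
have GE sgn := @GammaE R sgn m omega theta T l1 l2 m_gt0 om0 l10 l20 erefl erefl.
(* The natural length unit: time is left unscaled, so omega, theta and T keep their values. *)
pose l := Num.sqrt (hbar / m).
have hm0 : 0 < hbar / m by rewrite divr_gt0.
have l0 : 0 < l by rewrite sqrtr_gt0.
have ln : l != 0 by rewrite gt_eqF.
have ll : l ^+ 2 = hbar / m by rewrite sqr_sqrtr// ltW.
have hE : hbar = m * l ^+ 2 by rewrite ll; field.
pose rt t := rescaled l (fun x => u x t) true [::].
pose st t := rescaled l (fun x => u x t) false [::].
pose pt (x : R * R) := row2 (l * x.1) (l * x.2).
pose dr t x := complex.Re (cderive (V := R^o) 1 (u (pt x)) t).
pose ds t x := complex.Im (cderive (V := R^o) 1 (u (pt x)) t).
have Srt t : Sw (rt t) := Sw_rescaled l0 (u_schwartz t) true [::].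
have Sst t : Sw (st t) := Sw_rescaled l0 (u_schwartz t) false [::].
have hdr t x : der (fun t => rt t x) t (dr t x).
  by have [[d1 _] _] := u_sol (pt x) t; split; [exact: d1|].
have hds t x : der (fun t => st t x) t (ds t x).
  by have [[_ d2] _] := u_sol (pt x) t; split; [exact: d2|].
have hL t : schr omega theta (rt t) (st t) (dr t) (ds t).
  pose D b s x := rescaled l (fun x => u x t) b s x.
  have p1 b s := pder1_rescaled l (u_schwartz t) b s.
  have p2 b s := pder2_rescaled l (u_schwartz t) b s.
  have p11 b : pder1 (fun x => l * D b [:: 0] x) (fun x => l * (l * D b [:: 0; 0] x)).
    by move=> y z; have H := p1 b [:: 0] y z; rewrite /D; der_auto; rewrite /=; ring.
  have p22 b : pder2 (fun x => l * D b [:: 1] x) (fun x => l * (l * D b [:: 1; 1] x)).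
    by move=> y z; have H := p2 b [:: 1] y z; rewrite /D; der_auto; rewrite /=; ring.
  exists (fun x => l * D true [:: 0] x), (fun x => l * D true [:: 1] x),
    (fun x => l * D false [:: 0] x), (fun x => l * D false [:: 1] x),
    (fun x => l * (l * D true [:: 0; 0] x)), (fun x => l * (l * D true [:: 1; 1] x)),
    (fun x => l * (l * D false [:: 0; 0] x)), (fun x => l * (l * D false [:: 1; 1] x)).
  have key x : dr t x = (- (hbar ^+ 2 / (2 * m)) * (D false [:: 0; 0] x + D false [:: 1; 1] x)
        - hbar * theta * (l * x.2) * D true [:: 0] x
        + m * omega ^+ 2 / 2 * ((l * x.1) ^+ 2 + (l * x.2) ^+ 2) * st t x) / hbar /\
      ds t x = (hbar ^+ 2 / (2 * m) * (D true [:: 0; 0] x + D true [:: 1; 1] x)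
        - hbar * theta * (l * x.2) * D false [:: 0] x
        - m * omega ^+ 2 / 2 * ((l * x.1) ^+ 2 + (l * x.2) ^+ 2) * rt t x) / hbar.
    have [_ E] := u_sol (pt x) t.
    have [E1 E2] := schroedinger_components E.
    have lapE : laplacian (fun y => u y t) (pt x) =
        partials [:: 0; 0] (fun y => u y t) (pt x) + partials [:: 1; 1] (fun y => u y t) (pt x).
      by rewrite /laplacian big_ord_recl big_ord1 (_ : lift 0 0 = 1)//; exact/val_inj.
    rewrite lapE row2_0 row2_1 in E1 E2.
    have addRe (z z' : R[i]) : complex.Re (z + z') = complex.Re z + complex.Re z' by case: z z' => ? ? [].
    have addIm (z z' : R[i]) : complex.Im (z + z') = complex.Im z + complex.Im z' by case: z z' => ? ? [].
    rewrite addRe in E2; rewrite addIm in E1.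
    by split; apply: (mulIf hn); rewrite divfK// [LHS]mulrC; [exact: E1|exact: E2].
  split; first by split; [exact: p1|exact: p2|exact: p1|exact: p2].
  - by split; [exact: p11|exact: p22|exact: p11|exact: p22].
  - apply/funext => x; rewrite (key x).1.
    move: (D false [:: 0; 0] x) (D false [:: 1; 1] x) (D true [:: 0] x) (st t x) => A B P Q.
    exact: rescale_hamiltonian mn ln hE.
  - apply/funext => x; rewrite (key x).2.
    move: (D true [:: 0; 0] x) (D true [:: 1; 1] x) (D false [:: 0] x) (rt t x) => A B P Q.
    (* The imaginary component is the opposite of the same formula with the sign of [P] reversed. *)
    have := rescale_hamiltonian omega theta x.1 x.2 A B (- P) Q mn ln hE.
    by move=> H; apply: oppr_inj; rewrite -mulNr; apply: (etrans _ (etrans H _)); ring.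
have sq x : sqnorm2 (pt x) = hbar / m * (x.1 ^+ 2 + x.2 ^+ 2).
  rewrite /sqnorm2 big_ord_recl big_ord1 (_ : lift 0 0 = 1); last exact/val_inj.
  by rewrite row2_0 row2_1 !exprMn ll mulrDr.
have gauss_pt (c : R) x : - c * sqnorm2 (pt x) = - (c * (hbar / m) * (x.1 ^+ 2 + x.2 ^+ 2)).
  by rewrite sq; ring.
have hr0 x : `|rt 0 x| <= K * expR (- (alpha * (hbar / m) * (x.1 ^+ 2 + x.2 ^+ 2))).
  by rewrite -gauss_pt; exact: norm_Re_le (decay0 (pt x)).
have hs0 x : `|st 0 x| <= K * expR (- (alpha * (hbar / m) * (x.1 ^+ 2 + x.2 ^+ 2))).
  by rewrite -gauss_pt; exact: norm_Im_le (decay0 (pt x)).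
have hrT x : `|rt T x| <= K * expR (- (beta * (hbar / m) * (x.1 ^+ 2 + x.2 ^+ 2))).
  by rewrite -gauss_pt; exact: norm_Re_le (decayT (pt x)).
have hsT x : `|st T x| <= K * expR (- (beta * (hbar / m) * (x.1 ^+ 2 + x.2 ^+ 2))).
  by rewrite -gauss_pt; exact: norm_Im_le (decayT (pt x)).
have a'0 : 0 < alpha * (hbar / m) by rewrite mulr_gt0.
have b'0 : 0 < beta * (hbar / m) by rewrite mulr_gt0.
move: Gamma_plus_neq0 Gamma_minus_neq0 Gamma_plus_large; rewrite /Gamma_plus /Gamma_minus !GE.
set b11 := (l1 * sin _ + _) / _; set b12 := (cos _ - _) / _; set b22 := (sin _ / l1 + _) / 2.
move=> Gp Gm large0.
(* The squared determinant is the product of the two values of [sing_max], neither of which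
   vanishes. *)
have D0 : b11 * b22 + b12 ^+ 2 != 0.
  apply/negP => /eqP D0; have := sing_max_det b11 b12 b22.
  rewrite D0 expr0n/= => /eqP; rewrite mulf_eq0 => /orP[] /eqP Z.
    by apply: Gp; rewrite Z mul0r.
  by apply: Gm; rewrite Z mul0r.
(* Each decay rate acquires a factor hbar / m, and [Gamma_plus] is [sing_max] / m^2. *)
have large : 1 < 4 * (alpha * (hbar / m)) * (beta * (hbar / m) * sing_max b11 b12 b22 1).
  apply: (lt_le_trans large0); rewrite le_eqVlt; apply/orP; left; apply/eqP.
  by field.
move=> x t.
have [zr zi] := normalized_uniqueness om0 thom l10 l20 Hl1 Hl2 D0 Srt Sst hL hdr hds
  a'0 b'0 hr0 hs0 hrT hsT large t (x 0 0 / l, x 0 1 / l).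
have Ex : pt (x 0 0 / l, x 0 1 / l) = x.
  rewrite [RHS]row2E /pt /=; congr row2; by rewrite mulrC divfK// gt_eqF.
move: zr zi; rewrite /rt /st /rescaled /= -/(pt (x 0 0 / l, x 0 1 / l)) Ex.
by case: (u x t) => p q /= -> ->.
Qed.
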